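(* Let $\mathcal{G}$ be a $k$-perfect graph and $k\ge 1$. Then $\alpha_k(\mathcal{G})$ and $\Psi_k(\overline{\mathcal{G}})$ can be computed in polynomial time up to fixed precision.
   Context: All graphs are finite, simple and undirected; $k$ is an integer. $\alpha_k(\mathcal{G})$ is the maximum number of vertices of an induced subgraph of $\mathcal{G}$ that is $k$-colorable (each vertex can be assigned one of $k$ colors so that adjacent vertices get different colors). $\overline{\mathcal{G}}$ is the complement graph, $\chi$ the chromatic number (equal to $0$ for the graph with no vertices), $\mathcal{H}-\mathcal{S}$ the subgraph of $\mathcal{H}$ induced by the vertices not in $\mathcal{S}$, and $\mathcal{G}[\mathcal{S}]$ the subgraph of $\mathcal{G}$ induced by $\mathcal{S}$. For a graph $\mathcal{H}$ with vertex set $\mathcal{V}$, $\Psi_k(\mathcal{H}):=\min\{k\,\chi(\mathcal{H}-\mathcal{S})+|\mathcal{S}|:\mathcal{S}\subseteq\mathcal{V}\}$. A graph $\mathcal{G}=(\mathcal{V},\mathcal{E})$ is called $k$-perfect if $\alpha_k(\mathcal{G}[\mathcal{S}])=\Psi_k(\overline{\mathcal{G}[\mathcal{S}]})$ holds for all $\mathcal{S}\subseteq\mathcal{V}$. ''Computable in polynomial time up to fixed precision'' means: for every fixed $\varepsilon>0$ there is an algorithm that, given as input $k$ and a $k$-perfect graph $\mathcal{G}$, runs in time polynomial in the size of the input and outputs a number within $\varepsilon$ of the quantity in question. *)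

(* Defs.v *)
From HB Require Import structures.
From mathcomp Require Import all_boot all_order all_algebra.
From mathcomp Require Import reals.

Set Implicit Arguments.
Unset Strict Implicit.
Unset Printing Implicit Defensive.

Import Order.TTheory GRing.Theory Num.Theory.

Local Open Scope nat_scope.

Record sgraph := SGraph {
  vertex :> finType;
  edge : rel vertex;
  edge_sym : symmetric edge;
  edge_irrefl : irreflexive edge }.

Section Graphs.
Variable G : sgraph.

Definition compl_edge : rel G := [rel x y | (x != y) && ~~ edge x y].

Lemma compl_edge_sym : symmetric compl_edge.
Proof. by move=> x y; rewrite /compl_edge /= eq_sym edge_sym. Qed.

Lemma compl_edge_irrefl : irreflexive compl_edge.
Proof. by move=> x; rewrite /compl_edge /= eqxx. Qed.

Definition compl : sgraph := SGraph compl_edge_sym compl_edge_irrefl.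

Variable S : {set G}.

Definition induced_edge : rel {x : G | x \in S} :=
  [rel x y | edge (val x) (val y)].

Lemma induced_edge_sym : symmetric induced_edge.
Proof. by move=> x y; rewrite /induced_edge /= edge_sym. Qed.

Lemma induced_edge_irrefl : irreflexive induced_edge.
Proof. by move=> x; rewrite /induced_edge /= edge_irrefl. Qed.

Definition induced : sgraph := SGraph induced_edge_sym induced_edge_irrefl.

End Graphs.

Definition colorable (k : nat) (G : sgraph) : bool :=
  [exists c : {ffun G -> 'I_k}, forall x, forall y, edge x y ==> (c x != c y)].

Lemma colorable_ex (G : sgraph) : exists k, colorable k G.
Proof.
exists #|G|; apply/existsP; exists [ffun x => enum_rank x].
apply/forallP=> x; apply/forallP=> y; apply/implyP=> exy.
rewrite !ffunE (inj_eq enum_rank_inj).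
by apply: contraTneq exy => ->; rewrite edge_irrefl.
Qed.

Definition chi (G : sgraph) : nat := ex_minn (colorable_ex G).

Definition alpha (k : nat) (G : sgraph) : nat :=
  \max_(S : {set G} | colorable k (induced S)) #|S|.

Definition Psi_obj (k : nat) (H : sgraph) (S : {set H}) : nat :=
  k * chi (induced (~: S)) + #|S|.

Definition Psi (k : nat) (H : sgraph) : nat :=
  Psi_obj k [arg min_(S < [set: H]) Psi_obj k S].

Definition k_perfect (k : nat) (G : sgraph) : Prop :=
  forall S : {set G}, alpha k (induced S) = Psi k (compl (induced S)).

(* Algorithms are programs for a random access machine with integer registers,
   under the logarithmic cost criterion (Aho, Hopcroft and Ullman): an
   instruction costs the total bit length of the register indices and register
   contents that it handles. Up to polynomial factors this is Turing machine
   time. *)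

Definition bitlen (x : int) : nat := (trunc_log 2 `|x|).+1.

Inductive binop := Add | Sub | Mul | Div.

Definition eval_binop (o : binop) (x y : int) : int :=
  match o with
  | Add => (x + y)%R
  | Sub => (x - y)%R
  | Mul => (x * y)%R
  | Div => (x %/ y)%Z
  end.

Inductive instr :=
  | Const of nat & int                (* r_d := c *)
  | Binop of binop & nat & nat & nat  (* r_d := r_a o r_b *)
  | ReadInd of nat & nat                 (* r_d := r_(|r_a|) *)
  | WriteInd of nat & nat                (* r_(|r_a|) := r_b *)
  | Jump of nat
  | JumpZero of nat & nat             (* if r_a = 0, go to l *)
  | JumpPos of nat & nat.             (* if r_a > 0, go to l *)

Definition program := seq instr.
Definition memory := nat -> int.

Definition update (m : memory) (d : nat) (v : int) : memory :=
  fun i => if i == d then v else m i.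

Definition step (i : instr) (pc : nat) (m : memory) : nat * memory :=
  match i with
  | Const d c => (pc.+1, update m d c)
  | Binop o d a b => (pc.+1, update m d (eval_binop o (m a) (m b)))
  | ReadInd d a => (pc.+1, update m d (m `|m a|))
  | WriteInd a b => (pc.+1, update m `|m a| (m b))
  | Jump l => (l, m)
  | JumpZero a l => (if m a == 0%R then l else pc.+1, m)
  | JumpPos a l => (if (0 < m a)%R then l else pc.+1, m)
  end.

Definition cost (i : instr) (m : memory) : nat :=
  match i with
  | Const d c => bitlen d + bitlen c
  | Binop _ d a b =>
      bitlen d + (bitlen a + bitlen (m a)) + (bitlen b + bitlen (m b))
  | ReadInd d a => bitlen d + (bitlen a + bitlen (m a) + bitlen (m `|m a|))
  | WriteInd a b => (bitlen a + bitlen (m a)) + (bitlen b + bitlen (m b))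
  | Jump _ => 1
  | JumpZero a _ | JumpPos a _ => bitlen a + bitlen (m a)
  end.

(* [exec P pc m t m']: started at instruction [pc] with memory [m], the program
   [P] halts (by leaving its code) after time [t] with memory [m']. *)
Inductive exec (P : program) : nat -> memory -> nat -> memory -> Prop :=
  | ExecHalt pc m : size P <= pc -> exec P pc m 0 m
  | ExecStep pc m i t m' :
      onth P pc = Some i ->
      exec P (step i pc m).1 (step i pc m).2 t m' ->
      exec P pc m (cost i m + t) m'.

(* [k] (its bit length counts in the input size), the number of vertices, and
   the adjacency matrix row by row. *)
Definition encode (k : nat) (G : sgraph) : seq int :=
  [:: Posz k, Posz #|G| &
      [seq Posz (edge x y) | x <- enum G, y <- enum G]].

Definition input_size (s : seq int) : nat := \sum_(x <- s) bitlen x.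

Definition load_input (s : seq int) : memory := fun i => nth 0%R s i.

(* The output is the rational number r_0 / r_1. On inputs outside [dom] nothing
   is required of the program, not even termination. *)
Definition computes_within (R : realType) (eps : R)
    (dom : nat -> sgraph -> Prop) (f : nat -> sgraph -> nat)
    (P : program) (p : {poly nat}) : Prop :=
  forall (k : nat) (G : sgraph), dom k G ->
  exists (t : nat) (m : memory),
    [/\ exec P 0 (load_input (encode k G)) t m,
        t <= p.[input_size (encode k G)]%R,
        (0 < m 1%N)%R &
        (`|(m 0%N)%:~R / (m 1%N)%:~R - (f k G)%:R| <= eps :> R)%R].

Definition polytime_up_to_fixed_precision (R : realType)
    (dom : nat -> sgraph -> Prop) (f : nat -> sgraph -> nat) : Prop :=
  forall eps : R, (0 < eps)%R ->
  exists (P : program) (p : {poly nat}), computes_within eps dom f P p.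

(* Main.v *)
(* alpha_k(G) is the stability number of the Cartesian product of G with K_k,
   and an S attaining Psi_k of the complement turns into a cover of this product
   by Psi_k cliques: the (colour class) x {c} and the {v} x K_k for v in S. As
   k > n may be replaced by n, k-perfection gives a graph H on N <= n^2 vertices
   in which a stable set and a clique cover have the same size a, and it is
   enough to compute a exactly.

   To decide between a <= t and a > t one looks for a positive semidefinite S
   that vanishes on the edges of H and has <J, S> = (t + 1/2) tr S, up to an
   error of 1/poly(N) relative to tr S. For a <= t there is none, because
   <J, S> <= a (tr S + the sum of the entries of S on the covering cliques).
   The search is a perceptron iteration: keep an integer matrix S and add to it
   a rounded multiple of a matrix Y >= 0 on which the gradient M of the squared
   error is not much larger than 0, so that the squared error grows linearly in
   the number of steps and the relative error tends to 0. Such a Y exists as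
   soon as M is not positive definite, which a stable set of more than t
   vertices witnesses, and then it is found among the powers of B = c I - M: if
   <M, B^p> >= Q tr B^p for all p < P, then tr B^P <= (c - Q)^P N, whereas a
   vector v with v^T M v <= 0 gives tr B^P >= c^P. All matrices are integral with
   polynomially many bits, so nothing beyond integer arithmetic is involved.

   The algorithm is written in a small language of assignments and bounded loops
   which is compiled to the random access machine. *)
Require Import Defs.
From mathcomp Require Import all_boot all_order all_algebra.
From mathcomp Require Import reals.
From mathcomp Require Import zify ring lra.

Set Implicit Arguments.
Unset Strict Implicit.
Unset Printing Implicit Defensive.

Import Order.TTheory GRing.Theory Num.Theory.

(** * Positive semidefinite integer matrices *)

Local Open Scope ring_scope.

(** The integer [k] contributes only its bit length to the input size, so the product with [K_k] can
    be exponentially large; passing to [minn k n] is what keeps the graph polynomial. Exact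
    semidefinite feasibility would lead to irrational matrices. Since the stable set and the clique
    cover have the same integral size, the threshold t + 1/2 keeps a fixed distance from both
    outcomes, and this slack absorbs every rounding error. Rounding costs S its semidefiniteness,
    and S is never tested for it: the cover argument sees S only through one linear inequality,
    whose violation grows by at most N^3 per step and is carried along as an invariant. Likewise no
    eigenvector is computed: if no power of B works, the traces decay geometrically, and Bernoulli's
    inequality makes this contradictory after polynomially many powers. The tests for t = 1, ..., N
    - 1 are all run and their positive answers are counted, because the language has no early
    exit. *)

Section Forms.
Variable N : nat.
Implicit Types (A B Y Z M : 'M[int]_N) (x y v : 'cV[int]_N).

Definition bform Y x y : int := (x^T *m Y *m y) 0 0.

Lemma bformE Y x y : bform Y x y = \sum_i \sum_j x i 0 * Y i j * y j 0.
Proof.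
rewrite /bform mxE exchange_big /=; apply: eq_bigr => j _.
by rewrite !mxE mulr_suml; apply: eq_bigr => i _; rewrite !mxE.
Qed.

Lemma bformDl Y x1 x2 y : bform Y (x1 + x2) y = bform Y x1 y + bform Y x2 y.
Proof. by rewrite /bform linearD /= !mulmxDl mxE. Qed.
Lemma bformDr Y x y1 y2 : bform Y x (y1 + y2) = bform Y x y1 + bform Y x y2.
Proof. by rewrite /bform mulmxDr mxE. Qed.
Lemma bformZl Y a x y : bform Y (a *: x) y = a * bform Y x y.
Proof. by rewrite /bform linearZ /= -!scalemxAl mxE. Qed.
Lemma bformZr Y a x y : bform Y x (a *: y) = a * bform Y x y.
Proof. by rewrite /bform -scalemxAr mxE. Qed.

Lemma bform_delta Y i j : bform Y (delta_mx i 0) (delta_mx j 0) = Y i j.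
Proof. by rewrite /bform trmx_delta -rowE -colE !mxE. Qed.

Lemma bform_sym Y x y : Y^T = Y -> bform Y x y = bform Y y x.
Proof.
move=> Ys; have tr00 (A : 'M[int]_1) : A 0 0 = A^T 0 0 by rewrite mxE.
by rewrite /bform tr00 !trmx_mul trmxK Ys mulmxA.
Qed.

Definition psd Y := (Y^T = Y) /\ forall x, 0 <= bform Y x x.

Lemma psd_comb Y x y a b : psd Y ->
  0 <= a ^+ 2 * bform Y x x + 2 * a * b * bform Y x y + b ^+ 2 * bform Y y y.
Proof.
move=> [Ys /(_ (a *: x + b *: y))].
rewrite bformDl !bformDr !bformZl !bformZr (bform_sym y x Ys).
by congr (_ <= _); ring.
Qed.

Lemma psd_diag Y i : psd Y -> 0 <= Y i i.
Proof. by case=> _ /(_ (delta_mx i 0)); rewrite bform_delta. Qed.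

Lemma psd_tr_ge0 Y : psd Y -> 0 <= \tr Y.
Proof. by move=> pY; apply: sumr_ge0 => i _; apply: psd_diag. Qed.

Lemma psd_diag_le_tr Y i : psd Y -> Y i i <= \tr Y.
Proof.
move=> pY; rewrite /mxtrace (bigD1 i) //= lerDl.
by apply: sumr_ge0 => j _; apply: psd_diag.
Qed.

(** Positivity on e_i + e_j and on e_i - e_j gives 2 |Y_ij| <= Y_ii + Y_jj. *)
Lemma psd_entry_le_tr Y i j : psd Y -> `|Y i j| <= \tr Y.
Proof.
move=> pY; have ii := psd_diag_le_tr i pY; have jj := psd_diag_le_tr j pY.
have := psd_comb (delta_mx i 0) (delta_mx j 0) 1 1 pY.
have := psd_comb (delta_mx i 0) (delta_mx j 0) 1 (-1) pY.
rewrite !bform_delta; lia.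
Qed.

(* Positivity on [v_j e_i - v_i e_j], summed over all i and j. *)
Lemma psd_le_tr Y v : psd Y -> bform Y v v <= \tr Y * (\sum_i v i 0 ^+ 2).
Proof.
move=> pY.
have : 0 <= \sum_i \sum_j (v j 0 ^+ 2 * Y i i + 2 * v j 0 * (- v i 0) * Y i j
                           + (- v i 0) ^+ 2 * Y j j).
  apply: sumr_ge0 => i _; apply: sumr_ge0 => j _.
  by have := psd_comb (delta_mx i 0) (delta_mx j 0) (v j 0) (- v i 0) pY; rewrite !bform_delta.
rewrite (eq_bigr (fun i => (Y i i * \sum_j v j 0 ^+ 2 + v i 0 ^+ 2 * \tr Y)
   - 2 * \sum_j v i 0 * Y i j * v j 0)); last first.
  move=> i _; rewrite !mulr_sumr -sumrN -!big_split /=.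
  by apply: eq_bigr => j _; ring.
rewrite sumrB big_split /= -!mulr_suml -mulr_sumr -bformE.
rewrite -/(\tr Y) (mulrC _ (\tr Y)); move: (\tr Y * _) (bform _ _ _); lia.
Qed.

(* Positivity on the differences of the indicator vectors of the classes of f. *)
Lemma psd_cover q (f : 'I_N -> 'I_q) Y : psd Y ->
  \sum_i \sum_j Y i j <= q%:Z * \sum_i \sum_j (f i == f j)%:R * Y i j.
Proof.
move=> pY; pose x c : 'cV[int]_N := \col_i (f i == c)%:R.
have Ecd c d : bform Y (x c) (x d) = \sum_i \sum_j (f i == c)%:R * (f j == d)%:R * Y i j.
  rewrite bformE; apply: eq_bigr => i _; apply: eq_bigr => j _.
  by rewrite !mxE; ring.
have E1 (g : 'I_N -> 'I_q) i : \sum_c (g i == c)%:R = 1 :> int.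
  rewrite (bigD1 (g i)) //= eqxx big1 ?addr0 // => c /negPf.
  by rewrite eq_sym => ->.
have all : \sum_c \sum_d bform Y (x c) (x d) = \sum_i \sum_j Y i j.
  under eq_bigr => c _ do under eq_bigr => d _ do rewrite Ecd.
  under eq_bigr => c _ do rewrite exchange_big.
  rewrite exchange_big; apply: eq_bigr => i _.
  under eq_bigr => c _ do rewrite exchange_big.
  rewrite exchange_big; apply: eq_bigr => j _ /=.
  under eq_bigr => c _ do rewrite -mulr_suml -mulr_sumr E1 mulr1.
  by rewrite -mulr_suml E1 mul1r.
have dia : \sum_c bform Y (x c) (x c) = \sum_i \sum_j (f i == f j)%:R * Y i j.
  under eq_bigr => c _ do rewrite Ecd.
  rewrite exchange_big; apply: eq_bigr => i _.
  rewrite exchange_big; apply: eq_bigr => j _ /=.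
  rewrite -mulr_suml; congr (_ * _).
  rewrite (bigD1 (f i)) //= eqxx mul1r big1 ?addr0 1?eq_sym // => c /negPf.
  by rewrite eq_sym => ->; rewrite mul0r.
have : 0 <= \sum_c \sum_d (bform Y (x c) (x c) - 2 * bform Y (x c) (x d) + bform Y (x d) (x d)).
  apply: sumr_ge0 => c _; apply: sumr_ge0 => d _.
  by have := psd_comb (x c) (x d) 1 (-1) pY; congr (_ <= _); ring.
under eq_bigr => c _.
  rewrite big_split sumrB /= sumr_const card_ord -mulr_sumr dia.
  over.
rewrite big_split sumrB /= sumr_const card_ord -mulr_sumr all sumrMnl dia.
by move: (\sum_i \sum_j Y i j) (\sum_i _) => a b; rewrite -(mulr_natl b) natz; lia.
Qed.

Lemma bform_mul B Y x y : B^T = B -> bform (B *m Y *m B) x y = bform Y (B *m x) (B *m y).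
Proof. by move=> Bs; rewrite /bform trmx_mul Bs !mulmxA. Qed.

Lemma psd1 : psd 1%:M.
Proof.
split=> [|x]; first exact: trmx1.
rewrite bformE; apply: sumr_ge0 => i _; rewrite (bigD1 i) //= big1 => [|j ji].
  by rewrite mxE eqxx addr0 mulr1 -expr2 sqr_ge0.
by rewrite mxE eq_sym (negPf ji) mulr0 mul0r.
Qed.

Lemma psd_mul B Y : B^T = B -> psd Y -> psd (B *m Y *m B).
Proof.
move=> Bs [Ys pY]; split=> [|x]; first by rewrite !trmx_mul Bs Ys mulmxA.
by rewrite bform_mul.
Qed.

(** B^(p+2) = B B^p B is a congruence of B^p, so the induction proceeds in steps of two and avoids
    square roots and eigenvalues. *)
Lemma psd_exp B p : psd B -> psd (B ^+ p).
Proof.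
move=> pB; elim/ltn_ind: p => -[|[|p]] IH; first by rewrite expr0; exact: psd1.
  by rewrite expr1.
rewrite exprS exprSr mulrA; apply: psd_mul; first by case: pB.
exact: IH.
Qed.

(* Positivity of [B^p] on [B v - c v] makes [s (p+1) - c * s p] nonnegative for
   [s p := v^T B^p v]. *)
Lemma psd_exp_lower B v c p : psd B -> 0 <= c ->
  c * bform 1%:M v v <= bform B v v ->
  c ^+ p * bform 1%:M v v <= bform (B ^+ p) v v.
Proof.
move=> pB c0 h1; have Bs : B^T = B by case: pB.
pose s p := bform (B ^+ p) v v.
have rec k : 0 <= s k.+2 - 2 * c * s k.+1 + c ^+ 2 * s k.
  have := psd_comb (B *m v) v 1 (- c) (psd_exp k pB).
  rewrite -bform_mul //.
  have -> : bform (B ^+ k) (B *m v) v = s k.+1.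
    by rewrite /s exprS /bform trmx_mul Bs !mulmxA.
  have -> : B *m B ^+ k *m B = B ^+ k.+2.
    by rewrite exprS exprSr mulrA.
  by rewrite -/(s _); congr (_ <= _); rewrite /s; ring.
have d k : 0 <= s k.+1 - c * s k.
  elim: k => [|k IH]; first by rewrite /s expr1 expr0 subr_ge0.
  apply: le_trans (mulr_ge0 c0 IH) _; rewrite -subr_ge0.
  by have := rec k; congr (_ <= _); ring.
elim: p => [|p IH]; first by rewrite !expr0 mul1r.
apply: le_trans (_ : c * s p <= _); last by rewrite -subr_ge0; exact: d.
by rewrite exprS -mulrA; apply: ler_wpM2l.
Qed.

(** Diagonal dominance: a pair i, j contributes mu a^2 - 2 m a b + mu b^2 with m = M_ij, which is
    half of (mu - m)(a + b)^2 + (mu + m)(a - b)^2. Summed over ordered pairs this is twice the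
    form. *)
Lemma psd_shift M (mu : int) : M^T = M -> (forall i j, `|M i j| <= mu) ->
  psd ((N%:Z * mu)%:M - M).
Proof.
move=> Ms bM; split=> [|x]; first by rewrite linearB /= Ms tr_scalar_mx.
have -> : bform ((N%:Z * mu)%:M - M) x x
   = \sum_i \sum_j (mu * x i 0 ^+ 2 - x i 0 * M i j * x j 0).
  rewrite bformE; apply: eq_bigr => i _.
  under eq_bigr => j _ do rewrite mxE mulrDr mulrDl.
  rewrite sumrB big_split /=; congr (_ + _).
    rewrite (bigD1 i) //= big1 => [|j ji].
      rewrite !mxE eqxx mulr1n sumr_const card_ord -(mulr_natr (mu * _)) natz; ring.
    by rewrite mxE eq_sym (negPf ji) mulr0 mul0r.
  by rewrite -sumrN; apply: eq_bigr => j _; rewrite mxE; ring.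
have h : 0 <= \sum_i \sum_j (mu * x i 0 ^+ 2 - 2 * (x i 0 * M i j * x j 0) + mu * x j 0 ^+ 2).
  apply: sumr_ge0 => i _; apply: sumr_ge0 => j _; have := bM i j.
  move: (x i 0) (x j 0) (M i j) => a b m hm.
  have p1 : 0 <= (mu - m) * (a + b) ^+ 2 by rewrite mulr_ge0 ?sqr_ge0 //; lia.
  have p2 : 0 <= (mu + m) * (a - b) ^+ 2 by rewrite mulr_ge0 ?sqr_ge0 //; lia.
  lra.
have sw : \sum_(i < N) \sum_(j < N) mu * x j 0 ^+ 2 = \sum_(i < N) \sum_(j < N) mu * x i 0 ^+ 2.
  exact: exchange_big.
suff E : \sum_i \sum_j (mu * x i 0 ^+ 2 - 2 * (x i 0 * M i j * x j 0) + mu * x j 0 ^+ 2)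
       = 2 * \sum_i \sum_j (mu * x i 0 ^+ 2 - x i 0 * M i j * x j 0).
  by rewrite -(@pmulr_rge0 _ 2) // -E.
under eq_bigr => i _ do rewrite big_split.
rewrite big_split /= sw -big_split mulr_sumr; apply: eq_bigr => i _ /=.
rewrite -big_split mulr_sumr; apply: eq_bigr => j _ /=; ring.
Qed.

Definition ip A B : int := \sum_i \sum_j A i j * B i j.

Lemma ipDr A B1 B2 : ip A (B1 + B2) = ip A B1 + ip A B2.
Proof.
rewrite /ip -big_split; apply: eq_bigr => i _; rewrite -big_split.
by apply: eq_bigr => j _; rewrite mxE mulrDr.
Qed.

(** Used with Y a power of B = c I - M, as the recursion for the traces of the powers of B. *)
Lemma tr_mul_shift M Y (c : int) : M^T = M -> \tr (Y *m (c%:M - M)) = c * \tr Y - ip M Y.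
Proof.
move=> Ms; rewrite mulmxBr linearB /= mul_mx_scalar linearZ /=; congr (_ - _).
apply: eq_bigr => i _; rewrite mxE; apply: eq_bigr => j _.
by rewrite -[in LHS]Ms mxE mulrC.
Qed.
End Forms.

(** * The perceptron test *)

Lemma norm_sum_le n (F : 'I_n -> int) a : (forall i, `|F i| <= a) ->
  `|\sum_i F i| <= n%:Z * a.
Proof.
move=> h; apply: le_trans (ler_norm_sum _ _ _) _.
apply: le_trans (ler_sum _ (fun i _ => h i)) _.
by rewrite sumr_const card_ord -mulr_natl natz.
Qed.

Lemma norm_ip_le n (A B : 'M[int]_n) (a b : int) :
  (forall i j, `|A i j| <= a) -> (forall i j, `|B i j| <= b) ->
  `|ip A B| <= n%:Z * (n%:Z * (a * b)).
Proof.
move=> hA hB; apply: norm_sum_le => i; apply: norm_sum_le => j.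
by rewrite normrM ler_pM.
Qed.

(** Bernoulli's inequality (1 + 1/c)^p >= 1 + p/c with cleared denominators. *)
Lemma bernoulli_int (c : int) p : 0 <= c -> c ^+ p * (c + p%:Z) <= (c + 1) ^+ p * c.
Proof.
move=> c0; elim: p => [|p IH]; first by rewrite !expr0; lia.
rewrite !exprS; have := exprn_ge0 p c0; move: IH.
set x := c ^+ p; set y := (_ + 1) ^+ p; nia.
Qed.

(** For p = n c Bernoulli gives (c + 1)^p >= (1 + n) c^p. Together with (c - 1)(c + 1) <= c^2,
    raised to the power p, this yields (1 + n)(c - 1)^p <= c^p. *)
Lemma power_gap (n : nat) (c : int) p : 0 < c -> p%:Z = n%:Z * c ->
  n%:Z * (c - 1) ^+ p < c ^+ p.
Proof.
move=> c0 pE; have b := @bernoulli_int c p (ltW c0).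
have {}b : c ^+ p * (1 + n%:Z) <= (c + 1) ^+ p.
  rewrite -(@ler_pM2r _ c) //; apply: le_trans b.
  by rewrite pE le_eqVlt; apply/orP; left; apply/eqP; ring.
have cp : 0 < c ^+ p by rewrite exprn_gt0.
have c1 : 0 <= (c - 1) ^+ p by rewrite exprn_ge0 //; lia.
have : (c - 1) ^+ p * (c + 1) ^+ p <= c ^+ p * c ^+ p.
  by rewrite -!exprMn lerXn2r ?nnegrE; nia.
move: (c ^+ p) ((c - 1) ^+ p) ((c + 1) ^+ p) b cp c1 => x y z.
by nia.
Qed.

Lemma sum_ltn n a : (\sum_(t < n) (t.+1 < a : nat) = minn n a.-1)%N.
Proof.
elim: n => [|n IH]; first by rewrite big_ord0 min0n.
by rewrite big_ord_recr /= IH; lia.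
Qed.

Section Algorithm.
Variable N : nat.
Hypothesis N_gt0 : (0 < N)%N.
(* With Q the size of one update, the squared error [Phi] grows by at most
   9 N^6 Q^2 per step and hence is at most (3 N^3 Q R)^2 after T = R^2 steps; R is
   chosen so that this beats tr S >= T (Q - N). The entries of the gradient are at
   most 5 N^4 T Q, which dictates the shift c = Q c' and the rounding precision Q;
   Q is also the number N c' of matrix powers that have to be tried. *)
Definition nR : nat := 36 * N ^ 6.
Definition nT : nat := nR * nR.
Definition nQ : nat := 5 * N ^ 6 * nT.
Definition nc' : nat := 5 * N ^ 5 * nT.
Definition nc : nat := nQ * nc'.
Notation T := nT. Notation Q := nQ. Notation c := nc.

Variable e : rel 'I_N.
Hypotheses (e_sym : symmetric e) (e_irr : irreflexive e).
Implicit Types (S Y M : 'M[int]_N).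

Section Test.
Variable t : nat.
Hypothesis t_gt0 : (0 < t)%N.
Hypothesis t_lt : (t < N)%N.

(* Up to a factor 2, [Dval] is (t + 1/2) tr S - <J, S>. *)
Definition Kmx : 'M[int]_N := \matrix_(i, j) ((2 * t + 1)%:Z * (i == j)%:R - 2).
Definition Dval S : int := ip Kmx S.
(** Half the gradient at S of the squared error [Phi]; see [PhiD]. *)
Definition Mmx S : 'M[int]_N := \matrix_(i, j) ((e i j)%:R * S i j + Dval S * Kmx i j).
Definition good M Y : bool := ip M Y < Q%:Z * \tr Y.
Definition nextY M Y : 'M[int]_N := if good M Y then Y else Y *m (c%:Z%:M - M).
Definition iterY M p : 'M[int]_N := iter p (nextY M) 1%:M.
Definition addS Y S : 'M[int]_N := \matrix_(i, j) (S i j + (Q%:Z * Y i j %/ \tr Y)%Z).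
(** A failed step leaves S unchanged, so that all later steps fail too; the flag tells whether every
    step has succeeded. *)
Definition nextS (z : 'M[int]_N * bool) :=
  let M := Mmx z.1 in let Y := iterY M Q in
  if good M Y then (addS Y z.1, z.2) else (z.1, false).
Definition runS s := iter s nextS (0, true).

Let n : int := N%:Z.
Let TZ : int := T%:Z.
Let QZ : int := Q%:Z.
Let RZ : int := nR%:Z.
Let cZ : int := nc'%:Z.
Let n1 : 1 <= n. Proof. by rewrite /n; lia. Qed.
Let RE : RZ = 36 * n ^+ 6.
Proof. by rewrite /RZ /nR PoszM -(natz (N ^ 6)) natrX natz. Qed.
Let TE : TZ = RZ * RZ. Proof. by rewrite /TZ /nT PoszM. Qed.
Let QE : QZ = 5 * n ^+ 6 * TZ. Proof. by rewrite /QZ /nQ 2!PoszM -(natz (N ^ 6)) natrX natz. Qed.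
Let cE : cZ = 5 * n ^+ 5 * TZ. Proof. by rewrite /cZ /nc' 2!PoszM -(natz (N ^ 5)) natrX natz. Qed.
Let QnE : QZ = n * cZ. Proof. by rewrite QE cE; ring. Qed.
Let expn1 k : 1 <= n ^+ k. Proof. exact: exprn_ege1. Qed.
Let R1 : 1 <= RZ. Proof. by rewrite RE; have := expn1 6; lia. Qed.
Let T1 : 1 <= TZ. Proof. by rewrite TE; nia. Qed.
Let c1 : 1 <= cZ. Proof. by rewrite cE; have := expn1 5; nia. Qed.
Let Q1 : 1 <= QZ. Proof. by rewrite QnE; nia. Qed.

Let Q0 : 0 <= QZ. Proof. exact: le_trans Q1. Qed.

Let mu : int := 5 * n ^+ 4 * TZ * QZ.
Let cmu : c%:Z = n * mu.
Proof. by rewrite /nc PoszM -/QZ -/cZ cE /mu; ring. Qed.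

Lemma Kmx_bound i j : `|Kmx i j| <= 2 * n.
Proof. rewrite mxE; rewrite /n; case: eqP => _ /=; lia. Qed.

Lemma Dval_bound S a : 0 <= a -> (forall i j, `|S i j| <= a) -> `|Dval S| <= 2 * n ^+ 3 * a.
Proof.
move=> a0 hS; apply: le_trans (norm_ip_le Kmx_bound hS) _.
by rewrite le_eqVlt; apply/orP; left; apply/eqP; rewrite -/n; ring.
Qed.

Lemma Mmx_sym S : S^T = S -> (Mmx S)^T = Mmx S.
Proof.
move=> Ss; apply/matrixP=> i j; rewrite !mxE e_sym [j == i]eq_sym.
by rewrite -{1}Ss mxE.
Qed.

Lemma Mmx_bound S : (forall i j, `|S i j| <= TZ * QZ) -> forall i j, `|Mmx S i j| <= mu.
Proof.
move=> hS i j; have a0 : 0 <= TZ * QZ by nia.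
have hD := Dval_bound a0 hS; have hK := Kmx_bound i j; rewrite mxE.
have : `|(e i j)%:R * S i j| <= TZ * QZ.
  by case: (e i j); rewrite ?mul1r ?mul0r ?normr0.
have : `|Dval S * Kmx i j| <= (2 * n ^+ 3 * (TZ * QZ)) * (2 * n).
  by rewrite normrM ler_pM.
have -> : (2 * n ^+ 3 * (TZ * QZ)) * (2 * n) = 4 * n ^+ 4 * (TZ * QZ) by ring.
have -> : mu = 5 * n ^+ 4 * (TZ * QZ) by rewrite /mu; ring.
have := expn1 4; move: (n ^+ 4) => m4 hm.
have : TZ * QZ <= m4 * (TZ * QZ) by rewrite ler_peMl.
move: (Dval S * Kmx i j) ((e i j)%:R * S i j) (TZ * QZ) => x y z; lia.
Qed.

Definition Phi S : int := (\sum_i \sum_j (e i j)%:R * S i j ^+ 2) + Dval S ^+ 2.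

Lemma PhiD S Y : Phi (S + Y) = Phi S + 2 * ip (Mmx S) Y + Phi Y.
Proof.
rewrite /Phi [Dval (_ + _)]ipDr -/(Dval S) -/(Dval Y).
have -> : ip (Mmx S) Y = \sum_i \sum_j (e i j)%:R * S i j * Y i j + Dval S * Dval Y.
  rewrite /ip /Dval {2}/ip mulr_sumr -big_split; apply: eq_bigr => i _ /=.
  by rewrite mulr_sumr -big_split; apply: eq_bigr => j _ /=; rewrite [Mmx _ _ _]mxE; ring.
have -> : \sum_i \sum_j (e i j)%:R * (S + Y) i j ^+ 2 =
    \sum_i \sum_j (e i j)%:R * S i j ^+ 2
    + (2 * \sum_i \sum_j (e i j)%:R * S i j * Y i j
    + \sum_i \sum_j (e i j)%:R * Y i j ^+ 2).
  rewrite mulr_sumr -!big_split; apply: eq_bigr => i _ /=.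
  rewrite mulr_sumr -!big_split; apply: eq_bigr => j _ /=.
  by rewrite mxE; ring.
ring.
Qed.

Lemma Phi_edge S i j : e i j -> S i j ^+ 2 <= Phi S.
Proof.
move=> eij; rewrite /Phi (bigD1 i) //= (bigD1 j) //= eij mul1r -!addrA lerDl.
have p k l : 0 <= (e k l)%:R * S k l ^+ 2 by rewrite mulr_ge0 ?sqr_ge0.
apply: addr_ge0; first exact: sumr_ge0.
by rewrite addr_ge0 ?sqr_ge0 // sumr_ge0 // => k _; exact: sumr_ge0.
Qed.

Lemma Phi_Dval S : Dval S ^+ 2 <= Phi S.
Proof.
rewrite /Phi lerDr sumr_ge0 // => k _; apply: sumr_ge0 => l _.
by rewrite mulr_ge0 ?sqr_ge0.
Qed.

Lemma Phi_bound Y : (forall i j, `|Y i j| <= QZ) -> Phi Y <= 5 * n ^+ 6 * QZ ^+ 2.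
Proof.
move=> hY; have hD := Dval_bound Q0 hY.
have h1 : \sum_i \sum_j (e i j)%:R * Y i j ^+ 2 <= n * (n * QZ ^+ 2).
  apply: le_trans (ler_norm _) _; apply: norm_sum_le => i; apply: norm_sum_le => j.
  case: (e i j); rewrite ?mul1r ?mul0r ?normr0 ?sqr_ge0 //.
  by rewrite normrX lerXn2r ?nnegrE // hY.
have h2 : Dval Y ^+ 2 <= (2 * n ^+ 3 * QZ) ^+ 2.
  by rewrite -(real_normK (num_real (Dval Y))) lerXn2r ?nnegrE.
rewrite /Phi; apply: le_trans (lerD h1 h2) _.
have -> : (2 * n ^+ 3 * QZ) ^+ 2 = 4 * (n ^+ 6 * QZ ^+ 2) by ring.
have -> : n * (n * QZ ^+ 2) = n ^+ 2 * QZ ^+ 2 by ring.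
have : n ^+ 2 * QZ ^+ 2 <= n ^+ 6 * QZ ^+ 2.
  by rewrite ler_wpM2r ?sqr_ge0 // ler_weXn2l.
have -> : 5 * n ^+ 6 * QZ ^+ 2 = 5 * (n ^+ 6 * QZ ^+ 2) by ring.
lia.
Qed.

Definition rnd Y : 'M[int]_N := \matrix_(i, j) (QZ * Y i j %/ \tr Y)%Z.
Lemma addSE Y S : addS Y S = S + rnd Y.
Proof. by apply/matrixP=> i j; rewrite !mxE. Qed.

Section Rounding.
Variable Y : 'M[int]_N.
Hypotheses (pY : psd Y) (tr_gt0 : 0 < \tr Y).
Definition rnd_rem : 'M[int]_N := \matrix_(i, j) (QZ * Y i j %% \tr Y)%Z.
Lemma rndE i j : \tr Y * rnd Y i j = QZ * Y i j - rnd_rem i j.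
Proof.
rewrite !mxE mulrC; apply/eqP; rewrite eq_sym subr_eq; apply/eqP.
exact: divz_eq.
Qed.
Lemma rem_bounds i j : 0 <= rnd_rem i j <= \tr Y.
Proof.
rewrite mxE modz_ge0 ?gt_eqF //=; apply: ltW.
by rewrite -{2}(gtr0_norm tr_gt0) ltz_mod ?gt_eqF.
Qed.
Lemma rnd_bound i j : `|rnd Y i j| <= QZ.
Proof.
have h1 := psd_entry_le_tr i j pY; have h2 := rndE i j.
have h3 : 0 <= rnd_rem i j < \tr Y.
  by rewrite mxE modz_ge0 ?gt_eqF //= -{2}(gtr0_norm tr_gt0) ltz_mod ?gt_eqF.
have h4 : QZ * `|Y i j| <= QZ * \tr Y by rewrite ler_wpM2l.
have {h1}h4 : - (QZ * \tr Y) <= QZ * Y i j <= QZ * \tr Y.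
  by move: h4 h1; have := Q1; move: (Y i j) => y; case: (leP 0 y) => y0; rewrite ?(ger0_norm y0) ?(ltr0_norm y0); nia.
move: tr_gt0 h2 h3 h4; move: (QZ * Y i j) (rnd Y i j) (rnd_rem i j) (\tr Y) => a x r tau.
have := Q1; move: QZ => q q1 tau0 h2 h3 h4.
have u : x <= q by rewrite leNgt; apply/negP => lt; nia.
have l : - q <= x by rewrite leNgt; apply/negP => lt; nia.
lia.
Qed.

Lemma ip_rnd M (m : int) : (forall i j, `|M i j| <= m) ->
  \tr Y * ip M (rnd Y) <= QZ * ip M Y + n * (n * (m * \tr Y)).
Proof.
move=> hM; have -> : \tr Y * ip M (rnd Y) = QZ * ip M Y - ip M rnd_rem.
  rewrite /ip !mulr_sumr -sumrB; apply: eq_bigr => i _.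
  rewrite !mulr_sumr -sumrB; apply: eq_bigr => j _.
  by rewrite mulrCA rndE; ring.
rewrite lerD2l; apply: le_trans (ler_norm _) _; rewrite normrN.
apply: norm_ip_le => // i j; have /andP[r0 r1] := rem_bounds i j.
by rewrite ger0_norm.
Qed.

Lemma tr_rnd : QZ - n <= \tr (rnd Y).
Proof.
rewrite -(ler_pM2l tr_gt0).
have -> : \tr Y * \tr (rnd Y) = QZ * \tr Y - \sum_i rnd_rem i i.
  rewrite /mxtrace !mulr_sumr -sumrB; apply: eq_bigr => i _.
  by rewrite rndE.
have : `|\sum_i rnd_rem i i| <= n * \tr Y.
  apply: norm_sum_le => i; have /andP[r0 r1] := rem_bounds i i.
  by rewrite ger0_norm.
move: (\sum_i _) (\tr Y) => a b; have := Q1; move: QZ n => q m; nia.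
Qed.
End Rounding.

Lemma rnd_sym Y : Y^T = Y -> (rnd Y)^T = rnd Y.
Proof. by move=> Ys; apply/matrixP=> i j; rewrite !mxE -{1}Ys mxE. Qed.

(** A semidefinite matrix of trace 0 vanishes, and the strict inequality in [good] excludes the zero
    matrix. This legitimates the division by the trace in [addS]. *)
Lemma good_tr_gt0 M Y : psd Y -> good M Y -> 0 < \tr Y.
Proof.
move=> pY; rewrite lt_neqAle psd_tr_ge0 // andbT; apply: contraTneq => tr0.
have Y0 i j : Y i j = 0.
  by apply/eqP; rewrite -normr_le0 tr0; apply: psd_entry_le_tr.
rewrite /good -tr0 mulr0 -leNgt /ip big1 // => i _; rewrite big1 // => j _.
by rewrite Y0 mulr0.
Qed.

(** Here s counts the successful steps. Semidefiniteness is absent because rounding destroys it. The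
    trace gains at least Q - n per step, since each diagonal entry loses at most 1 by rounding. *)
Definition invS (s : nat) S :=
  [/\ S^T = S, forall i j, `|S i j| <= s%:Z * QZ,
      Phi S <= s%:Z * (9 * n ^+ 6 * QZ ^+ 2)
    & s%:Z * (QZ - n) <= \tr S].

Lemma invS0 : invS 0 0.
Proof.
have D0 : Dval 0 = 0.
  by rewrite /Dval /ip big1 // => i _; rewrite big1 // => j _; rewrite [X in _ * X]mxE mulr0.
split; rewrite ?mul0r.
- exact: trmx0.
- by move=> i j; rewrite mxE normr0.
- rewrite /Phi D0 big1 // => i _; rewrite big1 // => j _.
  by rewrite mxE expr0n mulr0.
- by rewrite mxtrace0.
Qed.

Lemma invS_bound s S : (s <= nT)%N -> invS s S -> forall i j, `|S i j| <= TZ * QZ.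
Proof.
move=> sT [_ h _ _] i j; apply: le_trans (h i j) _.
by rewrite ler_wpM2r.
Qed.

Lemma invS_step s S Y : (s < nT)%N -> invS s S -> psd Y -> good (Mmx S) Y ->
  invS s.+1 (addS Y S).
Proof.
move=> sT iS pY gY; have tr_gt0 := good_tr_gt0 pY gY.
have bS := invS_bound (ltnW sT) iS.
case: iS => Ss hS hP htr; rewrite addSE.
have s1 : s.+1%:Z = s%:Z + 1 by rewrite -addn1 PoszD.
split.
- by rewrite linearD /= Ss rnd_sym //; case: pY.
- move=> i j; rewrite mxE s1 mulrDl mul1r; apply: le_trans (ler_normD _ _) _.
  by apply: lerD => //; apply: rnd_bound.
(* One Q^2 comes from [good], the other from rounding: the remainders cost n^2 mu, and n^2 mu = Q^2
   is exactly the choice Q = 5 n^6 T. The growth of [Phi] is then 4 Q^2 + 5 n^6 Q^2 <= 9 n^6 Q^2. *)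
- have h : ip (Mmx S) (rnd Y) <= 2 * QZ ^+ 2.
    rewrite -(ler_pM2l tr_gt0); apply: le_trans (ip_rnd tr_gt0 (Mmx_bound bS)) _.
    have -> : n * (n * (mu * \tr Y)) = QZ * QZ * \tr Y.
      by rewrite {1}QE /mu; ring.
    have : QZ * ip (Mmx S) Y <= QZ * (QZ * \tr Y).
      by rewrite ler_wpM2l ?Q0 //; apply: ltW.
    have -> : \tr Y * (2 * QZ ^+ 2) = QZ * (QZ * \tr Y) + QZ * QZ * \tr Y by ring.
    by rewrite lerD2r.
  have h2 := Phi_bound (rnd_bound pY tr_gt0); rewrite PhiD s1.
  have h3 : QZ ^+ 2 <= n ^+ 6 * QZ ^+ 2 by rewrite ler_peMl // sqr_ge0.
  have -> : (s%:Z + 1) * (9 * n ^+ 6 * QZ ^+ 2) =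
     s%:Z * (9 * n ^+ 6 * QZ ^+ 2) + 4 * (n ^+ 6 * QZ ^+ 2) + 5 * n ^+ 6 * QZ ^+ 2 by ring.
  apply: lerD => //; apply: lerD => //.
  by move: h h3; move: (ip _ _) (QZ ^+ 2) (n ^+ 6 * _) => x y z; lia.
- by rewrite linearD /= s1 mulrDl mul1r; apply: lerD => //; apply: tr_rnd.
Qed.

Section Cover.
Variables (q : nat) (f : 'I_N -> 'I_q).
Hypothesis fP : forall i j, f i = f j -> i != j -> e i j.
Hypothesis q_le : (q <= t)%N.
Let qn : q%:Z <= n. Proof. by rewrite /n; lia. Qed.

Definition sumall S : int := \sum_i \sum_j S i j.
Definition Hmx : 'M[int]_N := \matrix_(i, j) (f i == f j)%:R.
(** By [psd_cover] this is at most 0 on semidefinite matrices. It is linear, so for the accumulated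
    S, which is a sum of rounded semidefinite matrices, it exceeds 0 by no more than the accumulated
    rounding errors. *)
Definition cover_gap S : int := ip (const_mx 1 - q%:Z *: Hmx) S.

Lemma cover_gapE S : cover_gap S = sumall S - q%:Z * \sum_i \sum_j (f i == f j)%:R * S i j.
Proof.
rewrite /cover_gap /ip /sumall mulr_sumr -sumrB; apply: eq_bigr => i _.
by rewrite mulr_sumr -sumrB; apply: eq_bigr => j _; rewrite !mxE; ring.
Qed.

Lemma cover_gap_rnd Y : psd Y -> 0 < \tr Y -> cover_gap (rnd Y) <= n ^+ 3.
Proof.
move=> pY tr_gt0; have := psd_cover f pY; rewrite -subr_le0 -cover_gapE => h.
rewrite -(ler_pM2l tr_gt0).
have b i j : `|(const_mx 1 - q%:Z *: Hmx) i j| <= n.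
  by rewrite !mxE; move: qn n1; case: eqP => _ /=; rewrite ?mulr0; lia.
apply: le_trans (ip_rnd tr_gt0 b) _; rewrite -/(cover_gap Y).
have -> : n * (n * (n * \tr Y)) = \tr Y * n ^+ 3 by ring.
by rewrite gerDr mulr_ge0_le0.
Qed.

Lemma cover_gap_step s S Y : psd Y -> good (Mmx S) Y ->
  cover_gap S <= s%:Z * n ^+ 3 -> cover_gap (addS Y S) <= s.+1%:Z * n ^+ 3.
Proof.
move=> pY gY h; rewrite addSE [cover_gap _]ipDr -/(cover_gap S) -/(cover_gap _).
rewrite -addn1 PoszD mulrDl mul1r; apply: lerD => //.
by apply: cover_gap_rnd => //; apply: good_tr_gt0 gY.
Qed.

(** With F = 3 n^3 Q R the error bound makes [Dval S] and all entries of S on edges at most F.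
    Distinct vertices of one class are adjacent, so the entries of S inside the classes add up to at
    most tr S + n^2 F. The cover inequality then bounds tr S by a quantity that is too small for T
    steps. *)
Lemma cover_false S : invS nT S -> cover_gap S <= TZ * n ^+ 3 -> False.
Proof.
case=> Ss _ hP htr; rewrite cover_gapE => hc.
pose F := 3 * n ^+ 3 * QZ * RZ.
have F0 : 0 <= F by rewrite /F !mulr_ge0 // ?Q0 ?(le_trans _ R1) ?exprn_ge0.
have FF : TZ * (9 * n ^+ 6 * QZ ^+ 2) = F ^+ 2 by rewrite TE /F; ring.
have {}hP : Phi S <= F ^+ 2 by rewrite -FF.
have sqF (x : int) : x ^+ 2 <= Phi S -> `|x| <= F.
  move=> hx; rewrite -(ler_pXn2r (_ : 0 < 2)%N) ?nnegrE //.
  by rewrite real_normK ?num_real //; apply: le_trans hx hP.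
have hD := sqF _ (Phi_Dval S).
have DE : Dval S = (2 * t + 1)%:Z * \tr S - 2 * sumall S.
  rewrite /Dval /ip /mxtrace /sumall !mulr_sumr -sumrB; apply: eq_bigr => i _.
  rewrite [RHS](_ : _ = \sum_j ((2 * t + 1)%:Z * ((i == j)%:R * S i j) - 2 * S i j)).
    by apply: eq_bigr => j _; rewrite mxE; ring.
  rewrite sumrB -!mulr_sumr; congr (_ * _ - _).
  rewrite (bigD1 i) //= eqxx mul1r big1 ?addr0 // => j ji.
  by rewrite eq_sym (negPf ji) mul0r.
have hH : \sum_i \sum_j (f i == f j)%:R * S i j <= \tr S + n * (n * F).
  rewrite -lerBlDl /mxtrace -sumrB; apply: le_trans (ler_norm _) _.
  apply: norm_sum_le => i; rewrite (bigD1 i) //= eqxx mul1r addrC addrK.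
  have -> : \sum_(j | j != i) (f i == f j)%:R * S i j =
            \sum_j ((f i == f j) && (j != i))%:R * S i j.
    rewrite [RHS](bigD1 i) //= !eqxx mul0r add0r; apply: eq_bigr => j ->.
    by rewrite andbT.
  apply: norm_sum_le => j; case: andP => [[/eqP fij ji]|_]; last by rewrite mul0r normr0.
  rewrite mul1r; apply: sqF; apply: Phi_edge; apply: fP => //.
  by rewrite eq_sym.
have tr0 : 0 <= \tr S.
  apply: le_trans htr; rewrite mulr_ge0 // subr_ge0 QnE ler_peMr //; exact: le_trans n1.
(* The coefficient 2t + 1 in [Dval] exceeds the 2q <= 2t from the cover inequality, so one full copy
   of tr S survives on the left. This is where the half in t + 1/2 is used. *)
have key : \tr S <= F + 2 * n * (n * (n * F)) + 2 * (TZ * n ^+ 3).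
  have h1 : q%:Z * \sum_i \sum_j (f i == f j)%:R * S i j <= q%:Z * \tr S + n * (n * (n * F)).
    have q0 : 0 <= q%:Z by [].
    apply: le_trans (ler_wpM2l q0 hH) _; rewrite mulrDr lerD2l.
    have nF : 0 <= n * (n * F) by rewrite !mulr_ge0.
    exact: ler_wpM2r.
  have h2 : q%:Z * \tr S <= t%:Z * \tr S by rewrite ler_wpM2r.
  move: DE; rewrite PoszD PoszM mulrDl -mulrA mul1r => DE.
  move: hc hD DE h1 h2; move: (Dval S) (\sum_i \sum_j _) (sumall S) => d a b.
  move: (q%:Z * a) (q%:Z * \tr S) (t%:Z * \tr S) (\tr S) (TZ * _) => x1 x2 x3 x4 x5.
  rewrite -mulrA; move: (n * (n * (n * F))) => x6; lia.
have {key htr}key := le_trans htr key; move: key.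
rewrite -/TZ; have n3 := expn1 3.
(* Origin of the constant in [nR]: 4 (F + 2 n^3 F) <= 12 n^3 F = 36 n^6 Q R = R^2 Q = T Q. *)
have b1 : 4 * (F + 2 * n * (n * (n * F))) <= TZ * QZ.
  have -> : TZ * QZ = 4 * (3 * (n ^+ 3 * F)) by rewrite TE {1}RE /F; ring.
  have -> : 2 * n * (n * (n * F)) = 2 * (n ^+ 3 * F) by ring.
  by have : F <= n ^+ 3 * F; [rewrite ler_peMl | lia].
have b2 : 5 * n ^+ 3 <= QZ.
  rewrite QE -mulrA ler_wpM2l // -[leLHS]mulr1 ler_pM // ?exprn_ge0 //.
  exact: ler_weXn2l.
have b3 : n <= n ^+ 3 by rewrite ler_eXnr.
have b4 : TZ * (5 * n ^+ 3) <= TZ * QZ by rewrite ler_wpM2l.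
have b5 : TZ * n <= TZ * n ^+ 3 by rewrite ler_wpM2l.
have b6 : 0 < TZ * n ^+ 3 by rewrite mulr_gt0 // (lt_le_trans _ n3).
move: b1 b4 b5 b6; rewrite mulrBr (mulrCA TZ).
move: (F + _) (TZ * QZ) (TZ * n) (TZ * n ^+ 3) => x1 x2 x3 x4; lia.
Qed.
End Cover.

Lemma bform1 (v : 'cV[int]_N) : bform 1%:M v v = \sum_i v i 0 ^+ 2.
Proof.
rewrite bformE; apply: eq_bigr => i _; rewrite (bigD1 i) //= big1 => [|j ji].
  by rewrite mxE eqxx addr0 mulr1 -expr2.
by rewrite mxE eq_sym (negPf ji) mulr0 mul0r.
Qed.

(** The iteration freezes at the first good power of B; as long as none has been found, the current
    matrix is the p-th power and all earlier ones are known to be bad. *)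
Lemma iterYP M p :
  exists p', [/\ (p' <= p)%N, iterY M p = (c%:Z%:M - M) ^+ p' &
    good M (iterY M p) \/ p' = p /\ forall i, (i <= p)%N -> ~~ good M ((c%:Z%:M - M) ^+ i)].
Proof.
elim: p => [|p [p' [p'p pE IH]]].
  exists 0%N; rewrite expr0; split=> //.
  case: (boolP (good M (iterY M 0))) => g; [by left|right].
  by split=> // -[|//] _; rewrite expr0.
rewrite /iterY iterS -/(iterY M p) {1 2}/nextY.
case: (boolP (good M (iterY M p))) IH => [g _|g [//|[Ep h]]].
  by exists p'; split=> //; [apply: leq_trans p'p _|left].
exists p.+1; subst p'; rewrite /nextY pE; set B := c%:Z%:M - M in pE h *.
rewrite -[B ^+ p *m B]/(B ^+ p * B) -exprSr; split=> //.
case: (boolP (good M (B ^+ p.+1))) => g'; [by left|right].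
by split=> // i; rewrite leq_eqVlt => /predU1P[-> //|]; apply: h.
Qed.

Lemma psdB S s : (s <= nT)%N -> invS s S -> psd (c%:Z%:M - Mmx S).
Proof.
move=> sT iS; rewrite cmu; apply: psd_shift; last exact: Mmx_bound (invS_bound sT iS).
by apply: Mmx_sym; case: iS.
Qed.

Lemma iterY_psd S s p : (s <= nT)%N -> invS s S -> psd (iterY (Mmx S) p).
Proof.
by move=> sT iS; have [p' [_ -> _]] := iterYP (Mmx S) p; apply/psd_exp/psdB/iS.
Qed.

Section Stable.
Variable A : {set 'I_N}.
Hypothesis A_stable : {in A &, forall i j, ~~ e i j}.
Hypothesis A_big : (t < #|A|)%N.

(* v is the indicator vector of A, unless [Dval S <= 0], when a unit vector will do. *)
Lemma stable_form S : exists2 v : 'cV[int]_N, 0 < \sum_i v i 0 ^+ 2 & bform (Mmx S) v v <= 0.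
Proof.
case: (leP (Dval S) 0) => D0.
  pose i0 := Ordinal N_gt0; exists (delta_mx i0 0); last first.
    rewrite bform_delta !mxE e_irr eqxx mul0r add0r mulr1.
    by rewrite mulr_le0_ge0 //; lia.
  rewrite (bigD1 i0) //= mxE !eqxx ltr_pwDl // sumr_ge0 // => i _.
  exact: sqr_ge0.
pose a : int := #|A|%:Z.
have sumA : \sum_i (i \in A)%:R = a :> int.
  by rewrite /a -natz -sum1_card natr_sum [RHS]big_mkcond; apply: eq_bigr => i _; case: (i \in A).
exists (\col_i (i \in A)%:R).
  rewrite (eq_bigr (fun i => (i \in A)%:R)) ?sumA /a; first by lia.
  by move=> i _; rewrite mxE; case: (i \in A).
suff -> : bform (Mmx S) (\col_i (i \in A)%:R) (\col_i (i \in A)%:R)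
    = Dval S * ((2 * t + 1)%:Z * a - 2 * (a * a)).
  rewrite mulr_ge0_le0 ?(ltW D0) //.
  have -> : (2 * t + 1)%:Z * a - 2 * (a * a) = a * ((2 * t + 1)%:Z - 2 * a) by ring.
  by rewrite mulr_ge0_le0 // /a; lia.
pose x i : int := (i \in A)%:R.
rewrite bformE.
have -> : \sum_i \sum_j (\col_i (i \in A)%:R : 'cV[int]_N) i 0 * Mmx S i j * (\col_i (i \in A)%:R : 'cV[int]_N) j 0 =
  \sum_i \sum_j Dval S * ((2 * t + 1)%:Z * ((i == j)%:R * x i) - 2 * (x i * x j)).
  apply: eq_bigr => i _; apply: eq_bigr => j _; rewrite !mxE -/(x i) -/(x j).
  have xx : x i * ((e i j)%:R * S i j) * x j = 0.
    rewrite /x; case iA: (i \in A); case jA: (j \in A); rewrite ?mulr0 ?mul0r //.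
    by rewrite (negPf (A_stable iA jA)) mul0r mulr0 mul0r.
  rewrite mulrDr mulrDl xx add0r.
  suff -> : (i == j)%:R * x i = (i == j)%:R * (x i * x j) by ring.
  case: eqP => [<-|_]; last by rewrite !mul0r.
  by rewrite /x; case: (i \in A).
rewrite (eq_bigr (fun i => Dval S * ((2 * t + 1)%:Z * x i - 2 * (x i * a)))); last first.
  move=> i _; rewrite -mulr_sumr sumrB -!mulr_sumr sumA; congr (_ * (_ * _ - _)).
  rewrite (bigD1 i) //= eqxx mul1r big1 ?addr0 // => j ji.
  by rewrite eq_sym (negPf ji) mul0r.
by rewrite -mulr_sumr sumrB -!mulr_sumr -mulr_suml sumA.
Qed.

Lemma stable_good S s : (s <= nT)%N -> invS s S -> good (Mmx S) (iterY (Mmx S) Q).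
Proof.
move=> sT iS; have pB := psdB sT iS; set M := Mmx S in pB *.
have Ms : M^T = M by apply: Mmx_sym; case: iS.
have [v v0 vM] := stable_form S; rewrite -/M in vM.
have [p' [_ _ [//|[_ bad]]]] := iterYP M Q; exfalso.
set B := c%:Z%:M - M in pB bad.
have cQ : 0 <= c%:Z - QZ by rewrite /nc PoszM -/QZ -/cZ; nia.
have trB p : (p <= Q)%N -> \tr (B ^+ p) <= (c%:Z - QZ) ^+ p * n.
  elim: p => [_|p IH pQ]; first by rewrite !expr0 mxtrace1 mul1r natz.
  have := bad p (ltnW pQ); rewrite -leNgt => hb.
  rewrite exprSr tr_mul_shift // exprS -mulrA.
  apply: le_trans (ler_wpM2l cQ (IH (ltnW pQ))).
  by move: hb; rewrite mulrBl -/QZ; move: (ip _ _) (QZ * _) (c%:Z * _) => x y z; lia.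
have vB : c%:Z * bform 1%:M v v <= bform B v v.
  have subE (x y : 'M[int]_1) : (x - y) 0 0 = x 0 0 - y 0 0 by rewrite !mxE.
  have sclE a (x : 'M[int]_1) : (a *: x) 0 0 = a * x 0 0 by rewrite !mxE.
  rewrite /B /bform mulmxBr mulmxBl subE mulmx1 mul_mx_scalar -scalemxAl sclE.
  by rewrite lerDl oppr_ge0.
have low := psd_exp_lower Q pB (isT : 0 <= c%:Z) vB.
have := le_trans low (psd_le_tr v (psd_exp Q pB)); rewrite bform1 ler_pM2r // => {}low.
have {low} := le_trans low (trB _ (leqnn _)).
(* Since c = Q c', the factor Q^Q cancels on both sides and leaves c'^Q <= N (c' - 1)^Q, which
   [power_gap] refutes because the exponent Q equals N c'. *)
have -> : c%:Z - QZ = QZ * (cZ - 1) by rewrite /nc PoszM -/QZ -/cZ; ring.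
rewrite /nc PoszM -/QZ -/cZ !exprMn -mulrA ler_pM2l; last by rewrite exprn_gt0 // (lt_le_trans _ Q1).
rewrite leNgt mulrC power_gap // (lt_le_trans _ c1) //.
Qed.
End Stable.

(** The witness s' is the number of successful steps. It falls behind s once a step has failed, and
    then the flag is false. *)
Lemma runSP s : (s <= nT)%N ->
  exists s', [/\ (s' <= s)%N, invS s' (runS s).1, (runS s).2 -> s' = s &
   forall q (f : 'I_N -> 'I_q), (forall i j, f i = f j -> i != j -> e i j) -> (q <= t)%N ->
     cover_gap f (runS s).1 <= s'%:Z * n ^+ 3].
Proof.
elim: s => [_|s IH sT].
  exists 0%N; split=> // [|q f fP qt]; first exact: invS0.
  rewrite cover_gapE /= /sumall !big1 ?mulr0 ?subrr ?mul0r // => i _; rewrite big1 // => j _;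
   by rewrite mxE ?mulr0.
have [s' [s's iS fl cov]] := IH (ltnW sT).
rewrite /runS iterS -/(runS s) /nextS; case: (boolP (good _ _)) => g; last first.
  by exists s'; split=> //; apply: leq_trans s's _.
have s'T : (s' < nT)%N by apply: leq_ltn_trans sT.
have pY := iterY_psd Q (ltnW s'T) iS.
exists s'.+1; split=> //= [||q f fP qt].
- exact: invS_step.
- by move=> /fl ->.
- by apply: cover_gap_step => //; apply: cov.
Qed.

Lemma runS_stable (A : {set 'I_N}) s : {in A &, forall i j, ~~ e i j} -> (t < #|A|)%N ->
  (s <= nT)%N -> (runS s).2.
Proof.
move=> sA bA; elim: s => // s IH sT.
have [s' [s's iS _ _]] := runSP (ltnW sT).
rewrite /runS iterS -/(runS s) /nextS (stable_good sA bA (leq_trans s's (ltnW sT)) iS) /=.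
exact: IH (ltnW sT).
Qed.

Lemma runS_cover q (f : 'I_N -> 'I_q) : (forall i j, f i = f j -> i != j -> e i j) ->
  (q <= t)%N -> (runS nT).2 = false.
Proof.
move=> fP qt; apply/negP => fl; have [s' [_ iS /(_ fl) E cov]] := runSP (leqnn nT).
by subst s'; apply: cover_false fP qt _ iS (cov _ _ fP qt).
Qed.

End Test.

Lemma runS_spec t (A : {set 'I_N}) (f : 'I_N -> 'I_#|A|) : (0 < t < N)%N ->
  {in A &, forall i j, ~~ e i j} -> (forall i j, f i = f j -> i != j -> e i j) ->
  (runS t nT).2 = (t < #|A|)%N.
Proof.
move=> /andP[t0 tN] sA fP; case: leqP => h; first exact: runS_cover fP h.
exact: runS_stable sA h (leqnn _).
Qed.

(** Test number t decides t < |A|, so exactly |A| - 1 of the tests t = 1, ..., N - 1 are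
    positive. *)
Lemma count_runS (A : {set 'I_N}) (f : 'I_N -> 'I_#|A|) : 
  {in A &, forall i j, ~~ e i j} -> (forall i j, f i = f j -> i != j -> e i j) ->
  (1 + \sum_(t < N.-1) (runS t.+1 nT).2)%N = #|A|.
Proof.
move=> sA fP.
have AN : (#|A| <= N)%N by rewrite -[X in (_ <= X)%N]card_ord max_card.
(* The labelling f sends a vertex into 'I_#|A|, so A cannot be empty. *)
have A0 : (0 < #|A|)%N by apply: leq_ltn_trans (ltn_ord (f (Ordinal N_gt0))).
rewrite (eq_bigr (fun t : 'I_N.-1 => (t.+1 < #|A|)%N : nat)); last first.
  move=> t _; have tN : (0 < t.+1 < N)%N by have := ltn_ord t; move: (nat_of_ord t); lia.
  by rewrite (runS_spec tN sA fP).
rewrite sum_ltn; move: AN A0; move: #|A| => a; lia.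
Qed.
End Algorithm.

Local Close Scope ring_scope.

(** * A structured language and its compiler *)

Inductive expr :=
  | Cst of int
  | Var of nat
  | Arr of nat & expr
  | Op of binop & expr & expr.

(** There is no conditional, and the number of rounds of a loop is fixed on entry. Hence a bound on
    the loop counts alone bounds the running time; branching is replaced by arithmetic with 0 and 1.
    [Fetch] reads an original input register. *)
Inductive cmd :=
  | Assign of nat & expr
  | Store of nat & expr & expr
  | Fetch of nat & expr
  | Seq of cmd & cmd
  | For of nat & expr & cmd.

Record state := State { sc : nat -> int; ar : nat -> nat -> int }.

Definition setv st x v := State (fun y => if y == x then v else sc st y) (ar st).
Definition seta st a i v :=
  State (sc st) (fun b j => if (b == a) && (j == i) then v else ar st b j).

Fixpoint aeval st e : int :=
  match e with
  | Cst z => z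
  | Var x => sc st x
  | Arr a e => ar st a `|aeval st e|
  | Op o e1 e2 => eval_binop o (aeval st e1) (aeval st e2)
  end.

Definition cnt (v : int) : nat := if v is Posz n then n else 0.

Notation ncell := 64.
Notation nscal := 32.
Notation tmp0 := 35.

Section Machine.
Variables (beta : nat) (raw : nat -> int).

Fixpoint run c st : state :=
  match c with
  | Assign x e => setv st x (aeval st e)
  | Store a e1 e2 => seta st a `|aeval st e1| (aeval st e2)
  | Fetch x e => setv st x (raw `|aeval st e|)
  | Seq c1 c2 => run c2 (run c1 st)
  | For x e c => iteri (cnt (aeval st e)) (fun i st => run c (setv st x (Posz i))) st
  end.

Section Safe.
Variables U L : nat.
(** U bounds the stored values and L the loop counts. The address range of [Fetch] consists of the
    registers that compiled code never writes: they lie above the scalars and temporaries and below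
    the array cells. *)
Fixpoint safe c st : Prop :=
  match c with
  | Assign x e => `|aeval st e| <= U
  | Store a e1 e2 => `|aeval st e2| <= U
  | Fetch x e => ncell <= `|aeval st e| < beta * ncell
  | Seq c1 c2 => safe c1 st /\ safe c2 (run c1 st)
  | For x e c => cnt (aeval st e) <= L /\
      forall i, i < cnt (aeval st e) ->
        safe c (setv (iteri i (fun i st => run c (setv st x (Posz i))) st) x (Posz i))
  end.
End Safe.

(* Squaring the index spares the computation of its absolute value; [beta] lifts
   the cells above the input. *)
Definition cell a i := (i * i + beta) * ncell + a.

Lemma cell_inj a i b j : a < ncell -> b < ncell -> cell a i = cell b j -> a = b /\ i = j.
Proof.
rewrite /cell => ha hb h; have [E ->] : i * i = j * j /\ a = b by lia.
by split=> //; apply/eqP; rewrite -(eqn_sqr i j) -!mulnn E.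
Qed.

Definition caddr a d : program :=
  [:: Binop Mul d d d; Binop Add d d 2; Const d.+1 ncell; Binop Mul d d d.+1;
      Const d.+1 a; Binop Add d d d.+1].

(** The result goes to register d, and only registers from d up to 63 are used. As the machine has
    no move instruction, a scalar is copied by adding it to 0. *)
Fixpoint cexpr e d : program :=
  match e with
  | Cst z => [:: Const d z]
  | Var x => [:: Const d 0; Binop Add d d (x + 3)]
  | Arr a e => cexpr e d ++ caddr a d ++ [:: ReadInd d d]
  | Op o e1 e2 => cexpr e1 d ++ cexpr e2 d.+1 ++ [:: Binop o d d d.+1]
  end.

(** Jump targets are absolute, hence the argument [pc]. In a loop, register d holds the number of
    rounds and d + 1 the counter, which is kept apart from the loop variable; the temporaries of the
    body start at d + 2. *)
Fixpoint ccmd c d pc : program :=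
  match c with
  | Assign x e => cexpr e d ++ [:: Const d.+1 0; Binop Add (x + 3) d d.+1]
  | Store a e1 e2 => cexpr e1 d ++ caddr a d ++ cexpr e2 d.+1 ++ [:: WriteInd d d.+1]
  | Fetch x e => cexpr e d ++ [:: ReadInd d d; Const d.+1 0; Binop Add (x + 3) d d.+1]
  | Seq c1 c2 => let l1 := ccmd c1 d pc in l1 ++ ccmd c2 d (pc + size l1)
  | For x e c =>
      let l0 := cexpr e d in
      let p1 := (pc + size l0).+1 in
      let l1 := ccmd c d.+2 (p1 + 5) in
      l0 ++ [:: Const d.+1 0;
                Binop Defs.Sub d.+2 d d.+1; JumpPos d.+2 (p1 + 3);
                Jump (p1 + 5 + size l1 + 3);
                Const d.+2 0; Binop Add (x + 3) d.+1 d.+2] ++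
      l1 ++ [:: Const d.+2 1; Binop Add d.+1 d.+1 d.+2; Jump p1]
  end.

Fixpoint edepth e :=
  match e with
  | Cst _ | Var _ => 1
  | Arr _ e => maxn 2 (edepth e)
  | Op _ e1 e2 => maxn (edepth e1) (edepth e2).+1
  end.

(* If all values of the state are at most U in absolute value, then those handled
   while e is evaluated are at most [U ^ eweight e]. *)
Fixpoint eweight e :=
  match e with
  | Cst _ | Var _ => 1
  | Arr _ e => 2 * eweight e + 3
  | Op _ e1 e2 => eweight e1 + eweight e2 + 1
  end.

Fixpoint ewf e :=
  match e with
  | Cst z => `|z| <= ncell
  | Var x => x < nscal
  | Arr a e => (a < ncell) && ewf e
  | Op _ e1 e2 => ewf e1 && ewf e2
  end.

Variable K : nat.
Definition eok e d := [&& ewf e, d + edepth e <= ncell & eweight e <= K].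

Fixpoint cok c d :=
  match c with
  | Assign x e => [&& x < nscal, d.+2 <= ncell & eok e d]
  | Store a e1 e2 => [&& a < ncell, d.+2 <= ncell, 2 * eweight e1 + 3 <= K, eok e1 d & eok e2 d.+1]
  | Fetch x e => [&& x < nscal, d.+2 <= ncell & eok e d]
  | Seq c1 c2 => cok c1 d && cok c2 d
  | For x e c => [&& x < nscal, d.+3 <= ncell, eok e d & cok c d.+2]
  end.

(** Counts executed instructions. A round of a loop adds 7 to its body: subtraction, test, two for
    setting the loop variable, two for the increment, and the jump back. The 4 stands for clearing
    the counter and the last, failing test of three instructions. *)
Fixpoint ctime L c :=
  match c with
  | For x e c => size (cexpr e 0) + 4 + L * (ctime L c + 7)
  | Seq c1 c2 => ctime L c1 + ctime L c2
  | _ => size (ccmd c 0 0)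
  end.

Lemma size_cexpr e d d' : size (cexpr e d) = size (cexpr e d').
Proof.
elim: e d d' => //= [a e IH|o e1 IH1 e2 IH2] d d'; rewrite !size_cat /=.
  by rewrite (IH d d').
by rewrite (IH1 d d') (IH2 d.+1 d'.+1).
Qed.

Variable b : nat.
Hypothesis b7 : 7 <= b.

Lemma bitlen_le (x : int) : `|x| < 2 ^ b -> bitlen x <= b.
Proof.
rewrite /bitlen => h; case: (posnP `|x|) => [->|x0]; first by rewrite trunc_log0; lia.
rewrite -(ltn_exp2l _ _ (isT : 1 < 2)); apply: leq_ltn_trans h; exact: trunc_logP.
Qed.

Definition fits (m : memory) := forall r, `|m r| < 2 ^ b.
(** Reachability in at most n instructions, phrased through the continuation because [exec]
    describes only halting runs. An instruction handles at most five numbers of at most b bits each,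
    whence 5 * b. *)
Definition red P pc m n pc' m' := forall t2 m2, exec P pc' m' t2 m2 ->
  exists2 t, exec P pc m t m2 & t <= n * (5 * b) + t2.
Definition code_at (P : program) pc l := exists P1 P2, P = P1 ++ l ++ P2 /\ size P1 = pc.

Lemma code_at_cat P pc l1 l2 : code_at P pc (l1 ++ l2) ->
  code_at P pc l1 /\ code_at P (pc + size l1) l2.
Proof.
case=> P1 [P2 [-> <-]]; split; first by exists P1, (l2 ++ P2); rewrite -!catA.
by exists (P1 ++ l1), P2; rewrite size_cat -!catA.
Qed.

Lemma code_at_cons P pc i l : code_at P pc (i :: l) ->
  onth P pc = Some i /\ code_at P pc.+1 l.
Proof.
case=> P1 [P2 [-> <-]]; split; first by rewrite onth_cat ltnn subnn.
by exists (rcons P1 i), P2; rewrite cat_rcons size_rcons.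
Qed.

Lemma red_refl P pc m : red P pc m 0 pc m.
Proof. by move=> t2 m2 h; exists t2. Qed.

Lemma red_trans P pc m n pc' m' n' pc'' m'' :
  red P pc m n pc' m' -> red P pc' m' n' pc'' m'' -> red P pc m (n + n') pc'' m''.
Proof.
move=> h1 h2 t2 m2 /h2[t ex tle]; have [t' ex' t'le] := h1 _ _ ex; exists t' => //.
by apply: leq_trans t'le _; rewrite mulnDl -addnA leq_add2l.
Qed.

Lemma red_le P pc m n n' pc' m' : n <= n' -> red P pc m n pc' m' -> red P pc m n' pc' m'.
Proof.
move=> le h t2 m2 /h[t ex tle]; exists t => //.
by apply: leq_trans tle _; rewrite leq_add2r leq_mul2r le orbT.
Qed.

Lemma red_step P pc m i : onth P pc = Some i -> cost i m <= 5 * b ->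
  red P pc m 1 (step i pc m).1 (step i pc m).2.
Proof.
move=> Pi c t2 m2 ex; exists (cost i m + t2); first exact: ExecStep ex.
by rewrite mul1n leq_add2r.
Qed.

Lemma bitlen_reg r : r < 128 -> bitlen (Posz r) <= b.
Proof.
move=> r128; apply: bitlen_le => /=; apply: leq_trans r128 _.
exact: (@leq_pexp2l 2 7 b isT b7).
Qed.

Lemma small_fits (z : int) : `|z| < 128 -> `|z| < 2 ^ b.
Proof. by move=> h; apply: leq_trans h _; rewrite (@leq_pexp2l 2 7 b). Qed.

Lemma upd_eq m d v : update m d v d = v. Proof. by rewrite /update eqxx. Qed.
Lemma upd_ne m d v r : (r == d) = false -> update m d v r = m r.
Proof. by rewrite /update => ->. Qed.

Lemma fits_update m d v : fits m -> `|v| < 2 ^ b -> fits (update m d v).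
Proof. by move=> fm fv r; rewrite /update; case: eqP. Qed.

Lemma fits_bitlen m r : fits m -> bitlen (m r) <= b.
Proof. by move=> fm; apply: bitlen_le. Qed.

Lemma red_const P pc m d v : onth P pc = Some (Const d v) -> d < 128 ->
  `|v| < 2 ^ b -> red P pc m 1 pc.+1 (update m d v).
Proof.
move=> Pi dr fv; apply: (red_step Pi) => /=.
by have := bitlen_reg dr; have := bitlen_le fv; lia.
Qed.

Lemma red_binop P pc m o d x y : onth P pc = Some (Binop o d x y) -> fits m ->
  d < 128 -> x < 128 -> y < 128 ->
  red P pc m 1 pc.+1 (update m d (eval_binop o (m x) (m y))).
Proof.
move=> Pi fm dr xr yr; apply: (red_step Pi) => /=.
have := bitlen_reg dr; have := bitlen_reg xr; have := bitlen_reg yr; have := fits_bitlen x fm; have := fits_bitlen y fm.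
lia.
Qed.

Lemma red_read P pc m d x : onth P pc = Some (ReadInd d x) -> fits m ->
  d < 128 -> x < 128 -> red P pc m 1 pc.+1 (update m d (m `|m x|)).
Proof.
move=> Pi fm dr xr; apply: (red_step Pi) => /=.
have := bitlen_reg dr; have := bitlen_reg xr; have := fits_bitlen x fm; have := fits_bitlen `|m x| fm.
lia.
Qed.

Lemma red_write P pc m x y : onth P pc = Some (WriteInd x y) -> fits m ->
  x < 128 -> y < 128 -> red P pc m 1 pc.+1 (update m `|m x| (m y)).
Proof.
move=> Pi fm xr yr; apply: (red_step Pi) => /=.
have := bitlen_reg xr; have := bitlen_reg yr; have := fits_bitlen x fm; have := fits_bitlen y fm.
lia.
Qed.

Lemma red_jump P pc m l : onth P pc = Some (Jump l) -> red P pc m 1 l m.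
Proof. by move=> Pi; apply: (red_step Pi) => /=; lia. Qed.

Lemma red_jpos P pc m x l : onth P pc = Some (JumpPos x l) -> fits m -> x < 128 ->
  red P pc m 1 (if (0 < m x)%R then l else pc.+1) m.
Proof.
move=> Pi fm xr; apply: (red_step Pi) => /=.
have := bitlen_reg xr; have := fits_bitlen x fm; lia.
Qed.

(* Register 2 holds [beta]; scalar x lives in register x + 3, temporaries in the
   registers from 35 to 63. *)
Definition rep st (m : memory) :=
  [/\ m 2 = (Posz beta), forall x, x < nscal -> m (x + 3) = sc st x,
      forall a i, a < ncell -> m (cell a i) = ar st a i
    & forall j, ncell <= j < beta * ncell -> m j = raw j].

Definition same_off d (m m' : memory) := forall r, (r < d) || (ncell <= r) -> m' r = m r.

Lemma same_off_refl d m : same_off d m m. Proof. by []. Qed.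
Lemma same_off_trans d d' m m' m'' : d <= d' -> same_off d m m' -> same_off d' m' m'' ->
  same_off d m m''.
Proof.
move=> dd h1 h2 r hr; rewrite h2 ?h1 //; case/orP: hr => [hr|->]; last by rewrite orbT.
by rewrite (leq_trans hr).
Qed.
Lemma same_off_update d x m v : d <= x < ncell -> same_off d m (update m x v).
Proof. by move=> hx r hr; rewrite /update; case: eqP => // E; lia. Qed.

Hypothesis beta_gt0 : 0 < beta.

Lemma cell_ge a i : ncell <= cell a i.
Proof. by rewrite /cell; move: beta_gt0; nia. Qed.

Lemma rep_same st m m' : rep st m -> same_off tmp0 m m' -> rep st m'.
Proof.
case=> h1 h2 h3 h4 so; split=> [|x hx|a i ha|j hj].
- by rewrite so.
- by rewrite so ?h2 //; lia.
- by rewrite so ?h3 // cell_ge orbT.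
- by rewrite so ?h4 //; lia.
Qed.

Section Bounds.
Variables U L : nat.
Hypotheses (U_ge : ncell <= U) (beta_le : beta <= U) (raw_le : forall j, `|raw j| <= U) (L_le : L <= U).
Hypothesis K_gt0 : 0 < K.
Hypothesis UK : U ^ K < 2 ^ b.

Definition bounded st := (forall x, `|sc st x| <= U) /\ forall a i, `|ar st a i| <= U.

Lemma absz_divz_le (x y : int) : `|(x %/ y)%Z| <= `|x|.
Proof.
suff h (z : nat) : `|(x %/ (Posz z))%Z| <= `|x|.
  case: y => y; first exact: h.
  by rewrite NegzE divzN abszN.
case: z => [|z]; first by rewrite divz0.
have E := divz_eq x z.+1; have := modz_ge0 x (isT : (Posz z.+1) != 0%R); have := @ltz_pmod x z.+1 isT.
move: E; move: (_ %/ _)%Z (_ %% _)%Z => q r E h1 h2; nia.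
Qed.

Lemma aeval_bound st e : bounded st -> ewf e -> `|aeval st e| <= U ^ eweight e.
Proof.
move=> [bs ba]; elim: e => [z|x|a e _|o e1 IH1 e2 IH2] /=.
- by rewrite expn1 => h; apply: leq_trans h _.
- by rewrite expn1.
- by move=> _; apply: leq_trans (ba _ _) _; rewrite -{1}(expn1 U) leq_pexp2l; lia.
case/andP=> /IH1 {}IH1 /IH2 {}IH2.
have p1 : 0 < U ^ eweight e1 by rewrite expn_gt0; lia.
have p2 : 0 < U ^ eweight e2 by rewrite expn_gt0; lia.
rewrite !expnD expn1.
move: (aeval st e1) (aeval st e2) (U ^ _) (U ^ _) IH1 IH2 p1 p2 => x y u v hx hy u0 v0.
have uv : u * v * 2 <= u * v * U by rewrite leq_mul2l; lia.
have uv1 : u <= u * v by rewrite leq_pmulr.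
have uv2 : v <= u * v by rewrite leq_pmull.
case: o => /=.
- by lia.
- by lia.
- by rewrite abszM; apply: leq_trans (leq_mul hx hy) _; lia.
- by apply: leq_trans (absz_divz_le _ _) _; lia.
Qed.

Lemma aeval_fits st e : bounded st -> ewf e -> eweight e <= K -> `|aeval st e| < 2 ^ b.
Proof.
move=> bs we wK; apply: leq_ltn_trans (aeval_bound bs we) _.
by apply: leq_ltn_trans UK; rewrite leq_pexp2l //; lia.
Qed.

(** The address squares the index, which doubles the weight; the factor 64 and the summands [beta]
    and a are paid for by three further factors U. *)
Lemma cell_fits st a e : bounded st -> ewf e -> a < ncell -> 2 * eweight e + 3 <= K ->
  (`|aeval st e| * `|aeval st e| + beta) * ncell + a < 2 ^ b.
Proof.
move=> bs we ha wK; apply: leq_ltn_trans UK.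
apply: leq_trans (_ : U ^ (2 * eweight e + 3) <= _); last by rewrite leq_pexp2l //; lia.
have h := aeval_bound bs we.
have p : 0 < U ^ eweight e by rewrite expn_gt0; lia.
rewrite mul2n -addnn !expnD !expnS expn0.
move: `|aeval st e| (U ^ _) h p => x u h p.
have h1 : x * x <= u * u by exact: leq_mul.
have h2 : 0 < u * u by rewrite muln_gt0 p.
move: (x * x) (u * u) h1 h2 => xx uu h1 h2.
have h3 : xx + beta <= uu * U * 2 by nia.
have h4 : uu * U * (64 * 64) <= uu * U * (U * U) by rewrite leq_mul2l leq_mul ?orbT.
have h5 : 0 < uu * U by rewrite muln_gt0 h2; lia.
rewrite muln1 mulnA; move: (uu * U) (uu * U * (U * U)) h3 h4 h5 => y z; lia.
Qed.

Lemma caddr_ok P pc d (m : memory) v (a : nat) : code_at P pc (caddr a d) -> fits m -> m 2 = (Posz beta) ->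
  tmp0 <= d -> d.+2 <= ncell -> a < ncell -> m d = v ->
  (`|v| * `|v| + beta) * ncell + a < 2 ^ b ->
  exists m', [/\ red P pc m 6 (pc + 6) m', m' d = (Posz (cell a `|v|)), same_off d m m' & fits m'].
Proof.
move=> cd fm mb hd hd2 ha mv vb.
have vv : (v * v)%R = (Posz (`|v| * `|v|)) by lia.
case/code_at_cons: cd => i0 /code_at_cons[i1] /code_at_cons[i2] /code_at_cons[i3].
move=> /code_at_cons[i4] /code_at_cons[i5] _.
have d1 : d < 128 by lia.
have d2 : d.+1 < 128 by lia.
have nd : (d.+1 == d) = false by lia.
have nd' : (d == d.+1) = false by lia.
have n2 : (2 == d) = false by lia.
have n2' : (2 == d.+1) = false by lia.
move: vb; set w := `|v| * `|v| in vv * => vb.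
have := red_binop i0 fm d1 d1 d1; set m0 := update _ _ _ => r0.
have f0 : fits m0 by apply: fits_update => //=; rewrite mv vv; lia.
have := red_binop i1 f0 d1 d1 (isT : 2 < 128); set m1 := update _ _ _ => r1.
have E1 : m1 d = (Posz (w + beta)) by rewrite /m1 /m0 /update !eqxx n2 /= mv vv mb PoszD.
have f1 : fits m1.
  by apply: fits_update => //; move: E1; rewrite /m1 upd_eq => ->; lia.
have := red_const (m := m1) i2 d2 (small_fits (isT : `|(Posz ncell)| < 128)); set m2 := update _ _ _ => r2.
have f2 : fits m2 by apply: fits_update => //; exact: small_fits.
have := red_binop i3 f2 d1 d1 d2; set m3 := update _ _ _ => r3.
have E3 : m3 d = (Posz ((w + beta) * ncell)).
  by rewrite /m3 upd_eq /= /m2 upd_eq upd_ne // E1.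
have f3 : fits m3.
  by apply: fits_update => //; move: E3; rewrite /m3 upd_eq => ->; lia.
have ha' : `|(Posz a)| < 128 by rewrite /=; lia.
have := red_const (m := m3) i4 d2 (small_fits ha'); set m4 := update _ _ _ => r4.
have f4 : fits m4 by apply: fits_update => //; exact: small_fits.
have := red_binop i5 f4 d1 d1 d2; set m5 := update _ _ _ => r5.
have E5 : m5 d = (Posz (cell a `|v|)).
  by rewrite /m5 upd_eq /= /m4 upd_eq upd_ne // E3.
have f5 : fits m5.
  by apply: fits_update => //; move: E5; rewrite /m5 upd_eq => ->; rewrite /cell -/w; lia.
exists m5; split=> //.
  have -> : pc + 6 = pc.+1.+1.+1.+1.+1.+1 by lia.
  exact: red_trans r0 (red_trans r1 (red_trans r2 (red_trans r3 (red_trans r4 r5)))).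
move=> r hr; rewrite /m5 /m4 /m3 /m2 /m1 /m0 /update.
by have -> : (r == d) = false; [lia|have -> : (r == d.+1) = false by lia].
Qed.

Lemma cexpr_ok st e d P pc m : code_at P pc (cexpr e d) -> rep st m -> fits m ->
  bounded st -> tmp0 <= d -> eok e d ->
  exists m', [/\ red P pc m (size (cexpr e d)) (pc + size (cexpr e d)) m',
     m' d = aeval st e, same_off d m m' & fits m'].
Proof.
move=> + + + bst; elim: e d pc m => [z|x|a e IH|o e1 IH1 e2 IH2] d pc m.
- move=> /code_at_cons[i _] rm fm hd /and3P[/= wz hdd _].
  have zb : `|z| < 2 ^ b by apply: small_fits; lia.
  have dr : d < 128 by lia.
  exists (update m d z); split; rewrite ?addn1.
  + exact: red_const.
  + by rewrite /update eqxx.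
  + by apply: same_off_update; lia.
  + exact: fits_update.
- move=> /code_at_cons[i0] /code_at_cons[i1 _] rm fm hd /and3P[/= wx hdd _].
  have dr : d < 128 by lia.
  have xr : x + 3 < 128 by lia.
  have z0 : `|0%Z| < 2 ^ b by apply: small_fits.
  have mx : m (x + 3) = sc st x by case: rm => _ ->.
  have nx : (x + 3 == d) = false by lia.
  have := red_const (m := m) i0 dr z0; set m0 := update _ _ _ => r0.
  have f0 : fits m0 by apply: fits_update.
  have := red_binop i1 f0 dr dr xr; set m1 := update _ _ _ => r1.
  have E1 : m1 d = sc st x by rewrite /m1 /m0 /update !eqxx nx /= mx add0r.
  exists m1; split=> //.
  + by rewrite addn2; exact: red_trans r0 r1.
  + by move=> r hr; rewrite /m1 /m0 /update; have -> : (r == d) = false by lia.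
  + by apply: fits_update => //; move: E1; rewrite /m1 upd_eq => ->; rewrite -mx.
- rewrite -[cexpr (Arr a e) d]/(cexpr e d ++ caddr a d ++ [:: ReadInd d d]).
  move=> /code_at_cat[c1 /code_at_cat[c2 /code_at_cons[i3 _]]] rm fm hd.
  case/and3P=> /= /andP[ha we]; rewrite maxnE => hdd hw.
  have ok : eok e d by apply/and3P; split=> //; lia.
  have [m1 [r1 E1 s1 f1]] := IH _ _ _ c1 rm fm hd ok.
  have m12 : m1 2 = (Posz beta) by rewrite s1; [case: rm | lia].
  have hd2 : d.+2 <= ncell by lia.
  have [m2 [r2 E2 s2 f2]] := caddr_ok c2 f1 m12 hd hd2 ha E1 (cell_fits bst we ha hw).
  have dr : d < 128 by lia.
  have r3 := red_read i3 f2 dr dr.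
  have E3 : m2 `|m2 d| = ar st a `|aeval st e|.
    rewrite E2 /= s2 ?cell_ge ?orbT // s1 ?cell_ge ?orbT //.
    by case: rm => _ _ -> .
  exists (update m2 d (m2 `|m2 d|)); split=> //.
  + have -> : size (cexpr e d ++ caddr a d ++ [:: ReadInd d d]) = size (cexpr e d) + 6 + 1.
      by rewrite !size_cat addnA.
    have -> : pc + (size (cexpr e d) + 6 + 1) = (pc + size (cexpr e d) + 6).+1 by lia.
    exact: red_trans (red_trans r1 r2) r3.
  + by rewrite /update eqxx.
  + apply: same_off_trans (leqnn d) s1 _; apply: same_off_trans (leqnn d) s2 _.
    by apply: same_off_update; lia.
  + exact: fits_update.
- move=> /code_at_cat[c1 /code_at_cat[c2 /code_at_cons[i3 _]]] rm fm hd.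
  case/and3P=> /= /andP[we1 we2]; rewrite maxnE => hdd hw.
  have ok1 : eok e1 d by apply/and3P; split=> //; lia.
  have ok2 : eok e2 d.+1 by apply/and3P; split=> //; lia.
  have [m1 [r1 E1 s1 f1]] := IH1 _ _ _ c1 rm fm hd ok1.
  have rm1 : rep st m1.
    by apply: rep_same rm _; apply: same_off_trans hd _ s1; exact: same_off_refl.
  have [m2 [r2 E2 s2 f2]] := IH2 _ _ _ c2 rm1 f1 (leqW hd) ok2.
  have dr : d < 128 by lia.
  have dr1 : d.+1 < 128 by lia.
  have r3 := red_binop i3 f2 dr dr dr1.
  have E3 : eval_binop o (m2 d) (m2 d.+1) = aeval st (Op o e1 e2).
    by rewrite /= E2 s2 ?E1 // ltnS leqnn.
  exists (update m2 d (eval_binop o (m2 d) (m2 d.+1))); split=> //.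
  + have -> : size (cexpr (Op o e1 e2) d) = size (cexpr e1 d) + size (cexpr e2 d.+1) + 1.
      by rewrite /= !size_cat addnA.
    have -> : pc + (size (cexpr e1 d) + size (cexpr e2 d.+1) + 1) =
      (pc + size (cexpr e1 d) + size (cexpr e2 d.+1)).+1 by lia.
    exact: red_trans (red_trans r1 r2) r3.
  + by rewrite upd_eq E3.
  + apply: same_off_trans (leqnn d) s1 _.
    move=> r hr; rewrite /update; have -> : (r == d) = false by lia.
    by apply: s2; lia.
  + by apply: fits_update => //; rewrite E3; apply: aeval_fits => //=; apply/andP.
Qed.

Lemma U_fits v : `|v| <= U -> `|v| < 2 ^ b.
Proof.
move=> h; apply: leq_ltn_trans h _; apply: leq_ltn_trans UK.
by rewrite -{1}(expn1 U) leq_pexp2l //; lia.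
Qed.

Lemma bounded_setv st x v : bounded st -> `|v| <= U -> bounded (setv st x v).
Proof. by case=> h1 h2 hv; split=> // y /=; case: eqP. Qed.

Lemma bounded_seta st a i v : bounded st -> `|v| <= U -> bounded (seta st a i v).
Proof. by case=> h1 h2 hv; split=> // y j /=; case: andP. Qed.

Lemma rep_setv st m x v : rep st m -> x < nscal -> rep (setv st x v) (update m (x + 3) v).
Proof.
case=> h1 h2 h3 h4 hx; split=> [|y hy|a i ha|j hj].
- by rewrite upd_ne //; lia.
- by rewrite /update /= eqn_add2r h2.
- by rewrite upd_ne ?h3 //; have := cell_ge a i; lia.
- by rewrite upd_ne ?h4 //; lia.
Qed.

Lemma rep_seta st m a i v : rep st m -> a < ncell ->
  rep (seta st a i v) (update m (cell a i) v).
Proof.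
case=> h1 h2 h3 h4 ha; have ge := cell_ge a i; split=> [|y hy|a' j ha'|j hj].
- by rewrite upd_ne //; lia.
- by rewrite upd_ne ?h2 //; lia.
- rewrite /update /=; case: eqP => [/cell_inj[]// -> ->|ne]; first by rewrite !eqxx.
  by case: andP => [[/eqP E1 /eqP E2]|_]; [case: ne; rewrite E1 E2 | rewrite h3].
- by rewrite upd_ne ?h4 //; rewrite /cell; apply/negbTE/eqP; nia.
Qed.

Lemma move_ok P pc m x d : onth P pc = Some (Const d.+1 0) ->
  onth P pc.+1 = Some (Binop Add x d d.+1) -> fits m -> x < 128 -> d < 127 ->
  red P pc m 2 pc.+2 (update (update m d.+1 0%Z) x (m d)) /\
  fits (update (update m d.+1 0%Z) x (m d)).
Proof.
move=> i0 i1 fm xr dr; have z0 : `|0%Z| < 2 ^ b by apply: small_fits.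
have d1 : d.+1 < 128 by lia.
have dd : d < 128 by lia.
have f0 : fits (update m d.+1 0%Z) by apply: fits_update.
have := red_trans (red_const (m := m) i0 d1 z0) (red_binop i1 f0 xr dd d1).
rewrite /= upd_eq upd_ne ?addr0; last by lia.
by move=> r; split=> //; apply: fits_update.
Qed.

Section Loop.
Variables (P : program) (p1 pend d x : nat) (c : cmd) (v : int).
Let f := fun i st => run c (setv st x (Posz i)).
Hypotheses (hx : x < nscal) (hd : tmp0 <= d) (hd3 : d.+3 <= ncell) (nL : cnt v <= L)
  (v_fits : `|v| < 2 ^ b).
Let l1 := ccmd c d.+2 (p1 + 5).
Hypotheses
  (i1 : onth P p1 = Some (Binop Defs.Sub d.+2 d d.+1))
  (i2 : onth P p1.+1 = Some (JumpPos d.+2 (p1 + 3)))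
  (i3 : onth P p1.+2 = Some (Jump pend))
  (i4 : onth P p1.+3 = Some (Const d.+2 0))
  (i5 : onth P p1.+4 = Some (Binop Add (x + 3) d.+1 d.+2))
  (i6 : onth P (p1 + 5 + size l1) = Some (Const d.+2 1))
  (i7 : onth P (p1 + 5 + size l1).+1 = Some (Binop Add d.+1 d.+1 d.+2))
  (i8 : onth P (p1 + 5 + size l1).+2 = Some (Jump p1)).
Hypothesis body_ok : forall st m, rep st m -> fits m -> bounded st -> safe U L c st ->
  exists m', [/\ red P (p1 + 5) m (ctime L c) (p1 + 5 + size l1) m', rep (run c st) m',
    forall r, tmp0 <= r < d.+2 -> m' r = m r, fits m' & bounded (run c st)].

(** Induction on the number k of remaining rounds, with i the current value of the counter; the
    summand 3 is the failing test at the end. *)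
Lemma loop_ok st : (forall i, i < cnt v -> safe U L c (setv (iteri i f st) x (Posz i))) ->
  forall k i m, i + k = cnt v -> rep (iteri i f st) m -> fits m -> bounded (iteri i f st) ->
  m d = v -> m d.+1 = Posz i ->
  exists m', [/\ red P p1 m (k * (ctime L c + 7) + 3) pend m', rep (iteri (cnt v) f st) m',
    forall r, tmp0 <= r < d -> m' r = m r, fits m' & bounded (iteri (cnt v) f st)].
Proof.
move=> sf; elim=> [|k IH] i m ik rm fm bst md md1.
  have fs : `|(m d - m d.+1)%R| < 2 ^ b.
    by rewrite md md1; move: ik v_fits; case: v => w /=; lia.
  have d2r : d.+2 < 128 by lia.
  have d1r : d.+1 < 128 by lia.
  have dr : d < 128 by lia.
  have r1 := red_binop i1 fm d2r dr d1r.
  have f1 := @fits_update m d.+2 _ fm fs.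
  have := red_jpos i2 f1 d2r; rewrite upd_eq md md1.
  have -> : (0 < v - Posz i)%R = false by move: ik; case: v => w /=; lia.
  move=> r2; have r3 := red_jump (m := update m d.+2 (m d - m d.+1)%R) i3.
  exists (update m d.+2 (m d - m d.+1)%R).
  have <- : i = cnt v by lia.
  split=> //.
  - rewrite mul0n add0n; rewrite /= md md1 in r1 r3 *.
    exact: red_trans r1 (red_trans r2 r3).
  - by apply: rep_same rm _; apply: same_off_update; lia.
  - by move=> r hr; rewrite upd_ne //; lia.
have ilt : i < cnt v by lia.
have fs : `|(m d - m d.+1)%R| < 2 ^ b.
  by rewrite md md1; move: ilt v_fits; case: v => w /=; lia.
have d2r : d.+2 < 128 by lia.
have d1r : d.+1 < 128 by lia.
have dr : d < 128 by lia.
have r1 := red_binop i1 fm d2r dr d1r.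
have f1 := @fits_update m d.+2 _ fm fs.
have := red_jpos i2 f1 d2r; rewrite upd_eq md md1.
have -> : (0 < v - Posz i)%R by move: ilt; case: v => w /=; lia.
rewrite addn3; move: r1 f1; rewrite /= md md1; set m1 := update _ _ _ => r1 f1 r2.
have x3 : x + 3 < 128 by lia.
have [//|r3 f3] := @move_ok _ _ m1 _ _ i4 i5 f1 x3.
have m1d1 : m1 d.+1 = Posz i by rewrite /m1 upd_ne ?md1 //; lia.
rewrite m1d1 in r3 f3; set m3 := update _ _ _ in r3 f3.
have iU : `|Posz i| <= U by rewrite /=; lia.
have rm3 : rep (setv (iteri i f st) x (Posz i)) m3.
  apply: rep_setv => //; apply: (rep_same rm) => r hr; rewrite /m1 !upd_ne //; lia.
have bst3 := bounded_setv x bst iU.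
have [m4 [r4 rm4 s4 f4 bst4]] := body_ok rm3 f3 bst3 (sf i ilt).
have o1 : `|1%Z| < 2 ^ b by apply: small_fits.
have r5 := red_const (m := m4) i6 d2r o1; set m5 := update _ _ _ in r5.
have f5 : fits m5 by apply: fits_update.
have r6 := red_binop i7 f5 d1r d1r d2r; set m6 := update _ _ _ in r6.
have m5d1 : m5 d.+1 = Posz i.
  by rewrite /m5 upd_ne ?s4 ?/m3 ?upd_ne //; lia.
have E6 : eval_binop Add (m5 d.+1) (m5 d.+2) = Posz i.+1.
  by rewrite m5d1 /m5 upd_eq /=; lia.
have f6 : fits m6 by apply: fits_update => //; rewrite E6; apply: U_fits; rewrite /=; lia.
have r7 := red_jump (m := m6) i8.
have m6d : m6 d = v.
  by rewrite /m6 /m5 !upd_ne ?s4 /m3 /m1 ?upd_ne //; lia.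
have m6d1 : m6 d.+1 = Posz i.+1 by rewrite /m6 upd_eq E6.
have rm6 : rep (iteri i.+1 f st) m6.
  by apply: (rep_same rm4) => r hr; rewrite /m6 /m5 !upd_ne //; lia.
have [|m7 [r8 rm7 s7 f7 bst7]] := IH i.+1 m6 _ rm6 f6 bst4 m6d m6d1; first by lia.
exists m7; split=> //.
  apply: red_le (red_trans r1 (red_trans r2 (red_trans r3 (red_trans _ (red_trans r5 (red_trans r6 (red_trans r7 r8))))))); last first.
    rewrite -[p1.+3.+2]addn2 -[p1.+3]addn3 -addnA; exact: r4.
  lia.
move=> r hr; rewrite s7 // /m6 /m5 !upd_ne ?s4 /m3 /m1 ?upd_ne //; lia.
Qed.
End Loop.

(** Correctness of the compiler. That temporaries below d survive is what protects the limits and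
    counters of enclosing loops. *)
Lemma ccmd_ok c d P pc st m : code_at P pc (ccmd c d pc) -> rep st m -> fits m ->
  bounded st -> safe U L c st -> tmp0 <= d -> cok c d ->
  exists m', [/\ red P pc m (ctime L c) (pc + size (ccmd c d pc)) m', rep (run c st) m',
    forall r, tmp0 <= r < d -> m' r = m r, fits m' & bounded (run c st)].
Proof.
elim: c d pc st m => [x e|a e1 e2|x e|c1 IH1 c2 IH2|x e c IH] d pc st m.
- move=> /code_at_cat[c1 /code_at_cons[i1 /code_at_cons[i2 _]]] rm fm bst sf hd.
  case/and3P=> hx hd2 ok; have [m1 [r1 E1 s1 f1]] := cexpr_ok c1 rm fm bst hd ok.
  have x3 : x + 3 < 128 by lia.
  have dr : d < 127 by lia.
  have [r2 f2] := move_ok i1 i2 f1 x3 dr.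
  rewrite E1 in r2 f2; eexists; split; last exact: bounded_setv.
  + have -> : pc + size (ccmd (Assign x e) d pc) = (pc + size (cexpr e d)).+2.
      by rewrite /= size_cat /=; lia.
    apply: red_le (red_trans r1 r2).
    by rewrite /= size_cat /= (size_cexpr e 0 d).
  + apply: rep_setv => //; apply: (rep_same rm) => r hr.
    by rewrite upd_ne ?s1 //; lia.
  + by move=> r hr; rewrite !upd_ne ?s1 //; lia.
  + by [].
- move=> /code_at_cat[c1 /code_at_cat[ca /code_at_cat[c2 /code_at_cons[i1 _]]]] rm fm bst sf hd.
  case/and5P=> ha hd2 wK ok1 ok2; have [m1 [r1 E1 s1 f1]] := cexpr_ok c1 rm fm bst hd ok1.
  have m12 : m1 2 = Posz beta by rewrite s1; [case: rm | lia].
  have we1 : ewf e1 by case/and3P: ok1.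
  have [m2 [r2 E2 s2 f2]] := caddr_ok ca f1 m12 hd hd2 ha E1 (cell_fits bst we1 ha wK).
  have rm2 : rep st m2.
    apply: rep_same (rep_same rm _) _ => r hr; [apply: s1|apply: s2]; lia.
  have [m3 [r3 E3 s3 f3]] := cexpr_ok c2 rm2 f2 bst (leqW hd) ok2.
  have dr : d < 128 by lia.
  have dr1 : d.+1 < 128 by lia.
  have r4 := red_write i1 f3 dr dr1.
  have m3d : m3 d = Posz (cell a `|aeval st e1|) by rewrite s3 ?E2 // ltnS leqnn.
  rewrite m3d E3 /= in r4.
  eexists; split; last exact: bounded_seta.
  + have -> : pc + size (ccmd (Store a e1 e2) d pc) =
      (pc + size (cexpr e1 d) + size (caddr a d) + size (cexpr e2 d.+1)).+1.
      by rewrite /= !size_cat /= size_cat /=; lia.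
    apply: red_le (red_trans r1 (red_trans r2 (red_trans r3 r4))).
    by rewrite /= !size_cat /= !size_cat /= (size_cexpr e1 0 d) (size_cexpr e2 1 d.+1); lia.
  + apply: rep_seta => //; apply: (rep_same rm2) => r hr; apply: s3; lia.
  + move=> r hr; rewrite upd_ne ?s3 ?s2 ?s1 //; try lia.
    by have := cell_ge a `|aeval st e1|; lia.
  + by apply: fits_update => //; apply: U_fits.
- move=> /code_at_cat[c1 /code_at_cons[i0 /code_at_cons[i1 /code_at_cons[i2 _]]]] rm fm bst sf hd.
  case/and3P=> hx hd2 ok; have [m1 [r1 E1 s1 f1]] := cexpr_ok c1 rm fm bst hd ok.
  have x3 : x + 3 < 128 by lia.
  have dr : d < 128 by lia.
  have dr' : d < 127 by lia.
  have r2 := red_read i0 f1 dr dr.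
  have rm1 : rep st m1 by apply: (rep_same rm) => r hr; apply: s1; lia.
  have E2 : m1 `|m1 d| = raw `|aeval st e| by rewrite E1; case: rm1 => _ _ _ ->.
  rewrite E2 in r2; have f2 : fits (update m1 d (raw `|aeval st e|)).
    by apply: fits_update => //; apply: U_fits.
  have [r3 f3] := move_ok i1 i2 f2 x3 dr'.
  rewrite upd_eq in r3 f3; eexists; split; last exact: bounded_setv.
  + have -> : pc + size (ccmd (Fetch x e) d pc) = (pc + size (cexpr e d)).+3.
      by rewrite /= size_cat /=; lia.
    apply: red_le (red_trans r1 (red_trans r2 r3)).
    by rewrite /= size_cat /= (size_cexpr e 0 d); lia.
  + apply: rep_setv => //; apply: (rep_same rm1) => r hr.
    by rewrite !upd_ne //; lia.
  + by move=> r hr; rewrite !upd_ne ?s1 //; lia.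
  + by [].
- move=> /code_at_cat[k1 k2] rm fm bst [sf1 sf2] hd /andP[ok1 ok2].
  have [m1 [r1 rm1 s1 f1 bst1]] := IH1 _ _ _ _ k1 rm fm bst sf1 hd ok1.
  have [m2 [r2 rm2 s2 f2 bst2]] := IH2 _ _ _ _ k2 rm1 f1 bst1 sf2 hd ok2.
  exists m2; split=> //.
  + by rewrite /= size_cat addnA; apply: red_trans r1 r2.
  + by move=> r hr; rewrite s2 ?s1.
- rewrite /=; set p1 := (pc + size (cexpr e d)).+1; set l1 := ccmd c d.+2 (p1 + 5).
  move=> /code_at_cat[c0 /code_at_cons[i0 /code_at_cons[i1 /code_at_cons[i2]]]].
  move=> /code_at_cons[i3 /code_at_cons[i4 /code_at_cons[i5]]].
  have -> : (pc + size (cexpr e d)).+4.+2 = p1 + 5 by rewrite /p1; lia.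
  move=> /code_at_cat[cb /code_at_cons[i6 /code_at_cons[i7 /code_at_cons[i8 _]]]].
  move=> rm fm bst [nL sf] hd /and4P[hx hd3 ok okc].
  have [m1 [r1 E1 s1 f1]] := cexpr_ok c0 rm fm bst hd ok.
  have d1r : d.+1 < 128 by lia.
  have z0 : `|0%Z| < 2 ^ b by apply: small_fits.
  have r2 := red_const (m := m1) i0 d1r z0; set m2 := update _ _ _ in r2.
  have f2 : fits m2 by apply: fits_update.
  have rm2 : rep st m2.
    by apply: (rep_same rm) => r hr; rewrite /m2 upd_ne ?s1 //; lia.
  have vf : `|aeval st e| < 2 ^ b by case/and3P: ok => *; apply: aeval_fits.
  have m2d : m2 d = aeval st e by rewrite /m2 upd_ne //; lia.
  have m2d1 : m2 d.+1 = Posz 0 by rewrite /m2 upd_eq.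
  have hd2 : tmp0 <= d.+2 by lia.
  have bok st' m' : rep st' m' -> fits m' -> bounded st' -> safe U L c st' ->
    exists m'', [/\ red P (p1 + 5) m' (ctime L c) (p1 + 5 + size l1) m'', rep (run c st') m'',
    forall r, tmp0 <= r < d.+2 -> m'' r = m' r, fits m'' & bounded (run c st')].
    by move=> *; apply: IH.
  have [m3 [r3 rm3 s3 f3 bst3]] := loop_ok hx hd hd3 nL vf i1 i2 i3 i4 i5 i6 i7 i8 bok sf
      (add0n _) rm2 f2 bst m2d m2d1.
  exists m3; split=> //.
  + have -> : pc + size (cexpr e d ++ [:: Const d.+1 0, Binop Defs.Sub d.+2 d d.+1,
      JumpPos d.+2 (p1 + 3), Jump (p1 + 5 + size l1 + 3), Const d.+2 0,
      Binop Add (x + 3) d.+1 d.+2 & l1 ++ [:: Const d.+2 1; Binop Add d.+1 d.+1 d.+2; Jump p1]])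
      = p1 + 5 + size l1 + 3.
      by rewrite size_cat /= size_cat /= /p1; lia.
    apply: red_le (red_trans r1 (red_trans r2 r3)).
    rewrite (size_cexpr e 0 d).
    have := leq_mul nL (leqnn (ctime L c + 7)); lia.
  + by move=> r hr; rewrite s3 // /m2 upd_ne ?s1 //; lia.
Qed.
End Bounds.
End Machine.

(** * Hoare rules *)

Fixpoint mods c : seq nat :=
  match c with
  | Assign x _ | Fetch x _ => [:: x]
  | Store _ _ _ => [::]
  | Seq c1 c2 => mods c1 ++ mods c2
  | For x _ c => x :: mods c
  end.
Fixpoint amods c : seq nat :=
  match c with
  | Assign _ _ | Fetch _ _ => [::]
  | Store a _ _ => [:: a]
  | Seq c1 c2 => amods c1 ++ amods c2
  | For _ _ c => amods c
  end.

Definition agree (xs as_ : seq nat) (st st' : state) :=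
  (forall x, x \notin xs -> sc st' x = sc st x) /\
  (forall a, a \notin as_ -> forall i, ar st' a i = ar st a i).

Lemma agree_sub xs as_ ys bs st st' : {subset xs <= ys} -> {subset as_ <= bs} ->
  agree xs as_ st st' -> agree ys bs st st'.
Proof.
move=> s1 s2 [h1 h2]; split=> [x hx|a ha i].
  by apply: h1; apply: contra hx; apply: s1.
by apply: h2; apply: contra ha; apply: s2.
Qed.
Lemma agree_trans xs as_ st st' st'' : agree xs as_ st st' -> agree xs as_ st' st'' ->
  agree xs as_ st st''.
Proof. by move=> [h1 h2] [h3 h4]; split=> [x hx|a ha i]; rewrite ?h3 ?h4 ?h1 ?h2. Qed.
Lemma agree_setv xs as_ st x v : x \in xs -> agree xs as_ st (setv st x v).
Proof. by move=> hx; split=> // y hy /=; case: eqP => // E; rewrite -E (negPf hy) in hx. Qed.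
Lemma agree_seta xs as_ st a i v : a \in as_ -> agree xs as_ st (seta st a i v).
Proof. by move=> ha; split=> // b hb j /=; case: eqP => // E; rewrite -E (negPf hb) in ha. Qed.

Section Hoare.
Variables (beta : nat) (raw : nat -> int) (U L : nat).
Notation run := (run raw). Notation safe := (safe beta raw U L).

Lemma run_agree c st : agree (mods c) (amods c) st (run c st).
Proof.
elim: c st => [x e|a e1 e2|x e|c1 IH1 c2 IH2|x e c IH] st /=.
- by apply: agree_setv; rewrite inE.
- by apply: agree_seta; rewrite inE.
- by apply: agree_setv; rewrite inE.
- apply: (@agree_trans _ _ _ (run c1 st)).
    by apply: agree_sub (IH1 st) => z hz; rewrite mem_cat hz.
  by apply: agree_sub (IH2 _) => z hz; rewrite mem_cat hz orbT.
- elim: cnt => [|i IHi] //=; apply: agree_trans IHi _.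
  apply: (@agree_trans _ _ _ (setv (iteri i (fun i st => run c (setv st x i)) st) x i)).
    by apply: agree_setv; rewrite inE eqxx.
  by apply: agree_sub (IH _) => // z hz; rewrite inE hz orbT.
Qed.

(** A total correctness statement that includes the size bounds of [safe]. [ok_imp] adds the frame
    property, computed from the syntax by [mods] and [amods], so that invariants mention only what
    changes. *)
Definition ok c st (Q : state -> Prop) := safe c st /\ Q (run c st).

Lemma ok_imp c st (Q Q' : state -> Prop) : ok c st Q ->
  (forall st', agree (mods c) (amods c) st st' -> Q st' -> Q' st') -> ok c st Q'.
Proof. by move=> [h1 h2] h; split=> //; apply: h h2; apply: run_agree. Qed.

Lemma ok_seq c1 c2 st Q : ok c1 st (fun st1 => ok c2 st1 Q) -> ok (Seq c1 c2) st Q.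
Proof. by case=> h1 [h2 h3]. Qed.

Lemma ok_assign x e v st (Q : state -> Prop) : aeval st e = v -> `|v| <= U ->
  Q (setv st x v) -> ok (Assign x e) st Q.
Proof. by move=> E hv hQ; split; rewrite /= E. Qed.

Lemma ok_for x e c st (I : nat -> state -> Prop) n : cnt (aeval st e) = n -> n <= L ->
  I 0 st ->
  (forall i st', i < n -> agree (x :: mods c) (amods c) st st' -> I i st' ->
     ok c (setv st' x i) (I i.+1)) ->
  ok (For x e c) st (I n).
Proof.
move=> En nL I0 step; rewrite /ok /= En.
pose f := fun i st => run c (setv st x (Posz i)).
have h i : i <= n -> I i (iteri i f st) /\ agree (x :: mods c) (amods c) st (iteri i f st).
  elim: i => [|i IH] hi //; have [Ii ag] := IH (ltnW hi); have [_ Ii1] := step _ _ hi ag Ii.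
  split=> //=; apply: agree_trans ag _.
  apply: (@agree_trans _ _ _ (setv (iteri i f st) x i)).
    by apply: agree_setv; rewrite inE eqxx.
  by apply: agree_sub (run_agree _ _) => // z hz; rewrite inE hz orbT.
split; last by case: (h n (leqnn n)).
split=> // i hi; have [Ii ag] := h i (ltnW hi).
by case: (step _ _ hi ag Ii).
Qed.

(** The new value of cell i may depend on its old value, since the loop has not yet touched cells
    from i on; this permits updates in place. *)
Lemma ok_fill x a e ev st n (f : nat -> int) : cnt (aeval st e) = n -> n <= L ->
  (forall i, i < n -> `|f i| <= U) ->
  (forall i st', i < n -> agree [:: x] [:: a] st st' -> sc st' x = i ->
     ar st' a i = ar st a i -> aeval st' ev = f i) ->
  ok (For x e (Store a (Var x) ev)) st (fun st' =>
    (forall i, i < n -> ar st' a i = f i) /\ (forall i, n <= i -> ar st' a i = ar st a i)).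
Proof.
move=> En nL fU fE.
apply: (ok_for (I := fun i st' => (forall j, j < i -> ar st' a j = f j) /\
   (forall j, i <= j -> ar st' a j = ar st a j)) En nL) => // i st' hi ag [h1 h2].
have E : aeval (setv st' x i) ev = f i.
  apply: fE => //=; rewrite ?eqxx ?h2 //.
  by apply: agree_trans ag _; apply: agree_setv; rewrite inE.
split; first by rewrite /= E fU.
rewrite /= E eqxx; split=> j hj /=; rewrite eqxx /=.
  by case: eqP => [->//|ne]; apply: h1; lia.
by rewrite (_ : (j == _) = false) ?h2; lia.
Qed.

Definition Sum x y e ev := Seq (Assign y (Cst 0)) (For x e (Assign y (Op Add (Var y) ev))).

Lemma ok_sum x y e ev st n (f : nat -> int) : x != y ->
  cnt (aeval (setv st y 0) e) = n -> n <= L ->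
  (forall i, i <= n -> `|(\sum_(j < i) f j)%R| <= U) ->
  (forall i st', i < n -> agree [:: x; y] [::] st st' -> sc st' x = i -> aeval st' ev = f i) ->
  ok (Sum x y e ev) st (fun st' => sc st' y = (\sum_(j < n) f j)%R).
Proof.
move=> xy En nL fU fE; apply: ok_seq; apply: (ok_assign (v := 0%Z)) => //.
apply: (ok_for (I := fun i st' => sc st' y = (\sum_(j < i) f j)%R) En nL).
  by rewrite big_ord0 /= eqxx.
move=> i st' hi ag h; apply: (ok_assign (v := (\sum_(j < i.+1) f j)%R)); last 1 first.
- by rewrite /= eqxx.
- rewrite /= big_ord_recr /= eq_sym (negPf xy) h (fE i) //=; last by rewrite eqxx.
  apply: (@agree_trans _ _ _ (setv st y 0)); first by apply: agree_setv; rewrite !inE eqxx orbT.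
  apply: (@agree_trans _ _ _ st'); first exact: ag.
  by apply: agree_setv; rewrite inE eqxx.
- exact: fU.
Qed.
End Hoare.

Lemma absz_sum_le n (f : nat -> int) w i : (forall j, j < n -> `|f j| <= w) -> i <= n ->
  `|(\sum_(j < i) f j)%R| <= n * w.
Proof.
move=> h; elim: i => [|i IH] hi; first by rewrite big_ord0.
rewrite big_ord_recr /=; apply: leq_trans (_ : i.+1 * w <= _); last by rewrite leq_mul2r hi orbT.
have {IH} : `|(\sum_(j < i) f j)%R| <= i * w.
  elim: i hi {IH} => [|i IH] hi; first by rewrite big_ord0.
  have := h i (ltnW hi); have := IH (ltnW hi); rewrite big_ord_recr /=.
  move: (\sum_(j < i) _)%R (f i) => x y; lia.
have := h i hi; move: (\sum_(j < i) _)%R (f i) => x y; lia.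
Qed.

Lemma sum_flat m N (f : nat -> int) :
  (\sum_(x < m * N) f x = \sum_(i < m) \sum_(j < N) f (i * N + j)%N)%R.
Proof.
elim: m => [|m IH]; first by rewrite !big_ord0.
rewrite big_ord_recr /= -IH -(big_mkord xpredT) mulSn addnC.
rewrite (big_cat_nat (n := m * N)) ?leq_addr //= big_mkord; congr (_ + _)%R.
by rewrite -{1}(add0n (m * N)) big_addn addKn big_mkord; apply: eq_bigr => j _; rewrite addnC.
Qed.

Lemma idx_lt N (i j : 'I_N) : i * N + j < N * N.
Proof. have := ltn_ord i; have := ltn_ord j; nia. Qed.

Lemma idx_div N (i j : 'I_N) : (i * N + j) %/ N = i.
Proof.
have N0 : 0 < N by apply: leq_ltn_trans (ltn_ord i).
by rewrite divnMDl // divn_small // addn0.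
Qed.

Lemma idx_ex N x : x < N * N -> exists i j : 'I_N, x = i * N + j.
Proof.
move=> xN; have N0 : 0 < N by case: N xN => //; rewrite mul0n.
have hi : x %/ N < N by rewrite ltn_divLR.
by exists (Ordinal hi), (Ordinal (ltn_pmod x N0)); rewrite /= -divn_eq.
Qed.

Definition holds N (f : nat -> int) (M : 'M[int]_N) := forall i j : 'I_N, f (i * N + j) = M i j.

Lemma holds_ext N (f g : nat -> int) (M : 'M[int]_N) : (forall x, g x = f x) ->
  holds f M -> holds g M.
Proof. by move=> h hf i j; rewrite h. Qed.

(** * Bounds for the matrix entries that occur in the iteration *)

Section Bounds.
Variable N : nat.
Hypothesis N_gt0 : 0 < N.
Notation c := (nc N).
(** The factor by which one multiplication by c I - M can enlarge the entries: N summands, and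
    entries of c I - M of size at most 2 c. *)
Definition nV := 2 * c * N.

Lemma nT_gt0 : 0 < nT N.
Proof. by rewrite /nT muln_gt0 /nR muln_gt0 expn_gt0 N_gt0. Qed.
Lemma nQ_ge1 : 0 < nQ N.
Proof. by rewrite /nQ muln_gt0 nT_gt0 muln_gt0 expn_gt0 N_gt0. Qed.
Lemma nQ_geT : nT N <= nQ N.
Proof. by rewrite /nQ leq_pmull // muln_gt0 expn_gt0 N_gt0. Qed.
Lemma nc'_ge1 : 0 < nc' N.
Proof. by rewrite /nc' muln_gt0 nT_gt0 muln_gt0 expn_gt0 N_gt0. Qed.
Lemma nc_geQ : nQ N <= c.
Proof. by rewrite /nc leq_pmulr // nc'_ge1. Qed.
Lemma nQ_geNN : N * N <= nQ N.
Proof.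
rewrite /nQ -mulnA (mulnC 5) -mulnA; apply: leq_trans (_ : N ^ 6 <= _).
  by rewrite mulnn leq_pexp2l.
by rewrite leq_pmulr // muln_gt0 nT_gt0.
Qed.
Lemma nV_ge : 2 * c <= nV.
Proof. by rewrite /nV leq_pmulr. Qed.
Lemma nV_gt0 : 0 < nV.
Proof. by apply: leq_trans nV_ge; have := nc_geQ; have := nQ_ge1; lia. Qed.

Lemma mulB_bound (M Y : 'M[int]_N) p : (forall i j, `|M i j| <= c) ->
  (forall i j, `|Y i j| <= nV ^ p) ->
  forall i j, `|(Y *m ((nc N)%:Z%:M - M))%R i j| <= nV ^ p.+1.
Proof.
move=> hM hY i j; have hB k : `|((nc N)%:Z%:M - M)%R k j| <= 2 * c.
  rewrite !mxE; have := hM k j; case: (k == j) => /=; rewrite ?mulr1n ?mulr0n; lia.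
have : (`|(Y *m ((nc N)%:Z%:M - M)) i j| <= N%:Z * (nV ^ p * (2 * c))%N%:Z)%R.
  rewrite mxE; apply: norm_sum_le => k; have := leq_mul (hY i k) (hB k).
  by rewrite -abszM; move: (Y i k * _)%R (nV ^ p * _) => x y; lia.
rewrite expnS -PoszM; have -> : N * (nV ^ p * (2 * c)) = nV * nV ^ p by rewrite /nV; ring.
by move: ((Y *m _)%R i j) (nV * _) => x y; lia.
Qed.

Lemma iterY_bound (M : 'M[int]_N) p : (forall i j, `|M i j| <= c) ->
  forall i j, `|iterY M p i j| <= nV ^ p.
Proof.
move=> hM; elim: p => [|p IH] i j.
  by rewrite expn0 mxE; case: (i == j).
rewrite /iterY iterS -/(iterY M p) /nextY; case: ifP => _; last exact: mulB_bound.
by rewrite expnS; apply: leq_trans (IH i j) _; rewrite leq_pmull // nV_gt0.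
Qed.

Variable e : rel 'I_N.
Hypothesis e_sym : symmetric e.
Variable t : nat.
Hypotheses (t_gt0 : 0 < t) (t_lt : t < N).

Lemma ncE : c = 5 * N ^ 5 * nT N * nQ N.
Proof. by rewrite /nc mulnC. Qed.

Lemma runS_bound s : s <= nT N -> let S := (runS e t s).1 in
  [/\ forall i j, `|S i j| <= nT N * nQ N, `|Dval t S| <= c & forall i j, `|Mmx e t S i j| <= c].
Proof.
move=> sT S; have [s' [s's iS _ _]] := runSP N_gt0 e_sym t_gt0 t_lt sT.
have hS := invS_bound N_gt0 t_gt0 t_lt (leq_trans s's sT) iS; rewrite -/S in hS.
have hM := Mmx_bound N_gt0 e t_gt0 t_lt hS.
have hD := Dval_bound N_gt0 t_gt0 t_lt (isT : (0 <= (nT N * nQ N)%N%:Z)%R) hS.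
have le x y : x <= y -> x * (nT N * nQ N) <= y * (nT N * nQ N) by move=> h; rewrite leq_mul2r h orbT.
have cE : c = 5 * N ^ 5 * (nT N * nQ N) by rewrite ncE; ring.
split=> [i j||i j].
- by have := hS i j; lia.
- have h : 2 * N ^ 3 <= 5 * N ^ 5 by apply: leq_mul => //; rewrite leq_pexp2l.
  have {}h := le _ _ h; rewrite cE; move: hD h.
  rewrite -(natz (nT N * nQ N)) -(natz N) -natrX -!natrM natz; lia.
- have h : 5 * N ^ 4 <= 5 * N ^ 5 by apply: leq_mul => //; rewrite leq_pexp2l.
  have {}h := le _ _ h; rewrite cE; have := hM i j; move: h.
  by rewrite -mulrA -PoszM -(natz N) -natrX -(natz (nT N * nQ N)) -!natrM natz; lia.
Qed.
End Bounds.

(** * The program *)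

Section Program.

Local Notation "e1 ⊕ e2" := (Op Add e1 e2) (at level 50, left associativity).
Local Notation "e1 ⊖ e2" := (Op Defs.Sub e1 e2) (at level 50, left associativity).
Local Notation "e1 ⊗ e2" := (Op Mul e1 e2) (at level 40, left associativity).
Local Notation "e1 ⊘ e2" := (Op Div e1 e2) (at level 40, left associativity).
Local Notation "# x" := (Var x) (at level 1, x at level 0, format "# x").
Local Notation "## z" := (Cst z) (at level 1, z at level 0, format "## z").
Local Notation "c1 ;;; c2" := (Seq c1 c2) (at level 80, right associativity).

Local Notation vk := 0%N. Local Notation vn := 1%N. Local Notation vN := 2%N.
Local Notation vNN := 3%N. Local Notation vT := 4%N. Local Notation vQ := 5%N.
Local Notation vc := 6%N. Local Notation vt := 7%N. Local Notation vs := 8%N.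
Local Notation vp := 9%N. Local Notation vi := 10%N. Local Notation vl := 11%N.
Local Notation vacc := 12%N. Local Notation vD := 13%N. Local Notation vtau := 14%N.
Local Notation vg := 15%N. Local Notation vres := 16%N. Local Notation vfl := 17%N.
Local Notation vfd := 18%N. Local Notation vt1 := 19%N. Local Notation vm := 20%N.
Local Notation vR := 21%N. Local Notation vx := 22%N. Local Notation vy := 23%N.
Local Notation va := 24%N. Local Notation vb := 25%N.
Local Notation aIN := 0%N. Local Notation aE := 1%N. Local Notation aI := 2%N.
Local Notation aS := 3%N. Local Notation aM := 4%N. Local Notation aY := 5%N.
Local Notation aZ := 6%N.

(* vtau, vg and vfd receive tr Y, <M, Y> and the truth value of [good M Y]. *)
Definition check_cmd : cmd :=
  Sum vi vtau #vN (Arr aY (#vi ⊗ #vN ⊕ #vi)) ;;;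
  Sum vi vg #vNN (Arr aM #vi ⊗ Arr aY #vi) ;;;
  Assign vm (#vg ⊖ #vQ ⊗ #vtau) ;;;
  Assign vfd (##0 ⊖ #vm ⊘ (#vm ⊗ #vm ⊕ ##1)).

Definition mul_cmd : cmd :=
  For vi #vNN (
    Assign vx (#vi ⊘ #vN) ;;;
    Assign vy (#vi ⊖ #vx ⊗ #vN) ;;;
    Sum vl vacc #vN (Arr aY (#vx ⊗ #vN ⊕ #vl) ⊗
      (#vc ⊗ Arr aI (#vl ⊗ #vN ⊕ #vy) ⊖ Arr aM (#vl ⊗ #vN ⊕ #vy))) ;;;
    Store aZ #vi #vacc).

(** One round is [nextY]. The product is computed in any case, and the factor 1 - [vfd] then selects
    between it and the old matrix. *)
Definition power_cmd : cmd :=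
  For vp #vQ (
    check_cmd ;;;
    mul_cmd ;;;
    For vi #vNN (Store aY #vi
      (Arr aY #vi ⊕ (##1 ⊖ #vfd) ⊗ (Arr aZ #vi ⊖ Arr aY #vi)))).

(** In a failing step the factor [vfd] is 0 and cancels the update together with its quotient by tr
    Y, as the conditional in [nextS] does. *)
Definition step_cmd : cmd :=
  Sum vi vD #vNN ((#vt1 ⊗ Arr aI #vi ⊖ ##2) ⊗ Arr aS #vi) ;;;
  For vi #vNN (Store aM #vi
    (Arr aE #vi ⊗ Arr aS #vi ⊕ #vD ⊗ (#vt1 ⊗ Arr aI #vi ⊖ ##2))) ;;;
  For vi #vNN (Store aY #vi (Arr aI #vi)) ;;;
  power_cmd ;;;
  check_cmd ;;;
  For vi #vNN (Store aS #vi
    (Arr aS #vi ⊕ #vfd ⊗ ((#vQ ⊗ Arr aY #vi) ⊘ #vtau))) ;;;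
  Assign vfl (#vfl ⊗ #vfd).

(** The loop variable [vt] starts at 0 and stands for t - 1, so that 2 t + 1 becomes 2 [vt] + 3. *)
Definition test_cmd : cmd :=
  Assign vfl ##1 ;;;
  Assign vt1 (##2 ⊗ #vt ⊕ ##3) ;;;
  For vi #vNN (Store aS #vi ##0) ;;;
  For vs #vT step_cmd.

Definition main_cmd : cmd :=
  For vt (#vN ⊖ ##1) (test_cmd ;;; Assign vres (#vres ⊕ #vfl)).

Lemma idx_inj N (i j i' j' : 'I_N) : i * N + j = i' * N + j' -> i = i' /\ j = j'.
Proof.
move=> E; have Ei : i = i' :> nat by rewrite -(idx_div i j) E idx_div.
split; apply: val_inj => //=; move: E; rewrite Ei; lia.
Qed.

(* The language has no tests: comparisons are computed by division. *)
Lemma sgn_div (z : int) : (0 - (z %/ (z * z + 1))%Z)%R = Posz (z < 0)%R.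
Proof.
case: (ltP z 0%R) => z0.
  have -> : (z %/ (z * z + 1))%Z = (-1)%R.
    have h := divz_eq z (z * z + 1); have p : (0 < z * z + 1)%R by nia.
    have := ltz_pmod z p; have := modz_ge0 z (lt0r_neq0 p).
    move: h; move: (_ %/ _)%Z (_ %% _)%Z => q r h h1 h2.
    nia.
  by [].
have -> : (z %/ (z * z + 1))%Z = 0%R by apply: divz_small; nia.
by [].
Qed.

Lemma divz_idx N (i j : 'I_N) : ((i * N + j)%N%:Z %/ N%:Z)%Z = i.
Proof. by rewrite divz_nat idx_div. Qed.

(** * Correctness of the test and of the main loop *)

Section Verify.
Variables (beta : nat) (raw : nat -> int) (U L N : nat).
Hypothesis N_gt0 : 0 < N.
Notation c := (nc N). Notation T := (nT N). Notation Q := (nQ N). Notation V := (nV N).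
Hypothesis HU : V ^ (Q + 3) + 64 <= U.
Hypothesis HL : Q <= L.
Variable e : rel 'I_N.
Hypothesis e_sym : symmetric e.
Notation ok := (ok beta raw U L).

Let Nc : N * N <= c. Proof. exact: leq_trans (nQ_geNN N_gt0) (nc_geQ N_gt0). Qed.
Let NN1 : N <= N * N. Proof. by rewrite leq_pmulr. Qed.
Let NNL : N * N <= L. Proof. exact: leq_trans (nQ_geNN N_gt0) HL. Qed.
Let NL : N <= L. Proof. exact: leq_trans NNL. Qed.
Let TL : T <= L. Proof. exact: leq_trans (nQ_geT N_gt0) HL. Qed.
Let VV i : i <= Q + 3 -> V ^ i <= V ^ (Q + 3).
Proof. by move=> h; rewrite leq_pexp2l // nV_gt0. Qed.
Let VU : V ^ (Q + 3) <= U. Proof. by apply: leq_trans HU; rewrite leq_addr. Qed.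
Let cV : 2 * c <= V := nV_ge N_gt0.
Let V_U : V <= U.
Proof. by apply: leq_trans VU; rewrite -{1}(expn1 V) leq_pexp2l ?nV_gt0 ?addn3. Qed.
Let cU : c <= U. Proof. by apply: leq_trans V_U; lia. Qed.

Definition ones : 'M[int]_N := 1%:M.

Definition env st :=
  [/\ sc st vN = N, sc st vNN = (N * N)%N, sc st vT = T, sc st vQ = Q & sc st vc = c] /\
  (holds (ar st aE) (\matrix_(i, j) (e i j)%:R : 'M[int]_N)%R /\ holds (ar st aI) ones).

Lemma env_agree xs as_ st st' : agree xs as_ st st' ->
  [&& vN \notin xs, vNN \notin xs, vT \notin xs, vQ \notin xs & vc \notin xs] ->
  (aE \notin as_) && (aI \notin as_) -> env st -> env st'.
Proof.
move=> [h1 h2] /and5P[n1 n2 n3 n4 n5] /andP[a1 a2] [[e1 e2 e3 e4 e5] [e6 e7]].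
split; first by split; rewrite h1.
by split; apply: holds_ext (h2 _ _) _.
Qed.

Lemma env_N st : env st -> sc st vN = N. Proof. by case=> -[]. Qed.
Lemma env_NN st : env st -> sc st vNN = (N * N)%N. Proof. by case=> -[]. Qed.
Lemma env_Q st : env st -> sc st vQ = Q. Proof. by case=> -[]. Qed.
Lemma env_T st : env st -> sc st vT = T. Proof. by case=> -[]. Qed.

Definition goodb (M Y : 'M[int]_N) : int := Posz (good M Y).

Lemma check_ok st M Y : env st -> holds (ar st aM) M -> holds (ar st aY) Y ->
  (forall i j, `|M i j| <= c) -> (forall i j, `|Y i j| <= V ^ Q) ->
  ok check_cmd st (fun st' => sc st' vtau = (\tr Y)%R /\ sc st' vfd = goodb M Y).
Proof.
move=> env0 hM hY bM bY.
have Q1 := nQ_ge1 N_gt0; have Vp := expn_gt0 V Q; rewrite nV_gt0 // in Vp.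
have e3 : V ^ (Q + 3) = V * (V * V) * V ^ Q by rewrite addn3 !expnS; ring.
have NV : N <= V by apply: leq_trans NN1 _; apply: leq_trans Nc _; lia.
have V1 := nV_gt0 N_gt0.
have btau : N * V ^ Q <= U.
  by apply: leq_trans VU; rewrite e3 leq_mul2r; apply/orP; right; nia.
(* Both <M, Y> and Q tr Y are at most N^2 c V^Q; the factor 2 covers their difference. The product N
   V V^Q fits because of the spare powers of V in the exponent Q + 3. *)
have bg : N * N * (c * V ^ Q) * 2 <= U.
  apply: leq_trans VU; have -> : N * N * (c * V ^ Q) * 2 = N * V * V ^ Q by rewrite /nV; ring.
  by rewrite e3 leq_mul2r mulnC leq_mul2l; apply/orP; right; nia.
apply: ok_seq; apply: ok_imp.
  apply: (@ok_sum _ _ _ _ _ _ _ _ _ N (fun i => ar st aY (i * N + i))) => //.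
  - by case: env0 => -[/= ->].
  - move=> i hi; apply: leq_trans btau.
    apply: (@absz_sum_le N (fun i => ar st aY (i * N + i)) (V ^ Q)) => // j hj; rewrite -[j]/(nat_of_ord (Ordinal hj)) hY; exact: bY.
  - move=> i st' hi [ag1 ag2] hs; rewrite /= hs ag1 // ag2 //.
    by case: env0 => -[-> _ _ _ _] _; rewrite -PoszM -PoszD absz_nat.
move=> st1 ag1 Etau.
have {Etau} Etau : sc st1 vtau = (\tr Y)%R.
  by rewrite Etau; apply: eq_bigr => i _; rewrite hY.
have env1 := env_agree ag1 isT isT env0.
have hM1 : holds (ar st1 aM) M by apply: holds_ext hM; apply: ag1.2.
have hY1 : holds (ar st1 aY) Y by apply: holds_ext hY; apply: ag1.2.
have bMY j : j < N * N -> `|(ar st1 aM j * ar st1 aY j)%R| <= c * V ^ Q.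
  by move=> /idx_ex[i [k ->]]; rewrite hM1 hY1 abszM leq_mul.
apply: ok_seq; apply: ok_imp.
  apply: (@ok_sum _ _ _ _ _ _ _ _ _ (N * N) (fun i => ar st1 aM i * ar st1 aY i)%R) => //.
  - by case: env1 => -[/= _ ->].
  - move=> i hi; apply: (@leq_trans (N * N * (c * V ^ Q))); last by lia.
    exact: (@absz_sum_le (N * N) (fun i => ar st1 aM i * ar st1 aY i)%R).
  - by move=> i st' hi [ag1' ag2'] hs; rewrite /= hs !ag2'.
move=> st2 ag2 Eg.
have {Eg} Eg : sc st2 vg = ip M Y.
  rewrite Eg (sum_flat N N (fun i => ar st1 aM i * ar st1 aY i)%R); apply: eq_bigr => i _; apply: eq_bigr => j _.
  by rewrite hM1 hY1.
have Etau2 : sc st2 vtau = (\tr Y)%R by rewrite ag2.1.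
have Q2 : sc st2 vQ = Q by rewrite ag2.1 //; case: env1 => -[].
have bip : `|ip M Y| <= N * N * (c * V ^ Q).
  have hM' i j : (`|M i j| <= (nc N)%:Z)%R by have := bM i j; lia.
  have hY' i j : (`|Y i j| <= (V ^ Q)%N%:Z)%R by have := bY i j; lia.
  have := norm_ip_le hM' hY'; rewrite -!PoszM mulnA; lia.
have btr : `|(\tr Y)%R| <= N * V ^ Q.
  have := @norm_sum_le N (fun i => Y i i) (V ^ Q)%N (fun i => ltac:(have := bY i i; lia)).
  rewrite -PoszM -/(\tr Y)%R; lia.
have bQ : Q * (N * V ^ Q) <= N * N * (c * V ^ Q).
  have -> : N * N * (c * V ^ Q) = N * (c * (N * V ^ Q)) by ring.
  apply: leq_trans (_ : c * (N * V ^ Q) <= _); last by rewrite leq_pmull.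
  by rewrite leq_mul2r nc_geQ ?orbT.
apply: ok_seq; apply: (@ok_assign _ _ _ _ _ _ ((ip M Y - Q%:Z * \tr Y)%R)).
- by rewrite /= Eg Etau2 Q2.
- have : `|(Q%:Z * \tr Y)%R| <= Q * (N * V ^ Q) by rewrite abszM leq_mul2l btr orbT.
  by move: (_ * _)%R => x; lia.
apply: (@ok_assign _ _ _ _ _ _ (goodb M Y)).
- by rewrite /= sgn_div subr_lt0.
- by rewrite /goodb; case: good => /=; lia.
- by rewrite /= Etau2.
Qed.

Lemma mul_ok st (M Y : 'M[int]_N) p : env st -> holds (ar st aM) M -> holds (ar st aY) Y ->
  (forall i j, `|M i j| <= c) -> (forall i j, `|Y i j| <= V ^ p) -> p < Q ->
  ok mul_cmd st (fun st' => holds (ar st' aZ) (Y *m ((nc N)%:Z%:M - M))%R).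
Proof.
move=> env0 hM hY bM bY pQ.
pose B : 'M[int]_N := ((nc N)%:Z%:M - M)%R.
have bB k j : `|B k j| <= 2 * c.
  rewrite !mxE; have := bM k j; case: (k == j) => /=; rewrite ?mulr1n ?mulr0n; lia.
have bp : N * (V ^ p * (2 * c)) <= U.
  have -> : N * (V ^ p * (2 * c)) = V ^ p.+1 by rewrite expnS /nV; ring.
  by apply: leq_trans VU; apply: VV; lia.
rewrite -/B.
apply: ok_imp; first apply: (@ok_for _ _ _ _ _ _ _ _
  (fun n st' => forall i j : 'I_N, i * N + j < n -> ar st' aZ (i * N + j) = (Y *m B)%R i j) (N * N)) => //.
- by rewrite /= (env_NN env0).
- move=> x st1 xN ag1 IH; have [i [j xE]] := idx_ex xN.
  have env1 := env_agree ag1 isT isT env0.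
  have hM1 : holds (ar st1 aM) M by apply: holds_ext hM; apply: ag1.2.
  have hY1 : holds (ar st1 aY) Y by apply: holds_ext hY; apply: ag1.2.
  case: env1 => [[n1 n2 n3 n4 n5] [_ hI]].
  apply: ok_seq; apply: (@ok_assign _ _ _ _ _ _ (i : nat)).
  + by rewrite /= n1 xE divz_idx.
  + by have := ltn_ord i; rewrite /=; move: NN1 Nc cU; lia.
  apply: ok_seq; apply: (@ok_assign _ _ _ _ _ _ (j : nat)).
  + by rewrite /= n1 xE; lia.
  + by have := ltn_ord j; rewrite /=; move: NN1 Nc cU; lia.
  set st2 := setv _ vy _.
  pose f l : int := (ar st1 aY (i * N + l) *
    (c%:Z * ar st1 aI (l * N + j) - ar st1 aM (l * N + j)))%R.
  have fE (l : 'I_N) : f l = (Y i l * B l j)%R.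
    by rewrite /f hY1 hM1 hI !mxE; case: (l == j); rewrite ?mulr1 ?mulr0 ?mulr1n ?mulr0n.
  apply: ok_seq; apply: ok_imp.
    apply: (@ok_sum _ _ _ _ _ _ _ _ _ N f) => //.
    * by rewrite /= n1.
    * move=> k hk; apply: leq_trans bp; apply: absz_sum_le hk => l hl.
      by rewrite -[l]/(nat_of_ord (Ordinal hl)) fE abszM leq_mul.
    * move=> l st3 hl [ag3 ag3'] hs.
      rewrite /= hs !ag3 // !ag3' // /st2 /= n1 n5.
      by rewrite -!PoszM -!PoszD !absz_nat.
  move=> st3 ag3 Es.
  have {Es} Es : sc st3 vacc = (Y *m B)%R i j.
    by rewrite Es mxE; apply: eq_bigr => l _; rewrite fE.
  split; first rewrite /= Es.
    have h : (`|(Y *m B) i j| <= N%:Z * (V ^ p * (2 * c))%N%:Z)%R.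
      rewrite mxE; apply: norm_sum_le => k; have := leq_mul (bY i k) (bB k j).
      by rewrite -abszM; move: (Y i k * _)%R (V ^ p * _) => a b; lia.
    by move: h bp; rewrite -PoszM; move: ((Y *m B)%R i j) => a; lia.
  move=> i' j' hlt; rewrite /= Es ag3.1 // /st2 /= xE; case: eqP => [E|ne].
    by have [-> ->] := idx_inj E.
  by rewrite ag3.2 // /= IH //; move: ne hlt; rewrite xE; lia.
move=> st' ag' h i j; apply: h; exact: idx_lt.
Qed.

Lemma upd_ok st (Y Z : 'M[int]_N) (g : bool) w : env st -> holds (ar st aZ) Z ->
  holds (ar st aY) Y -> sc st vfd = g -> w <= U ->
  (forall i j, `|Y i j| <= w) -> (forall i j, `|Z i j| <= w) ->
  ok (For vi #vNN (Store aY #vi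
      (Arr aY #vi ⊕ (##1 ⊖ #vfd) ⊗ (Arr aZ #vi ⊖ Arr aY #vi)))) st
    (fun st' => holds (ar st' aY) (if g then Y else Z)).
Proof.
move=> env0 hZ hY hg wU bY bZ.
apply: ok_imp.
  apply: (@ok_fill _ _ _ _ _ _ _ _ _ (N * N)
    (fun x => if g then ar st aY x else ar st aZ x)) => //.
  - by rewrite /= (env_NN env0).
  - by move=> x /idx_ex[i [j ->]]; case: (g); rewrite ?hY ?hZ; apply: leq_trans wU.
  - move=> x st1 xN [ag1 ag2] hs h; rewrite /= hs absz_nat h ag2 // ag1 // hg.
    by case: (g) => /=; ring.
move=> st' _ [h _] i j; rewrite h ?idx_lt //.
by case: (g); rewrite ?hY ?hZ.
Qed.

Lemma power_ok st (M : 'M[int]_N) : env st -> holds (ar st aM) M ->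
  holds (ar st aY) ones -> (forall i j, `|M i j| <= c) ->
  ok power_cmd st (fun st' => holds (ar st' aY) (iterY M Q)).
Proof.
move=> env0 hM hY bM.
apply: (@ok_for _ _ _ _ _ _ _ _ (fun p st' => holds (ar st' aY) (iterY M p)) Q) => //.
  by rewrite /= (env_Q env0).
move=> p st1 pQ ag1 hY1; set st1' := setv st1 _ _.
have env1 : env st1'.
  exact: env_agree (@agree_setv [:: vp] [::] st1 vp p isT) isT isT (env_agree ag1 isT isT env0).
have hM1 : holds (ar st1' aM) M by apply: holds_ext hM; apply: ag1.2.
have bY := @iterY_bound N N_gt0 M p bM.
have bYQ i j : `|iterY M p i j| <= V ^ Q.
  by apply: leq_trans (bY i j) _; rewrite leq_pexp2l ?nV_gt0 // ltnW.
apply: ok_seq; apply: ok_imp (check_ok env1 hM1 hY1 bM bYQ) _ => st2 ag2 [_ fd2].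
have env2 := env_agree ag2 isT isT env1.
have hM2 : holds (ar st2 aM) M by apply: holds_ext hM1; apply: ag2.2.
have hY2 : holds (ar st2 aY) (iterY M p) by apply: holds_ext hY1; apply: ag2.2.
apply: ok_seq; apply: ok_imp (mul_ok env2 hM2 hY2 bM bY pQ) _ => st3 ag3 hZ3.
have env3 := env_agree ag3 isT isT env2.
have hY3 : holds (ar st3 aY) (iterY M p) by apply: holds_ext hY2; apply: ag3.2.
have fd3 : sc st3 vfd = good M (iterY M p) by rewrite ag3.1.
have wU : V ^ p.+1 <= U by apply: leq_trans VU; apply: VV; lia.
apply: (upd_ok env3 hZ3 hY3 fd3 wU) => i j.
  by apply: leq_trans (bY i j) _; rewrite leq_pexp2l ?nV_gt0.
exact: mulB_bound.
Qed.

Section Test.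
Variable t : nat.
Hypotheses (t_gt0 : 0 < t) (t_lt : t < N).

Lemma Kmx_eval x (i j : 'I_N) : sc x vt1 = (2 * t + 1)%N -> holds (ar x aI) ones ->
  (sc x vt1 * ar x aI (i * N + j)%N - 2)%R = Kmx N t i j.
Proof. by move=> -> ->; rewrite !mxE. Qed.

Lemma step_ok st s : env st -> sc st vt1 = (2 * t + 1)%N -> s < T ->
  holds (ar st aS) (runS e t s).1 -> sc st vfl = (runS e t s).2 ->
  ok step_cmd st (fun st' => holds (ar st' aS) (runS e t s.+1).1 /\
                          sc st' vfl = (runS e t s.+1).2).
Proof.
move=> env0 ht1 sT; set S := (runS e t s).1 => hS hfl.
have [bS bD bM] := runS_bound N_gt0 e_sym t_gt0 t_lt (ltnW sT); rewrite -/S in bS bD bM.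
have [bS' _ _] := runS_bound N_gt0 e_sym t_gt0 t_lt sT.
pose f x : int := ((sc st vt1 * ar st aI x - 2) * ar st aS x)%R.
have fE (i j : 'I_N) : f (i * N + j) = (Kmx N t i j * S i j)%R.
  by rewrite /f hS Kmx_eval //; case: env0 => _ [].
have TQc : N * N * (2 * N * (T * Q)) <= c.
  rewrite ncE; have -> : N * N * (2 * N * (T * Q)) = 2 * N ^ 3 * (T * Q) by ring.
  have -> : 5 * N ^ 5 * T * Q = 5 * N ^ 5 * (T * Q) by ring.
  by rewrite leq_mul2r; apply/orP; right; apply: leq_mul => //; rewrite leq_pexp2l.
apply: ok_seq; apply: ok_imp.
  apply: (@ok_sum _ _ _ _ _ _ _ _ _ (N * N) f) => //.
  - by rewrite /= (env_NN env0).
  - move=> i hi; apply: leq_trans cU; apply: leq_trans TQc; apply: absz_sum_le hi => x.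
    move=> /idx_ex[a [b ->]]; rewrite fE abszM leq_mul //.
    by have := Kmx_bound N_gt0 t_gt0 t_lt a b; lia.
  - move=> i st' hi [ag1 ag2] hs; rewrite /= hs absz_nat !ag2 // ag1 //.
move=> st1 ag1 ED.
have {ED} ED : sc st1 vD = Dval t S.
  rewrite ED (sum_flat N N f); apply: eq_bigr => i _; apply: eq_bigr => j _; exact: fE.
have env1 := env_agree ag1 isT isT env0.
have hS1 : holds (ar st1 aS) S by apply: holds_ext hS; apply: ag1.2.
have t11 : sc st1 vt1 = (2 * t + 1)%N by rewrite ag1.1.
case: (env1) => _ [hE1 hI1].
apply: ok_seq; apply: ok_imp.
  apply: (@ok_fill _ _ _ _ _ _ _ _ _ (N * N) (fun x => ar st1 aE x * ar st1 aS x
     + sc st1 vD * (sc st1 vt1 * ar st1 aI x - 2))%R) => //.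
  - by rewrite /= (env_NN env1).
  - move=> x /idx_ex[i [j ->]]; rewrite hE1 hS1 ED Kmx_eval // mxE.
    by have := bM i j; rewrite mxE => h; apply: leq_trans h cU.
  - by move=> x st' xN [a1 a2] hs h; rewrite /= hs !absz_nat !a2 // !a1.
move=> st2 ag2 [hM2 _].
have {}hM2 : holds (ar st2 aM) (Mmx e t S).
  by move=> i j; rewrite hM2 ?idx_lt // hE1 hS1 ED Kmx_eval // !mxE.
have env2 := env_agree ag2 isT isT env1.
apply: ok_seq; apply: ok_imp.
  apply: (@ok_fill _ _ _ _ _ _ _ _ _ (N * N) (ar st2 aI)) => //.
  - by rewrite /= (env_NN env2).
  - move=> x /idx_ex[i [j ->]]; case: env2 => _ [_ ->]; rewrite mxE.
    by case: (i == j) => /=; lia.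
  - by move=> x st' xN [a1 a2] hs h; rewrite /= hs !absz_nat !a2.
move=> st3 ag3 [hY3 _].
have {}hY3 : holds (ar st3 aY) ones.
  by move=> i j; rewrite hY3 ?idx_lt //; case: env2 => _ [_ ->].
have env3 := env_agree ag3 isT isT env2.
have hM3 : holds (ar st3 aM) (Mmx e t S) by apply: holds_ext hM2; apply: ag3.2.
apply: ok_seq; apply: ok_imp (power_ok env3 hM3 hY3 bM) _ => st4 ag4 hY4.
have env4 := env_agree ag4 isT isT env3.
have hM4 : holds (ar st4 aM) (Mmx e t S) by apply: holds_ext hM3; apply: ag4.2.
set Y := iterY _ _ in hY4.
have bY := @iterY_bound N N_gt0 (Mmx e t S) Q bM.
apply: ok_seq; apply: ok_imp (check_ok env4 hM4 hY4 bM bY) _ => st5 ag5 [tau5 fd5].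
have env5 := env_agree ag5 isT isT env4.
have hY5 : holds (ar st5 aY) Y by apply: holds_ext hY4; apply: ag5.2.
have hS5 : holds (ar st5 aS) S.
  by move=> i j; rewrite ag5.2 // ag4.2 // ag3.2 // ag2.2 // hS1.
have fl5 : sc st5 vfl = (runS e t s).2.
  by rewrite ag5.1 // ag4.1 // ag3.1 // ag2.1 // ag1.1.
have nextE : runS e t s.+1 = if good (Mmx e t S) Y then (addS Y S, (runS e t s).2) else (S, false) by [].
pose h x : int := (ar st5 aS x + sc st5 vfd * ((sc st5 vQ * ar st5 aY x) %/ sc st5 vtau)%Z)%R.
have hE (i j : 'I_N) : h (i * N + j) = (runS e t s.+1).1 i j.
  rewrite /h hS5 hY5 tau5 fd5 (env_Q env5) nextE /goodb; case: (good _ _) => /=.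
    by rewrite mul1r mxE.
  by rewrite mul0r addr0.
apply: ok_seq; apply: ok_imp.
  apply: (@ok_fill _ _ _ _ _ _ _ _ _ (N * N) h) => //.
  - by rewrite /= (env_NN env5).
  - move=> x /idx_ex[i [j ->]]; rewrite hE; apply: leq_trans (bS' i j) _.
    by apply: leq_trans cU; rewrite ncE -mulnA leq_pmull // muln_gt0 expn_gt0 N_gt0.
  - by move=> x st' xN [a1 a2] hs hx; rewrite /= hs !absz_nat hx !a2 // !a1.
move=> st6 ag6 [hS6 _].
apply: (@ok_assign _ _ _ _ _ _ ((runS e t s.+1).2 : nat)).
- rewrite -[aeval _ _]/(sc st6 vfl * sc st6 vfd)%R.
  rewrite ag6.1 // fl5 ag6.1 // fd5 nextE /goodb; case: good => /=.
    by rewrite mulr1.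
  by rewrite mulr0.
- by case: (runS e t s.+1).2 => /=; lia.
split=> // i j; rewrite /= hS6 ?idx_lt //.
Qed.

Lemma test_ok st : env st -> sc st vt = t.-1 ->
  ok test_cmd st (fun st' => sc st' vfl = (runS e t T).2).
Proof.
move=> env0 ht.
apply: ok_seq; apply: (@ok_assign _ _ _ _ _ _ 1%Z) => //; first by lia.
set st1 := setv _ _ _.
apply: ok_seq; apply: (@ok_assign _ _ _ _ _ _ (2 * t + 1)%N).
- by rewrite /= ht; lia.
- by move: cU Nc NN1; rewrite /=; lia.
set st2 := setv _ _ _.
have env2 : env st2.
  apply: env_agree (@agree_setv [:: vt1] [::] st1 vt1 _ isT) isT isT _.
  exact: env_agree (@agree_setv [:: vfl] [::] st vfl _ isT) isT isT env0.
apply: ok_seq; apply: ok_imp.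
  apply: (@ok_fill _ _ _ _ _ _ _ _ _ (N * N) (fun x => 0%Z)) => //.
  by rewrite -[aeval _ _]/(sc st2 vNN) (env_NN env2).
move=> st3 ag3 [hS3 _].
have env3 := env_agree ag3 isT isT env2.
apply: ok_imp.
  apply: (@ok_for _ _ _ _ _ _ _ _ (fun s st' => holds (ar st' aS) (runS e t s).1 /\
      sc st' vfl = (runS e t s).2) T) => //.
  - by rewrite /= (env_T env3).
  - split; first by move=> i j; rewrite hS3 ?idx_lt // mxE.
    by rewrite ag3.1.
  - move=> s st4 sT ag4 [hS4 fl4].
    have env4 := env_agree ag4 isT isT env3.
    apply: step_ok => //.
    by rewrite /= ag4.1 // ag3.1.
by move=> st' _ [].
Qed.
End Test.

Lemma main_ok st : env st -> sc st vres = 1%Z ->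
  ok main_cmd st (fun st' => sc st' vres = (1 + \sum_(t < N.-1) (runS e t.+1 T).2)%N).
Proof.
move=> env0 h0.
apply: (@ok_for _ _ _ _ _ _ _ _ (fun n st' => sc st' vres = (1 + \sum_(t < n) (runS e t.+1 T).2)%N) N.-1).
- rewrite -[aeval _ _]/(sc st vN - 1)%R (env_N env0).
  by have -> : (Posz N - 1)%R = Posz N.-1 by lia.
- by move: NL; lia.
- by rewrite big_ord0.
move=> t st1 ht ag1 h1; set st2 := setv _ _ _.
have env2 : env st2.
  exact: env_agree (@agree_setv [:: vt] [::] st1 vt t isT) isT isT (env_agree ag1 isT isT env0).
have t1 : t.+1 < N by lia.
apply: ok_seq; apply: ok_imp (@test_ok t.+1 isT t1 _ env2 _) _ => // st3 ag3 fl3.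
have b : \sum_(i < t) (runS e i.+1 T).2 <= t.
  rewrite -[X in _ <= X]card_ord -sum1_card; apply: leq_sum => i _; exact: leq_b1.
apply: (@ok_assign _ _ _ _ _ _ (1 + \sum_(i < t.+1) (runS e i.+1 T).2)%N).
- rewrite -[aeval _ _]/(sc st3 vres + sc st3 vfl)%R fl3 ag3.1 // /st2 [sc _ _]/= h1.
  by rewrite big_ord_recr addnA.
- have tU : 1 + (t + 1) <= U by move: cU Nc NN1; lia.
  apply: leq_trans tU; rewrite absz_nat big_ord_recr leq_add2l.
  exact: leq_add b (leq_b1 _).
- by [].
Qed.
End Verify.

(** Equality test by division: the quotient of 1 by d^2 + 1 is 1 for d = 0 and 0 otherwise. *)
Definition eeq e1 e2 : expr := ##1 ⊘ ((e1 ⊖ e2) ⊗ (e1 ⊖ e2) ⊕ ##1).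

(* The prelude stores n + 2 instead of n, and copies only the input registers below
   64 to the array aIN. *)
Definition input_cmd : cmd :=
  Assign vk (Arr aIN ##0) ;;;
  Assign vn (Arr aIN ##1 ⊖ ##2) ;;;
  For vi (#vn ⊗ #vn ⊕ ##2 ⊖ ##64) (
    Assign vl (#vi ⊕ ##64) ;;; Fetch vm #vl ;;; Store aIN #vl #vm).

(* [vk] becomes [minn k n]; [vres] is 1 if N > 0 and 0 otherwise. *)
Definition const_cmd : cmd :=
  Assign vm (#vk ⊖ #vn) ;;;
  Assign vk (#vn ⊖ #vm ⊗ (#vm ⊘ (#vm ⊗ #vm ⊕ ##1))) ;;;
  Assign vN (#vn ⊗ #vk) ;;;
  Assign vNN (#vN ⊗ #vN) ;;;
  Assign vm (#vNN ⊗ #vNN ⊗ #vN) ;;;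
  Assign vR (##36 ⊗ (#vm ⊗ #vN)) ;;;
  Assign vT (#vR ⊗ #vR) ;;;
  Assign vQ (##5 ⊗ (#vm ⊗ #vN) ⊗ #vT) ;;;
  Assign vc (#vQ ⊗ (##5 ⊗ #vm ⊗ #vT)) ;;;
  Assign vres (#vN ⊘ #vN).

Definition graph_cmd : cmd :=
  For vi #vNN (
    Assign vx (#vi ⊘ #vN) ;;;
    Assign vy (#vi ⊖ #vx ⊗ #vN) ;;;
    Store aI #vi (eeq #vx #vy) ;;;
    Assign va (#vx ⊘ #vk) ;;;
    Assign vb (#vy ⊘ #vk) ;;;
    Assign vx (#vx ⊖ #va ⊗ #vk) ;;;
    Assign vy (#vy ⊖ #vb ⊗ #vk) ;;;
    Store aE #vi (eeq #vx #vy ⊗ Arr aIN (##2 ⊕ (#va ⊗ #vn ⊕ #vb))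
                  ⊕ eeq #va #vb ⊗ (##1 ⊖ eeq #vx #vy))).

Definition alpha_cmd : cmd := input_cmd ;;; const_cmd ;;; graph_cmd ;;; main_cmd.

(** Adjacency in the Cartesian product with [K_k], where p encodes the vertex p %/ k together with
    the colour p %% k. *)
Definition prod_adj (adj : rel nat) k (p q : nat) : bool :=
  (p %% k == q %% k) && adj (p %/ k) (q %/ k) || (p %/ k == q %/ k) && (p %% k != q %% k).

Lemma eq_div (z : int) : (1 %/ (z * z + 1))%Z = Posz (z == 0%R).
Proof.
case: (z =P 0%R) => [->|z0]; first by [].
by apply: divz_small; nia.
Qed.

Lemma cntB (a b : nat) : cnt (Posz a - Posz b)%R = a - b.
Proof.
by case E : (Posz a - Posz b)%R => [z|z] /=; lia.
Qed.

(** * Correctness of the input phase and of the construction of the product graph *)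

Section Init.
Variables (n k U L : nat) (raw : nat -> int) (adj : rel nat).
Notation beta := ((n + 2) * (n + 2))%N.
Notation k' := (minn k n).
Notation N := (n * k')%N.
Notation c := (nc N). Notation T := (nT N). Notation Q := (nQ N). Notation V := (nV N).
Hypothesis k_gt0 : 0 < k.
Hypothesis HU : V ^ (Q + 3) + 64 + 64 * beta + k <= U.
Hypothesis HL : Q + (n * n + 2) <= L.
Hypotheses (raw0 : raw 0 = k) (raw1 : raw 1 = n) (raw2 : raw 2 = 0%Z).
Hypothesis raw_adj : forall x y, x < n -> y < n -> raw (2 + (x * n + y)) = Posz (adj x y).
Hypothesis raw_le : forall j, `|raw j| <= U.
Hypothesis adj_sym : forall x y, x < n -> y < n -> adj x y = adj y x.
Hypothesis adj_irr : forall x, x < n -> adj x x = false.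
Notation ok := (ok beta raw U L).

Definition eprod : rel 'I_N := fun p q => prod_adj adj k' p q.

Lemma divk_lt (x : 'I_N) : x %/ k' < n.
Proof.
have : 0 < N by apply: leq_ltn_trans (ltn_ord x).
by rewrite muln_gt0 => /andP[_ k0]; rewrite ltn_divLR.
Qed.

Lemma eprod_sym : symmetric eprod.
Proof.
move=> x y; rewrite /eprod /prod_adj adj_sym ?divk_lt //.
by rewrite (eq_sym (x %% _)) (eq_sym (x %/ _)).
Qed.

Lemma eprod_irr : irreflexive eprod.
Proof. by move=> x; rewrite /eprod /prod_adj adj_irr ?divk_lt // !eqxx. Qed.

Variable st0 : state.
Hypotheses (st00 : ar st0 aIN 0 = k) (st01 : ar st0 aIN 1 = (n + 2)%N).
Hypothesis st02 : forall j, 2 <= j < 64 -> ar st0 aIN j = raw j.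

Lemma input_ok : ok input_cmd st0 (fun st => [/\ sc st vk = k, sc st vn = n &
  forall j, 2 <= j < n * n + 2 -> ar st aIN j = raw j]).
Proof.
apply: ok_seq; apply: (@ok_assign _ _ _ _ _ _ k) => //; first by rewrite /=; lia.
apply: ok_seq; apply: (@ok_assign _ _ _ _ _ _ n).
- by rewrite /= st01; lia.
- by rewrite /=; nia.
set st1 := setv _ _ _.
apply: ok_imp.
  (* The subtraction is truncated: for an input of at most 64 registers the loop is empty, and the
     saved cells are already complete. *)
  apply: (@ok_for _ _ _ _ _ _ _ _ (fun i st =>
    forall j, 2 <= j < i + 64 -> ar st aIN j = raw j) (n * n + 2 - 64)).
  - by rewrite /= -PoszM -PoszD cntB.
  - lia.
  - by rewrite add0n.
  move=> i st2 hi ag h.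
  apply: ok_seq; apply: (@ok_assign _ _ _ _ _ _ (i + 64)%N).
  - by rewrite /= PoszD.
  - by rewrite /=; nia.
  apply: ok_seq; split.
    by rewrite /=; nia.
  split=> [|j hj]; rewrite /= ?absz_nat ?eqxx //.
  by case: eqP => [->//|ne]; apply: h; lia.
move=> st ag h; split; rewrite ?ag.1 // => j hj; apply: h; lia.
Qed.

Definition st_const st := [/\ sc st vN = N, sc st vNN = (N * N)%N, sc st vT = T, sc st vQ = Q & sc st vc = c]
  /\ [/\ sc st vk = k', sc st vn = n & sc st vres = Posz (0 < N)].

Let beta_U : 64 * beta <= U. Proof. by move: HU; lia. Qed.
Let N_nn : N <= n * n. Proof. by rewrite leq_mul2l geq_minr orbT. Qed.
Let N_U : N <= U. Proof. by move: N_nn beta_U; nia. Qed.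
Let c_U : c <= U.
Proof.
case: (posnP N) => [->|N0]; first by rewrite /nc /nQ.
have := nV_ge N0; have := @leq_pexp2l V 1 (Q + 3) (nV_gt0 N0).
by rewrite expn1 addn3 => /(_ isT); move: HU; rewrite addn3; lia.
Qed.
Let T_c : T <= c.
Proof.
case: (posnP N) => [->|N0]; first by rewrite /nT /nR.
exact: leq_trans (nQ_geT N0) (nc_geQ N0).
Qed.
Let Q_c : Q <= c.
Proof. case: (posnP N) => [->|N0]; [by rewrite /nQ | exact: nc_geQ]. Qed.
Let N5_c : N ^ 5 <= c.
Proof.
case: (posnP N) => [->//|N0]; rewrite ncE //.
apply: (@leq_trans (5 * N ^ 5)); first by rewrite leq_pmull.
by rewrite -mulnA leq_pmulr // muln_gt0 nT_gt0 // nQ_ge1.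
Qed.
Let R_T : nR N <= T.
Proof.
case: (posnP N) => [->//|N0].
by rewrite /nT leq_pmulr // /nR muln_gt0 expn_gt0 N0.
Qed.
Let NN_c : N * N <= c.
Proof.
case: (posnP N) => [->//|N0]; exact: leq_trans (nQ_geNN N0) (nc_geQ N0).
Qed.

Lemma const_ok st : sc st vk = k -> sc st vn = n -> ok const_cmd st st_const.
Proof.
move=> hk hn.
apply: ok_seq; apply: (@ok_assign _ _ _ _ _ _ (Posz k - Posz n)%R).
- by rewrite /= hk hn.
- by have : n + 2 <= beta; [rewrite leq_pmulr // addn2 | move: HU; lia].
apply: ok_seq; apply: (@ok_assign _ _ _ _ _ _ k').
- rewrite /= hn; have := sgn_div (Posz k - Posz n)%R.
  move: ((_ - _) %/ _)%Z => q; rewrite minnE.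
  case: (ltP (Posz k - Posz n)%R 0%R) => h qE.
    have -> : q = (-1)%R by lia.
    lia.
  have -> : q = 0%R by lia.
  lia.
- by move: beta_U; have := geq_minr k n; rewrite /=; nia.
apply: ok_seq; apply: (@ok_assign _ _ _ _ _ _ N).
- by rewrite /= hn PoszM.
- exact: N_U.
apply: ok_seq; apply: (@ok_assign _ _ _ _ _ _ (N * N)%N).
- by rewrite /= PoszM.
- exact: leq_trans NN_c c_U.
apply: ok_seq; apply: (@ok_assign _ _ _ _ _ _ (N ^ 5)%N).
- rewrite /= -!PoszM; congr Posz; ring.
- exact: leq_trans N5_c c_U.
apply: ok_seq; apply: (@ok_assign _ _ _ _ _ _ (nR N)).
- rewrite /= -!PoszM; congr Posz; rewrite /nR; ring.
- exact: leq_trans R_T (leq_trans T_c c_U).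
apply: ok_seq; apply: (@ok_assign _ _ _ _ _ _ T).
- by rewrite /= -!PoszM.
- exact: leq_trans T_c c_U.
apply: ok_seq; apply: (@ok_assign _ _ _ _ _ _ Q).
- rewrite /= -!PoszM; congr Posz; rewrite /nQ -expnSr; ring.
- exact: leq_trans Q_c c_U.
apply: ok_seq; apply: (@ok_assign _ _ _ _ _ _ c).
- by rewrite /= -!PoszM.
- exact: c_U.
apply: (@ok_assign _ _ _ _ _ _ (0 < N : nat)).
- by rewrite /= divz_nat; case: (posnP N) => [->|N0] //; rewrite divnn N0.
- by case: (0 < N) => /=; lia.
by [].
Qed.

Lemma eeq_eval st e1 e2 a b : aeval st e1 = Posz a -> aeval st e2 = Posz b ->
  aeval st (eeq e1 e2) = Posz (a == b).
Proof. by move=> h1 h2; rewrite /= h1 h2 eq_div subr_eq0. Qed.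

Lemma graph_ok st : st_const st -> (forall j, 2 <= j < n * n + 2 -> ar st aIN j = raw j) ->
  0 < N -> ok graph_cmd st (env eprod).
Proof.
move=> [[e1 e2 e3 e4 e5] [ek en er]] hin N0.
have k'0 : 0 < k' by move: N0; rewrite muln_gt0 => /andP[].
have NQ := nQ_geNN N0.
apply: ok_imp.
  apply: (@ok_for _ _ _ _ _ _ _ _ (fun i st' => forall a b : 'I_N, a * N + b < i ->
     ar st' aE (a * N + b) = Posz (eprod a b) /\ ar st' aI (a * N + b) = Posz (a == b)) (N * N)).
  - by rewrite /= e2.
  - by move: HL; lia.
  - by [].
  move=> i st1 hi [ag1 ag2] IH; have [p [q iE]] := idx_ex hi.
  have [f1 f2 f3] : [/\ sc st1 vN = N, sc st1 vk = k' & sc st1 vn = n] by rewrite !ag1.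
  have hin1 j : 2 <= j < n * n + 2 -> ar st1 aIN j = raw j by move=> h; rewrite ag2 // hin.
  have pU : p <= U by apply: leq_trans (ltnW (ltn_ord p)) N_U.
  have qU : q <= U by apply: leq_trans (ltnW (ltn_ord q)) N_U.
  have one_U (x : bool) : `|Posz x| <= U by case: x; rewrite /=; move: HU; lia.
  apply: ok_seq; apply: (@ok_assign _ _ _ _ _ _ (p : nat)).
  - by rewrite /= f1 iE divz_idx.
  - exact: pU.
  apply: ok_seq; apply: (@ok_assign _ _ _ _ _ _ (q : nat)).
  - by rewrite /= f1 iE; lia.
  - exact: qU.
  set st2 := setv _ vy _.
  have E1 : aeval st2 (eeq #vx #vy) = Posz (p == q) by rewrite (@eeq_eval _ _ _ p q).
  apply: ok_seq; split; first by change (is_true (`|aeval st2 (eeq #vx #vy)| <= U)); rewrite E1.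
  change (run raw (Store aI #vi (eeq #vx #vy)) st2) with (seta st2 aI i (aeval st2 (eeq #vx #vy))); rewrite E1.
  set st3 := seta _ _ _ _.
  have xdiv (x : nat) : (Posz x %/ Posz k')%Z = x %/ k' by rewrite divz_nat.
  have xmod (x : nat) : (Posz x - Posz (x %/ k') * Posz k')%R = x %% k'.
    by rewrite {1}(divn_eq x k') PoszD PoszM; lia.
  have vN_lt (x : 'I_N) : x %/ k' < n by rewrite ltn_divLR.
  have le_div (x : nat) : x %/ k' <= x by exact: leq_div.
  have le_mod (x : nat) : x %% k' <= x by exact: leq_mod.
  apply: ok_seq; apply: (@ok_assign _ _ _ _ _ _ (p %/ k')%N).
  - by rewrite /= f2 xdiv.
  - exact: leq_trans (le_div _) pU.
  apply: ok_seq; apply: (@ok_assign _ _ _ _ _ _ (q %/ k')%N).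
  - by rewrite /= f2 xdiv.
  - exact: leq_trans (le_div _) qU.
  apply: ok_seq; apply: (@ok_assign _ _ _ _ _ _ (p %% k')%N).
  - by rewrite /= f2 xmod.
  - exact: leq_trans (le_mod _) pU.
  apply: ok_seq; apply: (@ok_assign _ _ _ _ _ _ (q %% k')%N).
  - by rewrite /= f2 xmod.
  - exact: leq_trans (le_mod _) qU.
  set st4 := setv _ vy _.
  set ee := (_ ⊕ _).
  have E2 : aeval st4 ee = Posz (eprod p q).
    have h1 : aeval st4 (eeq #vx #vy) = Posz (p %% k' == q %% k') by exact: eeq_eval.
    have h2 : aeval st4 (eeq #va #vb) = Posz (p %/ k' == q %/ k') by exact: eeq_eval.
    have h3 : ar st4 aIN (2 + (p %/ k' * n + q %/ k')) = Posz (adj (p %/ k') (q %/ k')).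
      have hxy := @idx_lt n (Ordinal (vN_lt p)) (Ordinal (vN_lt q)).
      rewrite -(raw_adj (vN_lt p) (vN_lt q)); apply: hin1.
      by rewrite leq_addr addnC ltn_add2r.
    have h4 : aeval st4 (Arr aIN (##2 ⊕ (#va ⊗ #vn ⊕ #vb))) = Posz (adj (p %/ k') (q %/ k')).
      by rewrite -h3 [LHS]/= f3 -PoszM -!PoszD absz_nat.
    rewrite /ee -[LHS]/(aeval st4 (eeq #vx #vy) * aeval st4 (Arr aIN (##2 ⊕ (#va ⊗ #vn ⊕ #vb)))
       + aeval st4 (eeq #va #vb) * (1 - aeval st4 (eeq #vx #vy)))%R h1 h2 h4 /eprod /prod_adj.
    have irr : p %/ k' = q %/ k' -> adj (p %/ k') (q %/ k') = false.
      by move=> <-; apply: adj_irr.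
    case: (p %% k' == q %% k') => /=; rewrite ?mul1r ?mul0r ?subrr ?mulr0 ?addr0 ?add0r ?subr0 ?mulr1 ?andbF ?orbF ?andbT //.
  split; first by change (is_true (`|aeval st4 ee| <= U)); rewrite E2.
  change (run raw (Store aE #vi ee) st4) with (seta st4 aE i (aeval st4 ee)); rewrite E2 => a b hab.
  rewrite /= iE; case: eqP => [/idx_inj[-> ->]//|ne].
  by apply: IH; move: ne hab; rewrite iE; lia.
move=> st' [ag1 ag2] h; split; first by rewrite !ag1.
by split=> a b; have [h1 h2] := h a b (idx_lt a b); rewrite ?h1 ?h2 mxE natz.
Qed.

Lemma alpha_ok : ok alpha_cmd st0 (fun st => sc st vres =
  if 0 < N then (1 + \sum_(t < N.-1) (runS eprod t.+1 T).2)%N else 0).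
Proof.
apply: ok_seq; apply: ok_imp input_ok _ => st1 _ [hk hn hin].
apply: ok_seq; apply: ok_imp (const_ok hk hn) _ => st2 ag2 c2.
have hin2 j : 2 <= j < n * n + 2 -> ar st2 aIN j = raw j by move=> h; rewrite ag2.2 // hin.
case: (posnP N) => N0.
  (* For N = 0 both loops are empty, the second because the count N - 1 = -1 is read as 0, and
     [vres] keeps its initial value 0. *)
  case: c2 => [[e1 e2 _ _ _] [_ _ er]].
  rewrite ?N0 in e1 e2 er *.
  apply: ok_seq; apply: ok_imp.
    apply: (@ok_for _ _ _ _ _ _ _ _ (fun _ st => sc st vN = 0%Z /\ sc st vres = 0%Z) 0) => //.
    by rewrite -[aeval _ _]/(sc st2 vNN) e2.
  move=> st3 _ [h1 h2].
  apply: (@ok_for _ _ _ _ _ _ _ _ (fun _ st => sc st vres = 0%Z) 0) => //.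
  by rewrite -[aeval _ _]/(sc st3 vN - 1)%R h1.
apply: ok_seq; apply: ok_imp (graph_ok c2 hin2 N0) _ => st3 ag3 e3.
apply: main_ok => //.
- by move: HU; lia.
- by move: HL; lia.
- exact: eprod_sym.
- by case: c2 => _ [_ _ er]; rewrite ag3.1 // er N0.
Qed.
End Init.

End Program.

(** * Graphs *)

(** A colouring of the subgraph induced by S as a function on all of G, so that colourings can be
    transported without subtypes. *)
Definition col_on (G : sgraph) k (S : {set G}) (c : G -> nat) :=
  {in S, forall x, c x < k} /\ {in S &, forall x y, edge x y -> c x <> c y}.

Lemma colorable_induced (G : sgraph) k (S : {set G}) :
  colorable k (induced S) <-> exists c, col_on k S c.
Proof.
split.
  case/existsP=> c /forallP hc.
  exists (fun x => if insub x is Some u then c u : nat else 0); split=> [x xS|x y xS yS exy].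
    by rewrite insubT; exact: ltn_ord.
  rewrite !insubT /= => E.
  have := implyP (forallP (hc (Sub x xS)) (Sub y yS)) exy.
  by move=> /eqP; apply; apply: val_inj.
case=> c [ck cE]; apply/existsP.
exists [ffun x : induced S => Ordinal (ck (val x) (valP x))].
apply/forallP=> x; apply/forallP=> y; apply/implyP=> exy; rewrite !ffunE.
by apply/eqP => -[]; apply: cE exy; exact: valP.
Qed.

Lemma alpha_ge (G : sgraph) k (S : {set G}) c : col_on k S c -> #|S| <= alpha k G.
Proof.
move=> h; apply: (@bigop.leq_bigmax_cond _ _ (fun S : {set G} => #|S|)).
by apply/colorable_induced; exists c.
Qed.

Lemma alpha_ex (G : sgraph) k : exists S : {set G}, exists c, #|S| = alpha k G /\ col_on k S c.
Proof.
have h0 : 0 < #|[pred S : {set G} | colorable k (induced S)]|.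
  apply/card_gt0P; exists set0; rewrite inE; apply/colorable_induced.
  by exists (fun=> 0); split=> x; rewrite inE.
have [S hS E] := bigop.eq_bigmax_cond (fun S : {set G} => #|S|) h0.
by have /colorable_induced[c hc] := hS; exists S, c.
Qed.

Lemma chi_le (G : sgraph) k (S : {set G}) c : col_on k S c -> chi (induced S) <= k.
Proof.
move=> h; rewrite /chi; case: ex_minnP => m _; apply.
by apply/colorable_induced; exists c.
Qed.

Lemma chi_ex (G : sgraph) (S : {set G}) : exists c, col_on (chi (induced S)) S c.
Proof. by apply/colorable_induced; rewrite /chi; case: ex_minnP. Qed.

Lemma Psi_le (H : sgraph) k (S : {set H}) m c : col_on m (~: S) c -> Psi k H <= k * m + #|S|.
Proof.
move=> h; apply: (@leq_trans (Psi_obj k S)).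
  by rewrite /Psi; case: arg_minnP => // i _; apply.
by rewrite leq_add2r leq_mul2l (chi_le h) orbT.
Qed.

Lemma Psi_ex (H : sgraph) k : exists S : {set H}, exists m c,
  Psi k H = k * m + #|S| /\ col_on m (~: S) c.
Proof.
rewrite /Psi; set S := [arg min_(S < _) _].
have [c hc] := chi_ex (~: S); by exists S, (chi (induced (~: S))), c.
Qed.

(** * Invariance under isomorphism *)

Section Iso.
Variables (G H : sgraph) (phi : G -> H) (psi : H -> G).
Hypotheses (phiK : cancel phi psi) (psiK : cancel psi phi).
Hypothesis phiE : forall x y, edge (phi x) (phi y) = edge x y.

Lemma col_on_iso k (S : {set G}) (T : {set H}) c : (forall y, (y \in T) = (psi y \in S)) ->
  col_on k S c -> col_on k T (c \o psi).
Proof.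
move=> hT [h1 h2]; split=> [y|y z]; rewrite !hT; first exact: h1.
by move=> yS zS e; apply: h2 => //; rewrite -phiE !psiK.
Qed.

Lemma mem_iso (S : {set G}) y : (y \in phi @: S) = (psi y \in S).
Proof. by rewrite -{1}(psiK y) mem_imset //; exact: can_inj phiK. Qed.

Lemma alpha_iso k : alpha k G <= alpha k H.
Proof.
have [S [c [<- hc]]] := alpha_ex G k.
rewrite -(card_imset (mem S) (can_inj phiK)).
exact: alpha_ge (col_on_iso (mem_iso S) hc).
Qed.

Lemma Psi_iso k : Psi k H <= Psi k G.
Proof.
have [S [m [c [-> hc]]]] := Psi_ex G k.
rewrite -(card_imset (mem S) (can_inj phiK)); apply: (@Psi_le _ _ _ m (c \o psi)).
by apply: col_on_iso hc => y; rewrite !inE mem_iso.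
Qed.
End Iso.

(** The defining equation for S the full vertex set, transported along the isomorphism of G with its
    induced subgraph on all vertices. *)
Lemma k_perfect_eq k (G : sgraph) : k_perfect k G -> alpha k G = Psi k (compl G).
Proof.
move=> /(_ [set: G]).
pose phi (x : induced [set: G]) : G := val x.
pose psi (x : G) : induced [set: G] := Sub x (in_setT x).
have phiK : cancel phi psi by move=> x; apply: val_inj.
have psiK : cancel psi phi by [].
have -> : alpha k (induced [set: G]) = alpha k G.
  apply/eqP; rewrite eqn_leq; apply/andP; split; first exact: (alpha_iso phiK psiK).
  exact: (alpha_iso psiK phiK).
move=> ->; apply/eqP; rewrite eqn_leq; apply/andP; split.
  exact: (@Psi_iso (compl G) (compl (induced [set: G])) psi phi psiK phiK).
exact: (@Psi_iso (compl (induced [set: G])) (compl G) phi psi phiK psiK).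
Qed.

(** * Stable set and clique cover in the Cartesian product *)

Section Product.
Variables (G : sgraph) (k : nat).
Notation n := #|G|.
Notation k' := (minn k n).
Notation N := (n * k')%N.
Hypothesis k_gt0 : 0 < k.

Definition enc (v : G) : nat := index v (enum G).
Definition adjn : rel nat := fun x y =>
  match onth (enum G) x, onth (enum G) y with Some u, Some v => edge u v | _, _ => false end.

Lemma onth_ex x : x < n -> exists2 v : G, onth (enum G) x = Some v & enc v = x.
Proof.
rewrite cardE => hx; case E : (onth (enum G) x) => [v|].
  exists v => //; have vx := @onth_nth _ v _ _ _ E.
  by rewrite /enc -vx index_uniq ?enum_uniq.
by have := onthTE (enum G) x; rewrite E hx.
Qed.

Lemma enc_lt v : enc v < n.
Proof. by rewrite cardE index_mem mem_enum. Qed.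

Lemma enc_inj : injective enc.
Proof.
move=> u v E; have := nth_index u (mem_enum G u); rewrite -/(enc u) E.
by rewrite nth_index ?mem_enum.
Qed.

Lemma onth_enc v : onth (enum G) (enc v) = Some v.
Proof. by have [u -> /enc_inj ->] := onth_ex (enc_lt v). Qed.

Lemma adjn_enc u v : adjn (enc u) (enc v) = edge u v.
Proof. by rewrite /adjn !onth_enc. Qed.

Lemma adjn_sym x y : adjn x y = adjn y x.
Proof.
by rewrite /adjn; case: (onth _ x) => [u|]; case: (onth _ y) => [v|] //; rewrite edge_sym.
Qed.

Lemma adjn_irr x : adjn x x = false.
Proof. by rewrite /adjn; case: (onth _ x) => [u|] //; rewrite edge_irrefl. Qed.

Definition stable_cover a := exists2 A : {set 'I_N}, #|A| = a &
  {in A &, forall p q, ~~ eprod adjn p q} /\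
  exists f : 'I_N -> 'I_#|A|, forall p q, f p = f q -> p != q -> eprod adjn p q.

(** The stable set consists of the pairs (u, c u) with u in S; g labels each pair (u, i) by its
    clique, and distinct pairs with the same label have to be adjacent in the product. *)
Lemma stable_cover_intro (S : {set G}) c (g : G -> nat -> nat) :
  col_on k' S c ->
  (forall u i, i < k' -> g u i < #|S|) ->
  (forall u v i j, i < k' -> j < k' -> g u i = g v j -> (u, i) <> (v, j) ->
     (i = j /\ edge u v) \/ (u = v /\ i <> j)) ->
  stable_cover #|S|.
Proof.
move=> [ck cE] gS gE.
have dec (p : 'I_N) : exists u i, [/\ i < k', p %/ k' = enc u & p %% k' = i].
  have [v _ E] := onth_ex (divk_lt p); exists v, (p %% k'); split=> //.
  rewrite ltn_mod; have : 0 < N by apply: leq_ltn_trans (ltn_ord p).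
  by rewrite muln_gt0 => /andP[].
have lt (u : G) i : i < k' -> enc u * k' + i < N.
  by move=> hi; have := enc_lt u; nia.
have dv (u : G) i : i < k' -> (enc u * k' + i) %/ k' = enc u.
  by move=> hi; rewrite divnMDl ?divn_small ?addn0 //; apply: leq_ltn_trans hi.
have md (u : G) i : i < k' -> (enc u * k' + i) %% k' = i.
  by move=> hi; rewrite modnMDl modn_small.
pose A := [set p : 'I_N | [exists u in S, p == enc u * k' + c u :> nat]].
have AE (p : 'I_N) : reflect (exists2 u, u \in S & p = enc u * k' + c u :> nat) (p \in A).
  rewrite inE; apply: (iffP existsP) => [[u /andP[uS /eqP E]]|[u uS E]]; exists u => //.
  by rewrite uS E /=.
have cA : #|A| = #|S|.
  case: (set_0Vmem S) => [S0|[u0 u0S]].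
    have -> : A = set0; last by rewrite S0 !cards0.
    by apply/setP => p; rewrite [RHS]inE; apply/negP => /AE[u]; rewrite S0 inE.
  pose o0 := Ordinal (lt u0 (c u0) (ck _ u0S)).
  pose h u : 'I_N := insubd o0 (enc u * k' + c u).
  have hE u : u \in S -> h u = enc u * k' + c u :> nat.
    by move=> uS; rewrite val_insubd lt // ck.
  have -> : A = h @: S.
    apply/setP => p; apply/AE/imsetP => -[u uS E]; exists u => //.
      by apply: val_inj; rewrite /= hE.
    by rewrite E hE.
  apply: card_in_imset => u v uS vS /(congr1 val) /=; rewrite !hE // => E.
  by apply: enc_inj; rewrite -(dv u (c u)) ?ck // E dv ?ck.
exists A => //; split.
  move=> p q /AE[u uS pE] /AE[v vS qE].
  rewrite /eprod /prod_adj pE qE !dv ?md ?ck // adjn_enc negb_or; apply/andP; split.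
    by apply/negP => /andP[/eqP E /cE]; apply.
  by apply/negP => /andP[/eqP/enc_inj ->]; rewrite eqxx.
have gN (p : 'I_N) : exists o : 'I_#|A|, exists u i, [/\ i < k', p %/ k' = enc u, p %% k' = i & o = g u i :> nat].
  have [u [i [hi E1 E2]]] := dec p.
  have hg : g u i < #|A| by rewrite cA gS.
  by exists (Ordinal hg), u, i.
have [f fP] := fin_all_exists gN; exists f => p q E pq.
have [u [i [hi p1 p2 p3]]] := fP p; have [v [j [hj q1 q2 q3]]] := fP q.
have ne : (u, i) <> (v, j).
  case=> E1 E2; case/eqP: pq; apply: val_inj => /=.
  by rewrite (divn_eq p k') (divn_eq q k') p1 q1 p2 q2 E1 E2.
rewrite /eprod /prod_adj p1 q1 p2 q2 adjn_enc (inj_eq enc_inj).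
have Eg : g u i = g v j by rewrite -p3 -q3 E.
case: (gE _ _ _ _ hi hj Eg ne) => [[-> ->]|[-> /eqP ij]]; first by rewrite eqxx.
by rewrite eqxx ij orbT.
Qed.

(** For n <= k all vertices can get different colours, so alpha is n, and the n cliques {v} x K_n
    cover the product with K_n. For k < n the cover comes from an optimal set W for [Psi]. *)
Lemma stable_cover_alpha : alpha k G = Psi k (compl G) -> stable_cover (alpha k G).
Proof.
case: (leqP n k) => nk.
  move=> _; have kn : k' = n by apply/minn_idPr.
  have colT : col_on n [set: G] enc.
    by split=> [x _|x y _ _ e /enc_inj E]; [exact: enc_lt | rewrite E edge_irrefl in e].
  have -> : alpha k G = #|[set: G]|.
    apply/eqP; rewrite eqn_leq; apply/andP; split.
      by have [S [c [<- _]]] := alpha_ex G k; rewrite cardsT max_card.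
    apply: (@alpha_ge _ _ _ enc); case: colT => h1 h2; split=> // x xT.
    by apply: leq_trans (h1 x xT) nk.
  apply: (@stable_cover_intro _ enc (fun u _ => enc u)).
  - by rewrite kn.
  - by move=> u i _; rewrite cardsT enc_lt.
  - move=> u v i j hi hj /enc_inj -> ne; right; split=> // E; apply: ne; rewrite E //.
have kk : k' = k by apply/minn_idPl/ltnW.
have [S [c [SE hc]]] := alpha_ex G k.
have [W [m [h [PE [hm hE]]]]] := Psi_ex (compl G) k.
rewrite -SE => E.
(* A colour class of the complement is a clique of G. The m classes and k colours give the labels
   below k m; each u in W has a label of its own, shared by all colours, after these. *)
pose g u i := if u \in W then k * m + index u (enum W) else h u * k + i.
have aE : #|S| = k * m + #|W| by rewrite E PE.
apply: (@stable_cover_intro _ c g); rewrite ?kk //.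
- move=> u i hi; rewrite /g aE; case: ifPn => uW.
    by rewrite ltn_add2l cardE index_mem mem_enum.
  have hu : h u < m by apply: hm; rewrite inE.
  by apply: leq_trans (leq_addr _ _); nia.
- move=> u v i j hi hj; rewrite /g; case: ifPn => uW; case: ifPn => vW.
  + move=> /addnI Ei ne; right.
    have uv : u = v by rewrite -(nth_index u (_ : u \in enum W)) ?mem_enum // Ei nth_index ?mem_enum.
    by split=> // ij; apply: ne; rewrite uv ij.
  + have hv : h v < m by apply: hm; rewrite inE.
    by nia.
  + have hu : h u < m by apply: hm; rewrite inE.
    by nia.
  + move=> Eg ne; left.
    have hh : h u = h v.
      by have := congr1 (divn^~ k) Eg; rewrite !divnMDl // !divn_small // !addn0.
    have ij : i = j by move: Eg; rewrite hh => /addnI.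
    split=> //; case: (boolP (edge u v)) => // ne'.
    have uv : u != v by apply/eqP => uv; apply: ne; rewrite uv ij.
    have ec : @edge (compl G) u v by apply/andP; split.
    by case: (hE u v _ _ ec hh); rewrite inE.
Qed.
End Product.

(** * The complete machine program *)

(** 128 bounds the weights of all expressions, and hence the powers of U that occur; 35 is the first
    temporary. *)
Lemma alpha_cmd_cok : cok 128 alpha_cmd 35.
Proof. by vm_compute. Qed.

(* Register 2 runs through the addresses of the cells (0, j), whose distances are
   64 (2 j - 1). *)
Definition save_reg j : program :=
  [:: Const 0 (Posz ((2 * j - 1) * 64)); Binop Add 2 2 0; WriteInd 2 j].
Definition save_regs i cnt : program := flatten [seq save_reg j | j <- iota i cnt].

(* On entry every register may carry input; register 2 can be overwritten because it
   holds a diagonal entry of the adjacency matrix, which is 0. *)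
Definition prelude_head : program :=
  [:: Const 2 (Posz 2); Binop Add 1 1 2; Const 2 (Posz 64); Binop Mul 2 2 1; Binop Mul 2 2 1;
      WriteInd 2 0; Const 0 (Posz 64); Binop Add 2 2 0; WriteInd 2 1;
      Const 0 (Posz 192); Binop Add 2 2 0].
Definition prelude : program := prelude_head ++ save_regs 3 61 ++ [:: Binop Mul 2 1 1].
(* Register 19 is the scalar vres. *)
Definition coda : program := [:: Const 1 (Posz 0); Binop Add 0 19 1; Const 1 (Posz 1)].
Definition alpha_program : program := prelude ++ ccmd alpha_cmd 35 (size prelude) ++ coda.

(** * Moving the input out of the registers of the compiled code *)

Section Pre.
Variables (b n k : nat) (m : memory).
Notation beta := ((n + 2) * (n + 2))%N.
Hypotheses (b14 : 14 <= b) (bb : (64 * 64 + beta) * 64 < 2 ^ b).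
Let b7 : 7 <= b. Proof. exact: leq_trans b14. Qed.
Hypotheses (fm : fits b m) (m0 : m 0 = Posz k) (m1 : m 1 = Posz n) (m2 : m 2 = 0%Z).
Hypothesis m_out : forall r, n * n + 2 <= r -> m r = 0%Z.
Notation red := (red b).

Let c14 z : z < 2 ^ 14 -> `|Posz z| < 2 ^ b.
Proof. by move=> h; apply: leq_trans h _; rewrite leq_pexp2l. Qed.

(** No register is lost before it is saved: the targets are cells at addresses from 64 on, the
    sources are registers below 64. *)
Lemma save_ok P cnt : forall i pc (m : memory), code_at P pc (save_regs i cnt) -> 3 <= i -> i + cnt <= 64 ->
  fits b m -> m 2 = Posz (cell beta 0 i.-1) ->
  exists m', [/\ red P pc m (size (save_regs i cnt)) (pc + size (save_regs i cnt)) m', fits b m',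
    forall j, i <= j < i + cnt -> m' (cell beta 0 j) = m j
  & forall r, r != 0 -> r != 2 -> (forall j, i <= j < i + cnt -> r <> cell beta 0 j) -> m' r = m r].
Proof.
elim: cnt => [|cnt IH] i pc m' cd i3 i64 fm' m2'.
  exists m'; split=> // [|j]; last by lia.
  by rewrite addn0; apply: red_refl.
move: cd; rewrite -[save_regs i cnt.+1]/(save_reg i ++ save_regs i.+1 cnt).
case/code_at_cat=> /code_at_cons[i0 /code_at_cons[i1 /code_at_cons[i2 _]]] cd.
have vb : `|Posz ((2 * i - 1) * 64)| < 2 ^ b.
  by apply: c14; apply: leq_trans (_ : 127 * 64 < _) => //; rewrite ltnS leq_mul2r; lia.
have := red_const b7 (m := m') i0 isT vb; set ma := update _ _ _ => r0.
have fa : fits b ma by apply: fits_update.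
have := red_binop b7 i1 fa isT isT isT; set mb := update _ _ _ => r1.
have mb2 : mb 2 = Posz (cell beta 0 i).
  rewrite /mb upd_eq /= /ma upd_ne // upd_eq m2' -PoszD /cell; congr Posz.
  by case: i i3 {cd i0 i1 i2 r0 ma fa r1 mb i64 vb m2'} => // i _ /=; nia.
have ci j : j < 64 -> cell beta 0 j < 2 ^ b.
  move=> hj; apply: leq_ltn_trans bb; rewrite /cell addn0 leq_mul2r leq_add2r.
  by rewrite leq_mul //; lia.
have fb : fits b mb.
  apply: fits_update => //; move: mb2; rewrite /mb upd_eq => ->; apply: ci; lia.
have i128 : i < 128 by lia.
have := red_write b7 i2 fb isT i128; rewrite mb2 absz_nat; set mc := update _ _ _ => r2.
have mbi : mb i = m' i by rewrite /mb /ma !upd_ne //; lia.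
have fc : fits b mc by apply: fits_update.
have cge j : 64 <= cell beta 0 j by rewrite /cell; nia.
have mc2 : mc 2 = Posz (cell beta 0 i.+1.-1) by rewrite /mc upd_ne //; have := cge i; lia.
have [||m4 [r4 f4 h4 h4']] := IH i.+1 _ mc cd _ _ fc mc2; try lia.
exists m4; split=> //.
- rewrite size_cat addnA; apply: red_trans r4.
  have -> : pc + size (save_reg i) = pc.+3 by rewrite addn3.
  exact: red_trans r0 (red_trans r1 r2).
- move=> j hj; case: (j =P i) => [->|ne].
    rewrite h4'; first by rewrite /mc upd_eq mbi.
    + by have := cge i; lia.
    + by have := cge i; lia.
    + by move=> j' hj' /cell_inj[] // _; lia.
  rewrite h4; last by lia.
  rewrite /mc upd_ne; last by have := cge i; lia.
  by rewrite /mb /ma !upd_ne //; lia.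
- move=> r r0' r2' hr; rewrite h4' //; last by move=> j hj; apply: hr; lia.
  rewrite /mc upd_ne; last by apply/eqP; apply: hr; lia.
  by rewrite /mb /ma !upd_ne //; exact: negbTE.
Qed.

(** The scalars start with leftover input. Cells outside the saved part of array 0 lie beyond the
    input and therefore read 0. *)
Definition st_in : state := State (fun x => m (x + 3))
  (fun a i => if a == 0 then (if i == 0 then Posz k else if i == 1 then Posz (n + 2)
     else if i < 64 then m i else 0%Z) else 0%Z).

Lemma prelude_ok P : code_at P 0 prelude ->
  exists m', [/\ red P 0 m (size prelude) (size prelude) m', rep beta m st_in m' & fits b m'].
Proof.
case/code_at_cat=> /code_at_cons[i0 /code_at_cons[i1 /code_at_cons[i2 /code_at_cons[i3
  /code_at_cons[i4 /code_at_cons[i5 /code_at_cons[i6 /code_at_cons[i7 /code_at_cons[i8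
  /code_at_cons[i9 /code_at_cons[i10 _]]]]]]]]]]].
rewrite add0n; case/code_at_cat=> cs /code_at_cons[il _].
have cge j : 64 <= cell beta 0 j by rewrite /cell; nia.
have ci j : j < 64 -> cell beta 0 j < 2 ^ b.
  move=> hj; apply: leq_ltn_trans bb; rewrite /cell addn0 leq_mul2r leq_add2r.
  by rewrite leq_mul //; lia.
have n2b : n + 2 < 2 ^ b by apply: leq_ltn_trans bb; nia.
have r0 := red_const b7 (m := m) i0 isT (@c14 2 isT); set x0 := update _ _ _ in r0.
have f0 : fits b x0 by apply: fits_update => //; apply: c14.
have r1 := red_binop b7 i1 f0 isT isT isT.
have E1 : eval_binop Add (x0 1) (x0 2) = Posz (n + 2) by rewrite /= /x0 upd_ne // upd_eq m1 PoszD.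
rewrite E1 in r1; set x1 := update _ _ _ in r1.
have f1 : fits b x1 by apply: fits_update.
have r2 := red_const b7 (m := x1) i2 isT (@c14 64 isT); set x2 := update _ _ _ in r2.
have f2 : fits b x2 by apply: fits_update => //; apply: c14.
have r3 := red_binop b7 i3 f2 isT isT isT.
have E3 : eval_binop Mul (x2 2) (x2 1) = Posz (64 * (n + 2)).
  by rewrite /= /x2 upd_eq upd_ne // /x1 upd_eq -PoszM.
rewrite E3 in r3; set x3 := update _ _ _ in r3.
have f3 : fits b x3.
  by apply: fits_update => //=; apply: leq_ltn_trans bb; nia.
have r4 := red_binop b7 i4 f3 isT isT isT.
have E4 : eval_binop Mul (x3 2) (x3 1) = Posz (cell beta 0 0).
  by rewrite /= /x3 upd_eq upd_ne // /x2 upd_ne // /x1 upd_eq -PoszM /cell; congr Posz; ring.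
rewrite E4 in r4; set x4 := update _ _ _ in r4.
have f4 : fits b x4 by apply: fits_update => //; apply: ci.
have r5 := red_write b7 i5 f4 isT isT.
have E5 : x4 0 = Posz k by rewrite /x4 /x3 /x2 /x1 /x0 !upd_ne.
rewrite E5 in r5; rewrite [x4 2]upd_eq absz_nat in r5; set x5 := update _ _ _ in r5.
have f5 : fits b x5 by apply: fits_update => //; rewrite -m0.
have x52 : x5 2 = Posz (cell beta 0 0) by rewrite /x5 upd_ne //; have := cge 0; lia.
have x51 : x5 1 = Posz (n + 2) by rewrite /x5 upd_ne //; have := cge 0; lia.
have r6 := red_const b7 (m := x5) i6 isT (@c14 64 isT); set x6 := update _ _ _ in r6.
have f6 : fits b x6 by apply: fits_update => //; apply: c14.
have r7 := red_binop b7 i7 f6 isT isT isT.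
have E7 : eval_binop Add (x6 2) (x6 0) = Posz (cell beta 0 1).
  by rewrite /= /x6 upd_ne // upd_eq x52 -PoszD /cell; congr Posz; ring.
rewrite E7 in r7; set x7 := update _ _ _ in r7.
have f7 : fits b x7 by apply: fits_update => //; apply: ci.
have r8 := red_write b7 i8 f7 isT isT.
have x71 : x7 1 = Posz (n + 2) by rewrite /x7 /x6 !upd_ne.
rewrite x71 [x7 2]upd_eq absz_nat in r8; set x8 := update _ _ _ in r8.
have f8 : fits b x8 by apply: fits_update.
have r9 := red_const b7 (m := x8) i9 isT (@c14 192 isT); set x9 := update _ _ _ in r9.
have f9 : fits b x9 by apply: fits_update => //; apply: c14.
have r10 := red_binop b7 i10 f9 isT isT isT.
have x82 : x8 2 = Posz (cell beta 0 1).
  by rewrite /x8 upd_ne ?upd_eq //; have := cge 1; lia.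
have E10 : eval_binop Add (x9 2) (x9 0) = Posz (cell beta 0 2).
  by rewrite /= /x9 upd_ne // upd_eq x82 -PoszD /cell; congr Posz; ring.
rewrite E10 in r10; set x10 := update _ _ _ in r10.
have f10 : fits b x10 by apply: fits_update => //; apply: ci.
have x102 : x10 2 = Posz (cell beta 0 3.-1) by rewrite /x10 upd_eq.
have [x11 [r11 f11 h11 h11']] := save_ok cs isT isT f10 x102.
have r12 := red_binop b7 il f11 isT isT isT.
have x10r r : r != 0 -> r != 1 -> r != 2 -> r != cell beta 0 0 -> r != cell beta 0 1 ->
    x10 r = m r.
  by move=> *; rewrite /x10 /x9 /x8 /x7 /x6 /x5 /x4 /x3 /x2 /x1 /x0 !upd_ne //; exact: negbTE.
have x111 : x11 1 = Posz (n + 2).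
  rewrite h11' //; last by move=> j _; have := cge j; lia.
have E12 : eval_binop Mul (x11 1) (x11 1) = Posz beta by rewrite /= x111 PoszM.
rewrite E12 in r12; set x12 := update _ _ _ in r12.
exists x12; split.
- have := red_trans r0 (red_trans r1 (red_trans r2 (red_trans r3 (red_trans r4 (red_trans r5
   (red_trans r6 (red_trans r7 (red_trans r8 (red_trans r9 (red_trans r10 (red_trans r11 r12))))))))))).
  have -> : (size prelude_head + size (save_regs 3 61)).+1 = size prelude by rewrite /prelude !size_cat addnS addn1 addnS.
  apply: red_le; rewrite /prelude !size_cat /=; lia.
- have cne a i : cell beta a i != 0 /\ cell beta a i != 2 /\ cell beta a i != 1.
    by rewrite /cell; split; [|split]; nia.
  split.
  + by rewrite /x12 upd_eq.
  + move=> x hx; rewrite /x12 upd_ne; last by lia.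
    rewrite h11'; [|by lia|by lia|by move=> j _; have := cge j; lia].
    rewrite x10r //; try lia; have := cge 0; have := cge 1; lia.
  + move=> a i ha; have [c0 [c2 c1]] := cne a i; rewrite /x12 upd_ne; last exact: negbTE.
    rewrite /=; case: (a =P 0) => [a0|a0]; last first.
      rewrite h11' //; last by move=> j _ /cell_inj[].
      rewrite x10r //; try by apply/eqP => /cell_inj[].
      apply: m_out; rewrite /cell; nia.
    subst a; case: (i =P 0) => [i0'|i0'].
      subst i; rewrite h11' //; last by move=> j hj /cell_inj[] // _; lia.
      rewrite /x10 /x9 !upd_ne; try exact: negbTE.
      rewrite /x8 upd_ne; last by apply/eqP => /cell_inj[].
      rewrite /x7 /x6 !upd_ne; try exact: negbTE.
      by rewrite /x5 upd_eq.
    case: (i =P 1) => [i1'|i1'].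
      subst i; rewrite h11' //; last by move=> j hj /cell_inj[] // _; lia.
      rewrite /x10 /x9 !upd_ne; try exact: negbTE.
      by rewrite /x8 upd_eq.
    have out : x10 (cell beta 0 i) = m (cell beta 0 i).
      by apply: x10r => //; apply/eqP => /cell_inj[].
    have mout : m (cell beta 0 i) = 0%Z by apply: m_out; rewrite /cell; nia.
    case: ltnP => hi; last first.
      by rewrite h11' ?out //; move=> j hj /cell_inj[] // _; lia.
    case: (i =P 2) => [i2'|i2'].
      subst i; rewrite h11' ?out ?mout ?m2 //; move=> j hj /cell_inj[] // _; lia.
    rewrite h11; last by lia.
    rewrite x10r //; try lia; have := cge 0; have := cge 1; lia.
  + move=> j hj; rewrite /x12 upd_ne; last by lia.
    have nc i : j != cell beta 0 i by rewrite /cell; move: hj; nia.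
    rewrite h11'; [|by lia|by lia|by move=> i _; apply/eqP].
    by rewrite x10r //; lia.
- by apply: fits_update => //=; apply: leq_ltn_trans bb; nia.
Qed.
End Pre.

Lemma nth_allpairs (S T : Type) (x0 : S) (y0 : T) (f : S -> T -> int) s t i j :
  i < size s -> j < size t ->
  nth 0%R [seq f x y | x <- s, y <- t] (i * size t + j) = f (nth x0 s i) (nth y0 t j).
Proof.
elim: s i => [//|x s IH] [|i] hi hj; rewrite /= nth_cat size_map.
  by rewrite hj (nth_map y0).
by rewrite ltnNge mulSn -addnA leq_addr /= addKn IH.
Qed.

Section Input.
Variables (k : nat) (G : sgraph).
Notation n := #|G|.
Notation m := (load_input (encode k G)).

Lemma input_adj x y : x < n -> y < n -> m (2 + (x * n + y)) = Posz (adjn G x y).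
Proof.
move=> hx hy; have [u xu _] := onth_ex hx; have [v yv _] := onth_ex hy.
rewrite /adjn xu yv /load_input add2n /= {1}cardE.
rewrite (nth_allpairs u v) -?cardE //.
by rewrite (@onth_nth _ u _ _ _ xu) (@onth_nth _ v _ _ _ yv).
Qed.

Lemma input_out r : n * n + 2 <= r -> m r = 0%Z.
Proof.
by move=> hr; rewrite /load_input nth_default //= size_allpairs -cardE -addn2.
Qed.

(** Register 2 is the first diagonal entry of the adjacency matrix or, without vertices, lies beyond
    the input. *)
Lemma input_2 : m 2 = 0%Z.
Proof.
case: (posnP n) => n0; first by apply: input_out; rewrite n0.
by have := input_adj n0 n0; rewrite adjn_irr mul0n.
Qed.

Lemma input_le r : `|m r| <= maxn k (n + 1).
Proof.
case: r => [|[|r]]; first by rewrite /= leq_maxl.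
  by rewrite /= leq_max addn1 leqnSn orbT.
case: (ltnP r (n * n)) => hr; last by rewrite input_out //; lia.
have n0 : 0 < n by case: (n) hr.
have hx : r %/ n < n by rewrite ltn_divLR.
have := input_adj hx (ltn_pmod r n0); rewrite -divn_eq add2n => ->.
by rewrite leq_max addn1; case: adjn; rewrite /= ?orbT.
Qed.

Lemma input_size_ge : n * n + 2 <= input_size (encode k G).
Proof.
have h (s : seq int) : size s <= input_size s.
  by rewrite /input_size -sum1_size; apply: leq_sum.
by apply: leq_trans (h _); rewrite /= size_allpairs -cardE addn2.
Qed.

Lemma k_lt : k < 2 ^ input_size (encode k G).
Proof.
apply: leq_trans (_ : 2 ^ bitlen (Posz k) <= _); first exact: trunc_log_ltn.
by rewrite leq_pexp2l // /input_size /encode big_cons leq_addr.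
Qed.
End Input.

(** * Explicit bounds in terms of the input size *)

Definition bnd_L s := nQ s + s.
(** 2 ^ [bnd_u s] serves as U. The crude estimate V <= 2^V replaces a logarithm, so that the
    exponent remains a polynomial; the remaining summands make room for the loop counts, k, the
    addresses and constants. *)
Definition bnd_u s := nV s * (nQ s + 3) + nQ s + 3 * s + 30.
Definition bnd_b s := 128 * bnd_u s + 1.
Definition bnd_time s := (size prelude + ctime (bnd_L s) alpha_cmd + 3) * (5 * bnd_b s).

Lemma nQ_mono a b : a <= b -> nQ a <= nQ b.
Proof. by move=> h; rewrite /nQ /nT /nR !leq_mul // leq_exp2r. Qed.
Lemma nc_mono a b : a <= b -> nc a <= nc b.
Proof. by move=> h; rewrite /nc leq_mul ?nQ_mono // /nc' /nT /nR !leq_mul // leq_exp2r. Qed.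
Lemma nV_mono a b : a <= b -> nV a <= nV b.
Proof. by move=> h; rewrite /nV !leq_mul // nc_mono. Qed.

Lemma le_exp2 x y : x <= y -> x <= 2 ^ y.
Proof. by move=> h; apply: leq_trans h (ltnW (ltn_expl _ _)). Qed.

Lemma coda_ok b P p1 (m : memory) v : 7 <= b -> code_at P p1 coda -> fits b m -> m 19 = v ->
  exists m', [/\ red b P p1 m 3 p1.+3 m', m' 0 = v & m' 1 = 1%Z].
Proof.
move=> b7 /code_at_cons[j0 /code_at_cons[j1 /code_at_cons[j2 _]]] fm mv.
have fits_small (z : int) : `|z| < 128 -> `|z| < 2 ^ b by exact: small_fits.
have r1 := red_const b7 (m := m) j0 isT (fits_small 0%Z isT).
set x1 := update m 1 0%Z in r1.
have f1 : fits b x1 := fits_update 1 fm (fits_small 0%Z isT).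
have r2 := red_binop b7 j1 f1 isT isT isT.
have E2 : eval_binop Add (x1 19) (x1 1) = v by rewrite /= /x1 upd_eq upd_ne // addr0.
rewrite E2 in r2; set x2 := update x1 0 _ in r2.
have r3 := red_const b7 (m := x2) j2 isT (fits_small 1%Z isT).
exists (update x2 1 1%Z); split; last by rewrite upd_eq.
  exact: red_trans r1 (red_trans r2 r3).
by rewrite upd_ne // /x2 upd_eq.
Qed.

Lemma size_cat3 (T : Type) (l1 l2 l3 : seq T) :
  size (l1 ++ l2 ++ l3) = size l1 + size l2 + size l3.
Proof. by rewrite !size_cat addnA. Qed.

Section Run.
Variables (k : nat) (G : sgraph) (U L b : nat).
Notation n := #|G|.
Notation m := (load_input (encode k G)).
Notation N := (n * minn k n)%N.
Notation beta := ((n + 2) * (n + 2))%N.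
Hypotheses (k_gt0 : 0 < k) (kP : k_perfect k G).
Hypothesis U_big : nV N ^ (nQ N + 3) + 64 + 64 * beta + k <= U.
Hypotheses (L_ge : nQ N + (n * n + 2) <= L) (L_U : L <= U).
Hypotheses (b14 : 14 <= b) (U_b : U ^ 128 < 2 ^ b) (bb : (64 * 64 + beta) * 64 < 2 ^ b).

Let U64 : 64 <= U. Proof. by move: U_big; lia. Qed.

Let U_lt : U < 2 ^ b.
Proof. by apply: leq_ltn_trans U_b; rewrite -{1}(expn1 U) leq_pexp2l //; lia. Qed.

Let beta_ge : n + 2 <= beta. Proof. by rewrite leq_pmulr // addn2. Qed.

Let raw_U r : `|m r| <= U.
Proof.
apply: leq_trans (input_le k G r) _; rewrite geq_max; apply/andP.
by split; move: U_big beta_ge; lia.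
Qed.

Lemma alpha_program_run : exists t m', [/\ exec alpha_program 0 m t m', t <= (size prelude + ctime L alpha_cmd + 3) * (5 * b),
  m' 0 = Posz (alpha k G) & m' 1 = 1%Z].
Proof.
have b7 : 7 <= b by lia.
have fm : fits (b) m by move=> r; apply: leq_ltn_trans (raw_U r) U_lt.
have cp : code_at alpha_program 0 prelude.
  exists [::], (ccmd alpha_cmd 35 (size prelude) ++ coda).
  exact: (conj (erefl alpha_program) (erefl 0)).
have [ma [ra rma fa]] := prelude_ok b14 bb fm erefl erefl (input_2 k G) (@input_out k G) cp.
have cc : code_at alpha_program (size prelude) (ccmd alpha_cmd 35 (size prelude)).
  exists prelude, coda; exact: (conj (erefl alpha_program) (erefl (size prelude))).
have beta0 : 0 < beta by rewrite muln_gt0 addn2.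
have bU : beta <= U by move: U_big; lia.
have bst : bounded U (st_in n k m).
  have z_U : `|0%Z| <= U := leq0n U.
  have k_U : `|Posz k| <= U := raw_U 0.
  have n_U : `|Posz (n + 2)| <= U := leq_trans beta_ge bU.
  split=> [x|a i]; first exact: raw_U.
  by rewrite [ar _ _ _]/=; do 4? case: ifP => _.
have HU := U_big.
have HL := L_ge.
have st02 j : 2 <= j < 64 -> ar (st_in n k m) 0 j = m j.
  by move=> /andP[j2 j64] /=; rewrite j64; case: j j2 {j64} => [|[|j]].
have [sf vres] := @alpha_ok n k U (L) m (adjn G) k_gt0 HU HL erefl erefl (input_2 k G)
  (@input_adj k G) raw_U (fun x y _ _ => adjn_sym G x y) (fun x _ => adjn_irr G x)
  (st_in n k m) erefl erefl st02.
have [mb [rb rmb _ fb _]] := ccmd_ok b7 beta0 U64 bU raw_U L_U (isT : 0 < 128) U_b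
  cc rma fa bst sf isT alpha_cmd_cok.
set p1 := _ + size _ in rb.
have : code_at alpha_program p1 coda.
  exists (prelude ++ ccmd alpha_cmd 35 (size prelude)), [::].
  rewrite cats0 -catA; exact: (conj (erefl alpha_program) (size_cat _ _)).
move=> cpost; have v19 : mb 19 = sc (run m alpha_cmd (st_in n k m)) 16.
  by case: rmb => _ h _ _; exact: (h 16 isT).
have [x3 [r3 x30 x31]] := coda_ok b7 cpost fb v19.
have r := red_trans ra (red_trans rb r3).
have sE : size alpha_program = p1 + size coda := size_cat3 _ _ _.
have hp : size alpha_program <= p1.+3 := eq_leq (etrans sE (addn3 p1)).
have [t ex tle] := r 0 x3 (ExecHalt x3 hp).
rewrite addn0 addnA in tle.
exists t, x3; split; [exact: ex | exact: tle | | exact: x31].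
rewrite x30 vres.
  have [A <- [hA [f hf]]] := stable_cover_alpha k_gt0 (k_perfect_eq kP).
  have es : symmetric (@eprod n k (adjn G)) by apply: eprod_sym => x y _ _; exact: adjn_sym.
  have ei : irreflexive (@eprod n k (adjn G)) by apply: eprod_irr => x _; exact: adjn_irr.
  case: ifP => N0; first by rewrite (count_runS N0 es ei hA hf).
  congr Posz; apply/esym/eqP; rewrite -leqn0 -[X in _ <= X](_ : N = 0).
    by rewrite -[X in _ <= X]card_ord max_card.
  by move: N0; case: (N).
Qed.
End Run.

Lemma bnd_U_ge s n k : n * n + 2 <= s -> k < 2 ^ s ->
  nV (n * minn k n) ^ (nQ (n * minn k n) + 3) + 64 + 64 * ((n + 2) * (n + 2)) + k + 2 ^ 20
    <= 2 ^ bnd_u s.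
Proof.
set N := (n * minn k n)%N => s_ge k_lt.
have n_s : n <= s by nia.
have N_s : N <= s.
  by apply: leq_trans (_ : n * n <= _); [rewrite leq_mul2l geq_minr orbT | lia].
pose w := nV s * (nQ s + 3) + 2 * s + 20.
have h1 : nV N ^ (nQ N + 3) <= 2 ^ w.
  apply: (@leq_trans ((2 ^ nV s) ^ (nQ s + 3))).
    apply: (@leq_trans ((2 ^ nV s) ^ (nQ N + 3))).
      by rewrite leq_exp2r ?addn3 // le_exp2 // nV_mono.
    by rewrite leq_pexp2l ?expn_gt0 // leq_add2r nQ_mono.
  by rewrite -expnM leq_pexp2l // /w -addnA leq_addr.
have h2 : 64 * ((n + 2) * (n + 2)) <= 2 ^ w.
  apply: (@leq_trans (2 ^ (6 + ((s + 2) + (s + 2))))).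
    rewrite (expnD 2 6) leq_mul2l /= expnD leq_mul // le_exp2 // leq_add2r //.
  by rewrite leq_pexp2l // /w; lia.
have h3 : k <= 2 ^ w.
  by apply: leq_trans (ltnW k_lt) _; rewrite leq_pexp2l // /w; lia.
have h4 : 2 ^ 20 <= 2 ^ w by rewrite leq_pexp2l // /w; lia.
(* Five summands, each at most 2^w, fit below 8 * 2^w. *)
have h5 : 2 ^ w * 2 ^ 3 <= 2 ^ bnd_u s.
  by rewrite -expnD leq_pexp2l // /w /bnd_u; lia.
have h6 : 64 <= 2 ^ w by apply: leq_trans h4; rewrite (@leq_pexp2l 2 6 20).
have e8 : 2 ^ 3 = 8 by [].
by move: h5; rewrite e8; lia.
Qed.

Lemma bnd_addr U b x beta y : x + 64 * beta + y + 2 ^ 20 <= U -> U ^ 128 < 2 ^ b ->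
  (64 * 64 + beta) * 64 < 2 ^ b.
Proof.
move=> h; apply: leq_ltn_trans; apply: (@leq_trans U); first by lia.
by rewrite -{1}(expn1 U) leq_pexp2l //; lia.
Qed.

Lemma bnd_L_le s : bnd_L s <= 2 ^ bnd_u s.
Proof. by apply: le_exp2; rewrite /bnd_L /bnd_u; lia. Qed.

Lemma bnd_b_gt s : (2 ^ bnd_u s) ^ 128 < 2 ^ bnd_b s.
Proof. rewrite -expnM mulnC /bnd_b addn1 expnS mul2n -addnn -addn1 leq_add2l expn_gt0 //. Qed.

Lemma bnd_b_ge s : 14 <= bnd_b s.
Proof. by rewrite /bnd_b /bnd_u; lia. Qed.

Lemma alpha_program_time k (G : sgraph) : 0 < k -> k_perfect k G ->
  exists t m', [/\ exec alpha_program 0 (load_input (encode k G)) t m',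
    t <= bnd_time (input_size (encode k G)), m' 0 = Posz (alpha k G) & m' 1 = 1%Z].
Proof.
move=> k0 kP; have s_ge := input_size_ge k G.
have U_ge := bnd_U_ge s_ge (k_lt k G).
have U_b := bnd_b_gt (input_size (encode k G)).
have hbb := bnd_addr U_ge U_b.
have L_ge : nQ (#|G| * minn k #|G|) + (#|G| * #|G| + 2) <= bnd_L (input_size (encode k G)).
  apply: leq_add; last exact: s_ge.
  apply: nQ_mono; apply: leq_trans s_ge.
  by apply: leq_trans (leq_addr _ _); rewrite leq_mul2l geq_minr orbT.
have U_ge' := leq_trans (leq_addr _ _) U_ge.
exact: (alpha_program_run k0 kP U_ge' L_ge (bnd_L_le _) (bnd_b_ge _) U_b hbb).
Qed.

(** Equality with a polynomial is attainable because the time bound is built from constants, sums,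
    products and fixed powers. *)
Definition poly_bounded (f : nat -> nat) := exists p : {poly nat}, forall x, f x = p.[x]%R.

Lemma poly_const c : poly_bounded (fun=> c).
Proof. by exists (c%:P)%R => x; rewrite hornerC. Qed.
Lemma poly_id : poly_bounded id.
Proof. by exists 'X%R => x; rewrite hornerX. Qed.
Lemma poly_add f g : poly_bounded f -> poly_bounded g -> poly_bounded (fun x => f x + g x).
Proof. by move=> [p hp] [q hq]; exists (p + q)%R => x; rewrite hornerD hp hq. Qed.
Lemma poly_mul f g : poly_bounded f -> poly_bounded g -> poly_bounded (fun x => f x * g x).
Proof. by move=> [p hp] [q hq]; exists (p * q)%R => x; rewrite hornerM hp hq. Qed.
Lemma poly_exp f n : poly_bounded f -> poly_bounded (fun x => f x ^ n).
Proof.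
move=> hf; elim: n => [|n IH]; first exact: poly_const.
have [p hp] := poly_mul hf IH; exists p => x; rewrite expnS; exact: hp.
Qed.

Lemma poly_nT : poly_bounded nT.
Proof.
by apply: poly_mul; apply: poly_mul (poly_const _) (poly_exp _ poly_id).
Qed.
Lemma poly_nQ : poly_bounded nQ.
Proof.
exact: poly_mul (poly_mul (poly_const _) (poly_exp _ poly_id)) poly_nT.
Qed.
Lemma poly_nV : poly_bounded nV.
Proof.
apply: poly_mul poly_id; apply: poly_mul (poly_const _) _.
apply: poly_mul poly_nQ _.
exact: poly_mul (poly_mul (poly_const _) (poly_exp _ poly_id)) poly_nT.
Qed.
Lemma poly_ctime L c : poly_bounded L -> poly_bounded (fun x => ctime (L x) c).
Proof.
move=> hL; elim: c => [x e|a e1 e2|x e|c1 IH1 c2 IH2|x e c IH]; try exact: poly_const.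
  exact: poly_add.
exact: poly_add (poly_const _) (poly_mul hL (poly_add IH (poly_const _))).
Qed.
Lemma poly_time : poly_bounded bnd_time.
Proof.
apply: poly_mul; last apply: poly_mul (poly_const _) _.
  apply: poly_add (poly_const _); apply: poly_add (poly_const _) _.
  exact: poly_ctime (poly_add poly_nQ poly_id).
apply: poly_add (poly_const _); apply: poly_mul (poly_const _) _.
apply: poly_add (poly_const _); apply: poly_add (poly_mul (poly_const _) poly_id).
exact: poly_add (poly_mul poly_nV (poly_add poly_nQ (poly_const _))) poly_nQ.
Qed.

Theorem theorem3p6 (R : realType) :
  polytime_up_to_fixed_precision R
    (fun (k : nat) (G : sgraph) => 1 <= k /\ k_perfect k G)
    (fun (k : nat) (G : sgraph) => alpha k G)
  /\
  polytime_up_to_fixed_precision R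
    (fun (k : nat) (G : sgraph) => 1 <= k /\ k_perfect k G)
    (fun (k : nat) (G : sgraph) => Psi k (compl G)).
Proof.
have [p hp] := poly_time.
have run k G : 1 <= k /\ k_perfect k G -> forall (a : nat) (eps : R), a = alpha k G -> (0 < eps)%R ->
    exists (t : nat) (m : memory), [/\ exec alpha_program 0 (load_input (encode k G)) t m,
      t <= p.[input_size (encode k G)]%R, (0 < m 1%N)%R &
      (`|(m 0%N)%:~R / (m 1%N)%:~R - a%:R| <= eps)%R].
  case=> k0 kP a eps -> eps0; have [t [m [ex tle m0 m1]]] := alpha_program_time k0 kP.
  exists t, m; rewrite -hp m0 m1; split; [exact: ex | exact: tle | exact: ltr01 |].
  by rewrite divr1 subrr normr0 ltW.
split=> eps eps0; exists alpha_program, p => k G kG; apply: (run k G kG) => //.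
by rewrite k_perfect_eq //; case: kG.
Qed.
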